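(* Let $0<q<1$. Let $\mathcal H=\ell^2(\mathbb Z)$ with standard orthonormal basis $(e_m)_{m\in\mathbb Z}$ and let $\mathcal L=\ell^2(\mathbb Z\times\mathbb Z)$ with standard orthonormal basis $(e_{k,l})_{k,l\in\mathbb Z}$. Let $\mathbb{W}\in\mathcal U(\mathcal H\otimes\mathcal H)$, $\mathbb{W}(e_k\otimes e_l)=e_k\otimes e_{l+k}$ (a multiplicative unitary, manageable with $Q=1$). Define unitaries $$\mathbb{U}(e_{k,l}\otimes e_m)=e_{k,l}\otimes e_{m+l}\ \text{ on }\mathcal L\otimes\mathcal H,\qquad \hat{\mathbb{V}}(e_m\otimes e_{k,l})=e_m\otimes e_{k+m,l}\ \text{ on }\mathcal H\otimes\mathcal L,$$ and $\mathbb{F}:=\mathrm F_q(X)\in\mathcal U(\mathcal L\otimes\mathcal L)$, where $X$ is the normal operator on $\mathcal L\otimes\mathcal L$ with $$X(e_{k,l}\otimes e_{n,p})=q^{2(k-n)-(l+p)+1}\,e_{k,l+1}\otimes e_{n,p-1}$$ and $\mathrm F_q$ is the quantum exponential function. Then $(\mathbb{U},\hat{\mathbb{V}},\mathbb{F})$ is a manageable (top-)braided multiplicative unitary on $\mathcal L$ relative to $\mathbb{W}$.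
   Context: Normal operator $X$: $X=\Phi_X|X|$ with unitary phase $\Phi_X(e_{k,l}\otimes e_{n,p})=e_{k,l+1}\otimes e_{n,p-1}$ and strictly positive $|X|$ diagonal in the standard basis, $|X|(e_{k,l}\otimes e_{n,p})=q^{2(k-n)-(l+p)+1}e_{k,l}\otimes e_{n,p}$; these commute, and the spectrum of $X$ is $\overline{\mathbb C}_q:=\{0\}\cup\{z\in\mathbb C:|z|\in q^{\mathbb Z}\}$. (In terms of $\Upsilon e_{k,l}=q^{2k+l}e_{k,l+1}$ and $\hat{\mathcal N}e_{k,l}=l\,e_{k,l}$, $X=\Upsilon q^{-2\hat{\mathcal N}}\otimes\Upsilon^{-1}$.) $\mathrm F_q(X)$ is defined by Borel functional calculus. Quantum exponential function $\mathrm F_q\colon\overline{\mathbb C}_q\to\mathbb T$: $\mathrm F_q(z)=\prod_{k=0}^\infty\frac{1+q^{2k}\overline z}{1+q^{2k}z}$ for $z\in\overline{\mathbb C}_q\setminus\{-q^{-2k}:k=0,1,2,\dots\}$, and $\mathrm F_q(z)=-1$ for $z\in\{-q^{-2k}:k=0,1,2,\dots\}$. Leg numbering: $T_{ij}$ is $T$ acting on the $i$-th and $j$-th tensor factors. $\overline{\mathcal L}$: conjugate Hilbert space. Top-braided multiplicative unitary on $\mathcal L$ relative to a manageable multiplicative unitary $\mathbb{W}$ (''braided'' means ''top-braided''): unitaries $\mathbb{U}\in\mathcal U(\mathcal L\otimes\mathcal H)$, $\hat{\mathbb{V}}\in\mathcal U(\mathcal H\otimes\mathcal L)$, $\mathbb{F}\in\mathcal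 U(\mathcal L\otimes\mathcal L)$ with (i) $\mathbb{W}_{23}\mathbb{U}_{12}=\mathbb{U}_{12}\mathbb{U}_{13}\mathbb{W}_{23}$ on $\mathcal L\otimes\mathcal H\otimes\mathcal H$; (ii) $\hat{\mathbb{V}}_{23}\mathbb{W}_{12}=\mathbb{W}_{12}\hat{\mathbb{V}}_{13}\hat{\mathbb{V}}_{23}$ on $\mathcal H\otimes\mathcal H\otimes\mathcal L$; (iii) $\mathbb{U}_{23}\mathbb{W}_{13}\hat{\mathbb{V}}_{12}=\hat{\mathbb{V}}_{12}\mathbb{W}_{13}\mathbb{U}_{23}$ on $\mathcal H\otimes\mathcal L\otimes\mathcal H$; (iv) $\mathbb{U}_{13}\mathbb{U}_{23}\mathbb{F}_{12}=\mathbb{F}_{12}\mathbb{U}_{13}\mathbb{U}_{23}$ on $\mathcal L\otimes\mathcal L\otimes\mathcal H$; (v) $\hat{\mathbb{V}}_{13}\hat{\mathbb{V}}_{12}\mathbb{F}_{23}=\mathbb{F}_{23}\hat{\mathbb{V}}_{13}\hat{\mathbb{V}}_{12}$ on $\mathcal H\otimes\mathcal L\otimes\mathcal L$; (vi) $\mathbb{F}_{23}\mathbb{F}_{12}=\mathbb{F}_{12}B_{23}\mathbb{F}_{12}B_{23}^*\mathbb{F}_{23}$ on $\mathcal L\otimes\mathcal L\otimes\mathcal L$, where $B:=Z\Sigma$, $\Sigma$ is the flip, and $Z\in\mathcal U(\mathcal L\otimes\mathcal L)$ is the unique unitary with $Z_{13}=\hat{\mathbb{V}}_{23}\mathbb{U}_{12}^*\hat{\mathbb{V}}_{23}^*\mathbb{U}_{12}$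 on $\mathcal L\otimes\mathcal H\otimes\mathcal L$. (Here $Z(e_{k,l}\otimes e_{n,p})=e_{k,l}\otimes e_{n-l,p}$.) Manageable: with $Q$ witnessing the manageability of $\mathbb{W}$ (here $Q=1$), there are a strictly positive (positive, self-adjoint, injective) operator $Q_{\mathcal L}$ on $\mathcal L$ and a unitary $Y\in\mathcal U(\overline{\mathcal L}\otimes\mathcal L)$ such that $\mathbb{U}$ commutes with $Q_{\mathcal L}\otimes Q$, $\hat{\mathbb{V}}$ commutes with $Q\otimes Q_{\mathcal L}$, $\mathbb{F}$ commutes with $Q_{\mathcal L}\otimes Q_{\mathcal L}$, and $(x\otimes u\mid Z^*\mathbb{F}\mid y\otimes v)=(\overline y\otimes Q_{\mathcal L}u\mid Y\mid\overline x\otimes Q_{\mathcal L}^{-1}v)$ for all $x,y\in\mathcal L$, $u\in\mathcal D(Q_{\mathcal L})$, $v\in\mathcal D(Q_{\mathcal L}^{-1})$. *)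

(* Defs.v *)
From HB Require Import structures.
From mathcomp Require Import all_boot all_order all_algebra.
From mathcomp Require Import all_classical all_reals all_analysis.
From mathcomp Require Import complex.

Set Implicit Arguments.
Unset Strict Implicit.
Unset Printing Implicit Defensive.

Import Order.TTheory GRing.Theory Num.Theory numFieldNormedType.Exports.

Local Open Scope classical_set_scope.
Local Open Scope ring_scope.
Local Open Scope complex_scope.

(* Every Hilbert space is presented as l^2(I): square-summable families
   I -> R[i].  The tensor product of l^2(I) and l^2(J) is l^2(I * J).
   A bounded operator is a function on all families, and only its values on
   l^2(I) are meaningful; an unbounded operator is given by its graph. *)

Section HilbertSpace.
Variable R : realType.
Local Notation C := R[i].

Definition vec (I : choiceType) := I -> C.
Definition op (I : choiceType) := vec I -> vec I.
Definition graph (I : choiceType) := set (vec I * vec I).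

Definition norm2 (I : choiceType) (x : vec I) : \bar R :=
  \esum_(i in [set: I]) (complex.Re (x i) ^+ 2 + complex.Im (x i) ^+ 2)%:E.

Definition l2 (I : choiceType) (x : vec I) : Prop := (norm2 x < +oo)%E.

(* Unconditional sum, meaningful for absolutely summable families. *)
Definition rsum (I : choiceType) (f : I -> R) : R :=
  fine (\esum_(i in [set: I]) ((EFin \o f)^\+ i)%E) -
  fine (\esum_(i in [set: I]) ((EFin \o f)^\- i)%E).

(* Conjugate-linear in the first variable. *)
Definition ip (I : choiceType) (x y : vec I) : C :=
  rsum (fun i => complex.Re (conjc (x i) * y i)) +i*
  rsum (fun i => complex.Im (conjc (x i) * y i)).

Definition basis (I : choiceType) (i : I) : vec I := fun j => (j == i)%:R.

Definition tens (I J : choiceType) (x : vec I) (y : vec J) :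
  vec (I * J)%type := fun ij => x ij.1 * y ij.2.

(* The conjugate space of l^2(I) is identified with l^2(I) through the
   orthonormal basis of the vectors conjugate to [basis i]: the vector conjugate
   to x then has coordinates conjc (x i). *)
Definition cvec (I : choiceType) (x : vec I) : vec I := fun i => conjc (x i).

Definition linear_l2 (I : choiceType) (T : op I) : Prop :=
  forall (c : C) (x y : vec I), l2 x -> l2 y ->
    T (fun i => c * x i + y i) = (fun i => c * T x i + T y i).

Definition bounded_op (I : choiceType) (T : op I) : Prop :=
  linear_l2 T /\
  exists M : R, forall x, l2 x -> (norm2 (T x) <= M%:E * norm2 x)%E.

Definition unitary (I : choiceType) (T : op I) : Prop :=
  [/\ linear_l2 T,
      forall x, l2 x -> l2 (T x),
      forall x y, l2 x -> l2 y -> ip (T x) (T y) = ip x y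
    & forall y, l2 y -> exists2 x, l2 x & T x = y].

Definition orth_projection (I : choiceType) (P : op I) : Prop :=
  [/\ bounded_op P,
      forall x, l2 x -> P (P x) = P x
    & forall x y, l2 x -> l2 y -> ip (P x) y = ip x (P y)].

Definition eq_op_l2 (I : choiceType) (S T : op I) : Prop :=
  forall x, l2 x -> S x = T x.

(* The i-th coordinate of T^* x is ( T e_i | x ). *)
Definition adj (I : choiceType) (T : op I) : op I :=
  fun x i => ip (T (basis i)) x.

Definition flip (I : choiceType) : op (I * I)%type := fun x ij => x (ij.2, ij.1).

(* T acts on two of the three coordinates, the third one being fixed. *)
Definition leg12 (I J K : choiceType) (T : op (I * J)%type) :
    op (I * J * K)%type :=
  fun x a => T (fun b => x (b.1, b.2, a.2)) (a.1.1, a.1.2).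

Definition leg23 (I J K : choiceType) (T : op (J * K)%type) :
    op (I * J * K)%type :=
  fun x a => T (fun b => x (a.1.1, b.1, b.2)) (a.1.2, a.2).

Definition leg13 (I J K : choiceType) (T : op (I * K)%type) :
    op (I * J * K)%type :=
  fun x a => T (fun b => x (b.1, a.1.2, b.2)) (a.1.1, a.2).

Definition graph_adj (I : choiceType) (A : graph I) : graph I :=
  [set p | [/\ l2 p.1, l2 p.2
    & forall a, A a -> ip a.2 p.1 = ip a.1 p.2]].

Definition densely_defined (I : choiceType) (A : graph I) : Prop :=
  forall x, l2 x -> forall e : R, 0 < e ->
    exists2 a, A a & (norm2 (x \- a.1)%R < e%:E)%E.

Definition selfadjoint (I : choiceType) (A : graph I) : Prop :=
  densely_defined A /\ graph_adj A = A.

Definition strictly_positive (I : choiceType) (A : graph I) : Prop :=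
  [/\ selfadjoint A,
      forall a, A a -> 0 <= ip a.1 a.2
    & forall x, A (x, fun=> 0) -> x = fun=> 0].

Definition id_graph (I : choiceType) : graph I :=
  [set p | l2 p.1 /\ p.2 = p.1].

(* Closure of the algebraic tensor product of A and B. *)
Definition tens_graph (I J : choiceType) (A : graph I) (B : graph J) :
    graph (I * J)%type :=
  [set p | [/\ l2 p.1, l2 p.2 & forall e : R, 0 < e ->
    exists (n : nat) (a : 'I_n -> vec I * vec I) (b : 'I_n -> vec J * vec J),
      [/\ forall s, A (a s) /\ B (b s),
          (norm2 (fun i => p.1 i - \sum_(s < n) tens (a s).1 (b s).1 i)%R
             < e%:E)%E
        & (norm2 (fun i => p.2 i - \sum_(s < n) tens (a s).2 (b s).2 i)%R
             < e%:E)%E]]].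

(* A unitary T commutes with A when T A T^* = A. *)
Definition commutes (I : choiceType) (T : op I) (A : graph I) : Prop :=
  forall x y, l2 x -> l2 y -> A (x, y) <-> A (T x, T y).

(* Spectral measures on the complex plane, presented as R * R with the product
   of the Borel sigma-algebras. *)

Definition scalar_measure (I : choiceType) (E : set (R * R) -> op I)
    (x : vec I) (mu : {measure set (R * R) -> \bar R}) : Prop :=
  forall A, measurable A -> mu A = (complex.Re (ip x (E A x)))%:E.

Record spectral_measure (I : choiceType) (E : set (R * R) -> op I) : Prop := {
  sm_proj : forall A, measurable A -> orth_projection (E A);
  sm_setT : eq_op_l2 (E setT) id;
  sm_setI : forall A B, measurable A -> measurable B ->
    eq_op_l2 (E (A `&` B)) (E A \o E B);
  sm_sigma_additive : forall x, l2 x -> exists mu, scalar_measure E x mu }.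

Definition cint (mu : {measure set (R * R) -> \bar R}) (D : set (R * R))
    (f : C -> C) : C :=
  (\int[mu]_(z in D) complex.Re (f (z.1 +i* z.2))) +i*
  (\int[mu]_(z in D) complex.Im (f (z.1 +i* z.2))).

Record spectral_measure_of (I : choiceType) (X : graph I)
    (E : set (R * R) -> op I) : Prop := {
  smo_spectral : spectral_measure E;
  smo_domain : forall x mu, l2 x -> scalar_measure E x mu ->
    (exists y, X (x, y)) <->
    (\int[mu]_z (z.1 ^+ 2 + z.2 ^+ 2)%:E < +oo)%E;
  smo_value : forall x y mu, X (x, y) -> scalar_measure E x mu ->
    l2 y /\ ip x y = cint mu setT id }.

(* T = f(X) for a bounded Borel function f on a Borel set D that carries the
   spectral measure of the normal operator X; the values of f outside D are
   irrelevant. *)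
Definition borel_calculus (I : choiceType) (X : graph I) (D : set C)
    (f : C -> C) (T : op I) : Prop :=
  let D2 := [set z : R * R | D (z.1 +i* z.2)] in
  exists E : set (R * R) -> op I,
    [/\ spectral_measure_of X E,
        measurable D2 /\ eq_op_l2 (E (~` D2)) (fun _ _ => 0),
        bounded_op T
      & forall x mu, l2 x -> scalar_measure E x mu ->
          ip x (T x) = cint mu D2 f].

Definition manageability_identity (I : choiceType) (T T' : op (I * I)%type)
    (Q : graph I) : Prop :=
  forall x y u Qu v Qinv_v, l2 x -> l2 y -> Q (u, Qu) -> Q (Qinv_v, v) ->
    ip (tens x u) (T (tens y v)) =
    ip (tens (cvec y) Qu) (T' (tens (cvec x) Qinv_v)).

Record multiplicative_unitary (I : choiceType) (W : op (I * I)%type) : Prop := {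
  mu_unitary : unitary W;
  mu_pentagon :
    eq_op_l2 (leg23 W \o leg12 W : op (I * I * I)%type)
             (leg12 W \o leg13 W \o leg23 W) }.

(* Q witnesses the manageability of W. *)
Record manageable_by (I : choiceType) (W : op (I * I)%type) (Q : graph I) :
    Prop := {
  mb_positive : strictly_positive Q;
  mb_commutes : commutes W (tens_graph Q Q);
  mb_identity : exists2 Wt : op (I * I)%type,
    unitary Wt & manageability_identity W Wt Q }.

(* The unitary Z determined by
   Z_13 = V_23 U_12^* V_23^* U_12 on l^2(J) (x) l^2(I) (x) l^2(J). *)
Definition braiding_of (I J : choiceType) (U : op (J * I)%type)
    (V : op (I * J)%type) (Z : op (J * J)%type) : Prop :=
  unitary Z /\
  eq_op_l2 (leg13 Z : op (J * I * J)%type)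
           (leg23 V \o leg12 (adj U) \o leg23 (adj V) \o leg12 U).

Record top_braided_mu (I J : choiceType) (W : op (I * I)%type)
    (U : op (J * I)%type) (V : op (I * J)%type) (F : op (J * J)%type)
    (Z : op (J * J)%type) : Prop := {
  tb_U : unitary U;
  tb_V : unitary V;
  tb_F : unitary F;
  tb_Z : braiding_of U V Z;
  tb_WU : eq_op_l2 (leg23 W \o leg12 U : op (J * I * I)%type)
                   (leg12 U \o leg13 U \o leg23 W);
  tb_VW : eq_op_l2 (leg23 V \o leg12 W : op (I * I * J)%type)
                   (leg12 W \o leg13 V \o leg23 V);
  tb_YD : eq_op_l2 (leg23 U \o leg13 W \o leg12 V : op (I * J * I)%type)
                   (leg12 V \o leg13 W \o leg23 U);
  tb_UF : eq_op_l2 (leg13 U \o leg23 U \o leg12 F : op (J * J * I)%type)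
                   (leg12 F \o leg13 U \o leg23 U);
  tb_VF : eq_op_l2 (leg13 V \o leg12 V \o leg23 F : op (I * J * J)%type)
                   (leg23 F \o leg13 V \o leg12 V);
  tb_pentagon :
    let B := Z \o @flip J in
    eq_op_l2 (leg23 F \o leg12 F : op (J * J * J)%type)
             (leg12 F \o leg23 B \o leg12 F \o leg23 (adj B) \o leg23 F) }.

(* (U, V, F) is a manageable top-braided multiplicative unitary on l^2(J)
   relative to the manageable multiplicative unitary W on l^2(I), where Q is
   the given witness of the manageability of W. *)
Definition manageable_top_braided_mu (I J : choiceType) (W : op (I * I)%type)
    (Q : graph I) (U : op (J * I)%type) (V : op (I * J)%type)
    (F : op (J * J)%type) : Prop :=
  [/\ multiplicative_unitary W, manageable_by W Q &
   exists Z : op (J * J)%type, top_braided_mu W U V F Z /\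
   exists (QL : graph J) (Y : op (J * J)%type),
    [/\ strictly_positive QL /\ unitary Y,
        commutes U (tens_graph QL Q),
        commutes V (tens_graph Q QL),
        commutes F (tens_graph QL QL)
      & manageability_identity (adj Z \o F) Y QL]].

(* diag_graph is the self-adjoint operator diagonal in the standard basis, with
   its maximal domain. *)
Definition diag_graph (I : choiceType) (w : I -> R) : graph I :=
  [set p | [/\ l2 p.1, l2 p.2 & p.2 = (fun i => (w i)%:C * p.1 i)]].

Definition comp_graph (I : choiceType) (T : op I) (A : graph I) : graph I :=
  [set p | exists2 y, A (p.1, y) & p.2 = T y].

End HilbertSpace.

Arguments id_graph R I : clear implicits.

Section QuantumE2.
Variable R : realType.
Local Notation C := R[i].

Definition H : choiceType := int.
Definition L : choiceType := (int * int)%type.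

Definition opW : op R (H * H)%type :=
  fun x a => let: (k, m) := a in x (k, m - k).

Definition opU : op R (L * H)%type :=
  fun x a => let: (k, l, m) := a in x (k, l, m - l).

Definition opV : op R (H * L)%type :=
  fun x a => let: (m, (k, l)) := a in x (m, (k - m, l)).

Definition phaseX : op R (L * L)%type :=
  fun x a => let: (k, l, (n, p)) := a in x (k, l - 1, (n, p + 1)).

Definition weightX (q : R) (a : L * L) : R :=
  let: (k, l, (n, p)) := a in q ^ (2 * (k - n) - (l + p) + 1).

Definition opX (q : R) : graph R (L * L)%type :=
  comp_graph phaseX (diag_graph (weightX q)).

Definition Cbar_q (q : R) : set C :=
  [set z | z = 0 \/ exists m : int, `|z| = (q ^ m)%:C].

Definition climit (u : nat -> C) : C :=
  lim ((fun n => complex.Re (u n)) @ \oo) +i* lim ((fun n => complex.Im (u n)) @ \oo).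

Definition qexp (q : R) (z : C) : C :=
  if `[< exists k : nat, z = - (q ^- (2 * k))%:C >] then -1
  else climit (fun n => \prod_(k < n)
    ((1 + (q ^+ (2 * k))%:C * conjc z) / (1 + (q ^+ (2 * k))%:C * z))).

Lemma opW_basis (k l : int) :
  opW (basis R ((k, l) : (H * H)%type)) = basis R ((k, l + k) : (H * H)%type).
Proof.
apply/funext => -[a b] /=; rewrite /basis /=; congr (_%:R).
by rewrite !xpair_eqE; case: eqP => //= ->; rewrite subr_eq.
Qed.

Lemma opU_basis (k l m : int) :
  opU (basis R ((k, l, m) : (L * H)%type)) = basis R ((k, l, m + l) : (L * H)%type).
Proof.
apply/funext => -[[a b] c] /=; rewrite /basis /=; congr (_%:R).
by rewrite !xpair_eqE; case: eqP => //= _; case: eqP => //= ->; rewrite subr_eq.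
Qed.

Lemma opV_basis (m k l : int) :
  opV (basis R ((m, (k, l)) : (H * L)%type)) =
  basis R ((m, (k + m, l)) : (H * L)%type).
Proof.
apply/funext => -[c [a b]] /=; rewrite /basis /=; congr (_%:R).
by rewrite !xpair_eqE; case: eqP => //= ->; rewrite subr_eq.
Qed.

Lemma phaseX_basis (k l n p : int) :
  phaseX (basis R ((k, l, (n, p)) : (L * L)%type)) =
  basis R ((k, l + 1, (n, p - 1)) : (L * L)%type).
Proof.
apply/funext => -[[a b] [c d]] /=; rewrite /basis /=; congr (_%:R).
by rewrite !xpair_eqE subr_eq [d == _]eq_sym subr_eq [p == _]eq_sym.
Qed.

Lemma l2_scale_basis (I : choiceType) (c : C) (i : I) :
  l2 (fun j => c * basis R i j).
Proof.
rewrite /l2 /norm2 (esumID [set i]); last first.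
  by move=> j _; rewrite lee_fin addr_ge0// sqr_ge0.
rewrite setTI esum_set1; last by rewrite lee_fin addr_ge0// sqr_ge0.
rewrite esum1 ?adde0 ?ltry// => j [_ /= /eqP ji].
by rewrite /basis (negbTE ji) mulr0 /= expr0n /= addr0.
Qed.

Lemma opX_basis (q : R) (k l n p : int) :
  opX q (basis R ((k, l, (n, p)) : (L * L)%type),
    fun a => (q ^ (2 * (k - n) - (l + p) + 1))%:C *
             basis R ((k, l + 1, (n, p - 1)) : (L * L)%type) a).
Proof.
exists (fun a => (q ^ (2 * (k - n) - (l + p) + 1))%:C *
                 basis R ((k, l, (n, p)) : (L * L)%type) a) => /=.
  split=> /=; last 2 first.
  - exact: l2_scale_basis.
  - apply/funext => a; rewrite /basis.
    by case: eqP => [->|]; rewrite ?mulr0.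
  - have := l2_scale_basis 1 ((k, l, (n, p)) : (L * L)%type).
    by under eq_fun do rewrite mul1r.
rewrite -phaseX_basis; by apply/funext => -[[a b] [c d]].
Qed.

End QuantumE2.

(* Main.v *)
(** On each circle |z| = q^m the function z -> F_q(z) has Fourier coefficients
    fqc j m, an explicit q-series, so F_q(X) should be the convolution
    (CF x)(a) = sum_j fqc j (mF a) x(shF (-j) a) along the orbits of the phase
    of X, where q^(mF a) is the weight of X at a.

    The coefficients satisfy two first-order recurrences (ladder).  These give
    the symmetry fqc j m = (-q)^j fqc (-j) (m - j), Wiener bounds that are
    uniform in m, the orthogonality sum_j fqc j m fqc (j + d) m = delta_d (the
    left side scales like q^(d m) but is bounded), and the uniqueness of bounded
    solutions up to scalars (their Wronskian scales geometrically).

    F commutes with the spectral measure E of X.  On the range of E A, with A a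
    small box near |z| = q^k, vectors live on the level mF = k, where X is q^k
    times a shift; there F and CF are both close to a multiplication by F_q(z).
    Summing over a fine grid of boxes gives F = CF.

    With F = CF, the pentagon equation becomes the product formula
    fqc s a fqc t (b + s) = sum_r fqc (s - r) (a - t) fqc r (a + b - 1 - t + r) fqc (t - r) b,
    whose right side solves the recurrences in (s, a) and in (t, b), and the
    manageability identity becomes the symmetry of fqc.  The other relations
    only permute basis vectors. *)

(* The hypothesis on [F] is weak: it only gives the forms (x | F x), through some spectral measure
   [E] tied to X by its domain and its quadratic form. [E] is not explicit, so everything about it
   is extracted from forms: polarization, additivity of the scalar measures, and the growth of the
   powers of X, which locates the range of [E A] on the levels of |X|.

   The ladder splits the functional equation of F_q between the circles of radius q^m and q^(m+2)
   into two one-step relations. With the level m as a second variable, q-series rearrangements are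
   replaced by uniqueness of bounded solutions, and the free constant is read off as m grows, where
   [fqc j m] tends to delta_(j,0).

   At the exceptional points -q^(-2k) the product is 0/0; the value -1 comes from a reflection m ->
   2 - m of the coefficients. The weights q^(-l) of Q_L and the signs (-1)^j in Y come from the
   factor (-q)^j of the symmetry. *)
Require Import Defs.
From HB Require Import structures.
From mathcomp Require Import all_boot all_order all_algebra.
From mathcomp Require Import all_classical all_reals all_analysis.
From mathcomp Require Import complex measurable_realfun.
From mathcomp Require Import ring lra zify.
(* Again, because mathcomp-analysis shadows [basis]. *)
Require Import Defs.

Set Implicit Arguments.
Unset Strict Implicit.
Unset Printing Implicit Defensive.

Import Order.TTheory GRing.Theory Num.Theory numFieldNormedType.Exports.
Import ComplexField.

Local Open Scope classical_set_scope.
Local Open Scope ring_scope.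
Local Open Scope complex_scope.

(** * Unconditional sums *)

Section RealSums.
Variable R : realType.
Implicit Types (I J : choiceType).

Definition rsummable I (f : I -> R) : Prop :=
  (\esum_(i in [set: I]) `|f i|%:E < +oo)%E.

Lemma esum_fin I (f : I -> R) : (forall i, 0 <= f i) -> rsummable f ->
  (\esum_(i in [set: I]) (f i)%:E)%E \is a fin_num.
Proof.
move=> f0 sf; rewrite ge0_fin_numE; last first.
  by apply: esum_ge0 => i _; rewrite lee_fin.
apply: le_lt_trans sf; apply: le_esum => i _.
by rewrite lee_fin ler_norm.
Qed.

Lemma rsummable_le I (f g : I -> R) :
  (forall i, `|f i| <= g i) -> rsummable g -> rsummable f.
Proof.
move=> fg; apply: le_lt_trans; apply: le_esum => i _.
by rewrite lee_fin (le_trans (fg i))// ler_norm.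
Qed.

Lemma rsummable_le_norm I (f g : I -> R) :
  (forall i, `|f i| <= `|g i|) -> rsummable g -> rsummable f.
Proof.
by move=> fg; apply: le_lt_trans; apply: le_esum => i _; rewrite lee_fin.
Qed.

Lemma rsummable_bij I J (e : I -> J) (f : J -> R) : bijective e ->
  rsummable (f \o e) -> rsummable f.
Proof.
move=> be; rewrite /rsummable (reindex_esum [set: I] [set: J] e)//.
by rewrite setTT_bijective.
Qed.

Lemma rsummable_inj I J (e : I -> J) (f : J -> R) : injective e ->
  rsummable f -> rsummable (f \o e).
Proof.
move=> ie; apply: le_lt_trans.
rewrite -(esum_image [set: I] e (fun j => `|f j|%:E)%E)//; last by move=> ? ? _ _ /ie.
rewrite [leRHS](esumID (e @` [set: I]))//= setTI leeDl//.
by apply: esum_ge0.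
Qed.

Lemma rsum_bij I J (e : I -> J) (f : J -> R) : bijective e ->
  rsum (f \o e) = rsum f.
Proof.
move=> be; have sb : set_bij [set: I] [set: J] e by rewrite setTT_bijective.
rewrite /rsum [in RHS](reindex_esum _ _ _ (EFin \o f)^\+%E sb).
rewrite [X in _ = _ - fine X](reindex_esum _ _ _ (EFin \o f)^\-%E sb).
congr (fine _ - fine _); apply: eq_esum => i _.
  by rewrite !funeposE.
by rewrite !funenegE.
Qed.

Lemma eq_rsum I (f g : I -> R) : f =1 g -> rsum f = rsum g.
Proof. by move=> /funext ->. Qed.

Lemma rsummableD I (f g : I -> R) :
  rsummable f -> rsummable g -> rsummable (fun i => f i + g i).
Proof. exact: (@summableD I R setT (EFin \o f) (EFin \o g)). Qed.

Lemma rsummableN I (f : I -> R) : rsummable f -> rsummable (fun i => - f i).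
Proof. by apply: rsummable_le_norm => i; rewrite normrN. Qed.

Lemma rsummableB I (f g : I -> R) :
  rsummable f -> rsummable g -> rsummable (fun i => f i - g i).
Proof. by move=> sf sg; exact: (rsummableD sf (rsummableN sg)). Qed.

Lemma esumZ I (c : R) (f : I -> R) : 0 <= c -> (forall i, 0 <= f i) ->
  (\esum_(i in [set: I]) (c * f i)%:E = c%:E * \esum_(i in [set: I]) (f i)%:E)%E.
Proof.
rewrite le_eqVlt => /predU1P[<- f0|c0 f0].
  by rewrite mul0e esum1// => i _; rewrite mul0r.
apply/eqP; rewrite eq_le; apply/andP; split.
  apply: ge_ereal_sup => _ [A [finA _] <-].
  rewrite (eq_fsbigr (fun i => c%:E * (f i)%:E)%E)//.
  rewrite -ge0_mule_fsumr; last by move=> i; rewrite lee_fin.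
  rewrite lee_pmul2l//; apply: ereal_sup_ubound; exists A => //.
rewrite -lee_pdivlMl//; apply: ge_ereal_sup => _ [A [finA _] <-].
rewrite lee_pdivlMl// ge0_mule_fsumr; last by move=> i; rewrite lee_fin.
apply: ereal_sup_ubound; exists A => //.
Qed.

Lemma rsummableZ I (c : R) (f : I -> R) : rsummable f -> rsummable (fun i => c * f i).
Proof.
rewrite /rsummable => sf; under eq_esum do rewrite normrM.
by rewrite esumZ// lte_mul_pinfty// ?lee_fin//.
Qed.

Lemma rsummable_abs I (f : I -> R) : rsummable f -> rsummable (fun i => `|f i|).
Proof. by apply: rsummable_le_norm => i; rewrite normr_id. Qed.

(** [rsum] is defined by positive and negative parts; this admits any other decomposition into
    nonnegative summable families. Additivity rests on it, since the positive part of a sum is not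
    the sum of the positive parts. *)
Lemma rsum_sub I (f g : I -> R) : (forall i, 0 <= f i) -> (forall i, 0 <= g i) ->
  rsummable f -> rsummable g ->
  rsum (fun i => f i - g i) =
  fine (\esum_(i in [set: I]) (f i)%:E) - fine (\esum_(i in [set: I]) (g i)%:E).
Proof.
move=> f0 g0 sf sg; have sfg := rsummableB sf sg.
have Ef := esum_fin f0 sf; have Eg := esum_fin g0 sg.
have sfg' (h : I -> R) : rsummable h ->
    (\esum_(i in [set: I]) ((EFin \o h)^\+ i))%E \is a fin_num /\
    (\esum_(i in [set: I]) ((EFin \o h)^\- i))%E \is a fin_num.
  rewrite /rsummable => sh.
  split; rewrite ge0_fin_numE ?esum_ge0//; apply: le_lt_trans sh; apply: le_esum => i _.
    by rewrite funeposE/= /maxe; case: ifP; rewrite lee_fin ?ler_norm ?normr_ge0.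
  rewrite funenegE/= /maxe; case: ifP; rewrite lee_fin ?normr_ge0// => _.
  by rewrite -normrN ler_norm.
have [Ep En] := sfg' _ sfg.
rewrite /rsum -!fineB//; congr fine.
rewrite (_ : EFin \o _ = (EFin \o f) \- (EFin \o g))%E; last by apply/funext.
rewrite (@esumB R I setT (EFin \o f) (EFin \o g) sf sg)//.
  by move=> i _; rewrite lee_fin.
by move=> i _; rewrite lee_fin.
Qed.

Lemma rsumE0 I (f : I -> R) : (forall i, 0 <= f i) ->
  rsum f = fine (\esum_(i in [set: I]) (f i)%:E).
Proof.
move=> f0; rewrite /rsum [X in _ - fine X](_ : _ = 0%E) ?subr0.
  congr fine; apply: eq_esum => i _; rewrite funeposE/=.
  by apply/max_idPl; rewrite lee_fin.
by apply: esum1 => i _; rewrite funenegE/=; apply/max_idPr; rewrite lee_fin oppr_le0.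
Qed.

Lemma rsum_ge0 I (f : I -> R) : (forall i, 0 <= f i) -> 0 <= rsum f.
Proof. by move=> f0; rewrite rsumE0// fine_ge0// esum_ge0// => i _; rewrite lee_fin. Qed.

Lemma rsum_subE I (f g : I -> R) : (forall i, 0 <= f i) -> (forall i, 0 <= g i) ->
  rsummable f -> rsummable g -> rsum (fun i => f i - g i) = rsum f - rsum g.
Proof. by move=> f0 g0 sf sg; rewrite rsum_sub// !rsumE0. Qed.

Lemma rsumD0 I (f g : I -> R) : (forall i, 0 <= f i) -> (forall i, 0 <= g i) ->
  rsummable f -> rsummable g -> rsum (fun i => f i + g i) = rsum f + rsum g.
Proof.
move=> f0 g0 sf sg; rewrite !rsumE0//; last by move=> i; rewrite addr_ge0.
rewrite -fineD ?esum_fin// -esumD// => i _; by rewrite lee_fin.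
Qed.

Definition rpos I (f : I -> R) i := Num.max (f i) 0.

Lemma rpos_ge0 I (f : I -> R) i : 0 <= rpos f i.
Proof. by rewrite /rpos le_max lexx orbT. Qed.

Lemma rposB I (f : I -> R) i : f i = rpos f i - rpos (fun i => - f i) i.
Proof. by rewrite /rpos; case: (leP (f i) 0); case: (leP (- f i) 0); lra. Qed.

Lemma rpos_le I (f : I -> R) i : `|rpos f i| <= `|f i|.
Proof. by rewrite ger0_norm ?rpos_ge0// /rpos ge_max ler_norm normr_ge0. Qed.

Lemma rsummable_pos I (f : I -> R) : rsummable f -> rsummable (rpos f).
Proof. by move=> sf; apply: rsummable_le (rsummable_abs sf) => i; exact: rpos_le. Qed.

Lemma rsum_pos I (f : I -> R) : rsummable f ->
  rsum f = rsum (rpos f) - rsum (rpos (fun i => - f i)).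
Proof.
move=> sf; rewrite -rsum_subE; last 4 first.
- exact: rpos_ge0.
- exact: rpos_ge0.
- exact: rsummable_pos.
- exact/rsummable_pos/rsummableN.
by apply: eq_rsum => i; exact: rposB.
Qed.

Lemma rsumD I (f g : I -> R) : rsummable f -> rsummable g ->
  rsum (fun i => f i + g i) = rsum f + rsum g.
Proof.
move=> sf sg; have sf' := rsummableN sf; have sg' := rsummableN sg.
rewrite (rsum_pos sf) (rsum_pos sg).
transitivity (rsum (fun i => (rpos f i + rpos g i) -
    (rpos (fun i => - f i) i + rpos (fun i => - g i) i))).
  by apply: eq_rsum => i; rewrite {1}(rposB f) {1}(rposB g); lra.
rewrite rsum_subE; first by rewrite !rsumD0//; try exact: rpos_ge0; try exact: rsummable_pos; lra.
- by move=> i; rewrite addr_ge0 ?rpos_ge0.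
- by move=> i; rewrite addr_ge0 ?rpos_ge0.
- by apply: rsummableD; exact: rsummable_pos.
- by apply: rsummableD; exact: rsummable_pos.
Qed.

Lemma rsumN I (f : I -> R) : rsummable f -> rsum (fun i => - f i) = - rsum f.
Proof.
move=> sf; rewrite (rsum_pos sf) (rsum_pos (rsummableN sf)) [RHS]opprB; congr (_ - _).
by apply: eq_rsum => i; rewrite /rpos opprK.
Qed.

Lemma rsumB I (f g : I -> R) : rsummable f -> rsummable g ->
  rsum (fun i => f i - g i) = rsum f - rsum g.
Proof. by move=> sf sg; rewrite rsumD ?rsumN//; exact: rsummableN. Qed.

Lemma rsumZ0 I c (f : I -> R) : 0 <= c -> rsummable f ->
  rsum (fun i => c * f i) = c * rsum f.
Proof.
move=> c0 sf; have scf := rsummableZ c sf.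
have H (g : I -> R) : (forall i, 0 <= g i) -> rsummable g -> rsum (fun i => c * g i) = c * rsum g.
  move=> g0 sg; rewrite !rsumE0//; last by move=> i; rewrite mulr_ge0.
  by rewrite esumZ// fineM ?esum_fin.
rewrite (rsum_pos sf) mulrBr -!H; do ?[exact: rpos_ge0|exact: rsummable_pos|exact/rsummable_pos/rsummableN].
rewrite (rsum_pos scf); congr (_ - _); apply: eq_rsum => i; rewrite /rpos.
  by rewrite maxr_pMr// mulr0.
by rewrite maxr_pMr// mulr0 mulrN.
Qed.

Lemma rsumZ I c (f : I -> R) : rsummable f -> rsum (fun i => c * f i) = c * rsum f.
Proof.
move=> sf; case: (leP 0 c) => c0; first exact: rsumZ0.
rewrite -[c]opprK mulNr -rsumZ0 ?oppr_ge0 ?(ltW c0)// -rsumN; last exact: rsummableZ.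
by apply: eq_rsum => i; rewrite mulNr.
Qed.

Lemma ler_rsum I (f g : I -> R) : rsummable f -> rsummable g ->
  (forall i, f i <= g i) -> rsum f <= rsum g.
Proof.
move=> sf sg fg; rewrite -subr_ge0 -rsumB//.
by apply: rsum_ge0 => i; rewrite subr_ge0.
Qed.

Lemma ler_norm_rsum I (f : I -> R) : rsummable f -> `|rsum f| <= rsum (fun i => `|f i|).
Proof.
move=> sf; have sa := rsummable_abs sf; rewrite ler_norml -rsumN//.
apply/andP; split; apply: ler_rsum => //; last by move=> i; exact: ler_norm.
- exact: rsummableN.
- by move=> i; rewrite lerNl -normrN ler_norm.
Qed.

Lemma esum_le_rsum I (f : I -> R) M : (forall i, 0 <= f i) ->
  (\esum_(i in [set: I]) (f i)%:E <= M%:E)%E -> rsummable f /\ rsum f <= M.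
Proof.
move=> f0 fM; have sf : rsummable f.
  rewrite /rsummable; apply: le_lt_trans (ltry M); apply: le_trans fM.
  by apply: le_esum => i _; rewrite ger0_norm.
by split=> //; rewrite rsumE0// -lee_fin fineK ?esum_fin.
Qed.

Lemma rsumE0_EFin I (f : I -> R) : (forall i, 0 <= f i) -> rsummable f ->
  (\esum_(i in [set: I]) (f i)%:E = (rsum f)%:E)%E.
Proof. by move=> f0 sf; rewrite rsumE0// fineK ?esum_fin. Qed.

Lemma rsum_supp1 I (i0 : I) (f : I -> R) : (forall i, i != i0 -> f i = 0) ->
  rsummable f /\ rsum f = f i0.
Proof.
have H (g : I -> R) : (forall i, 0 <= g i) -> (forall i, i != i0 -> g i = 0) ->
    (\esum_(i in [set: I]) (g i)%:E = (g i0)%:E)%E.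
  move=> g0 gi; rewrite (esumID [set i0])//=; last by move=> i _; rewrite lee_fin.
  rewrite setTI esum_set1 ?lee_fin// esum1 ?adde0// => i [_ /= /eqP ii0].
  by rewrite gi.
move=> fi; have sf : rsummable f.
  by rewrite /rsummable H ?ltry// => i /fi ->; rewrite normr0.
split=> //; rewrite (rsum_pos sf) !rsumE0; try exact: rpos_ge0.
rewrite !H /=; first by rewrite -rposB.
all: try exact: rpos_ge0.
  by move=> i /fi E; rewrite /rpos E oppr0 maxxx.
by move=> i /fi E; rewrite /rpos E maxxx.
Qed.

Lemma rsum0 I : rsum (fun _ : I => 0 : R) = 0.
Proof. by rewrite rsumE0// esum1. Qed.

Lemma rsummable0 I : rsummable (fun _ : I => 0 : R).
Proof. by rewrite /rsummable esum1 ?ltry// => i _; rewrite normr0. Qed.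

Lemma rsum_seq I (s : seq I) (f : I -> R) : uniq s ->
  rsummable (fun i => if i \in s then f i else 0) /\
  rsum (fun i => if i \in s then f i else 0) = \sum_(i <- s) f i.
Proof.
elim: s => [_|i s IH /= /andP[nis us]].
  by rewrite big_nil /=; split; [exact: rsummable0|exact: rsum0].
have [ss sE] := IH us.
have E : (fun j => if j \in i :: s then f j else 0) =
    (fun j => (if j == i then f j else 0) + (if j \in s then f j else 0)).
  apply/funext => j; rewrite inE; case: eqP => [->|_] /=; last by rewrite add0r.
  by rewrite (negbTE nis) addr0.
have [|s1 s1E] := @rsum_supp1 _ i (fun j => if j == i then f j else 0).
  by move=> j /negbTE ->.
by rewrite E; split; [exact: rsummableD|rewrite rsumD// s1E eqxx sE big_cons].
Qed.

Lemma rsummable_pair I J (f : I * J -> R) :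
  (forall i, rsummable (fun j => f (i, j))) ->
  rsummable (fun i => rsum (fun j => `|f (i, j)|)) -> rsummable f.
Proof.
move=> sf srf; rewrite /rsummable.
have := @esum_esum R I J setT (fun _ => setT) (fun i j => `|f (i, j)|%:E)%E.
rewrite (_ : [set: I] `*`` _ = setT); last by apply/seteqP; split.
rewrite (_ : (fun k => _) = (fun i => `|f i|%:E)); last by apply/funext => -[].
move=> <-//; have := srf; rewrite /rsummable; apply: le_lt_trans.
apply: le_esum => i _; rewrite ger0_norm ?rsum_ge0//.
by rewrite rsumE0_EFin//; exact: rsummable_abs.
Qed.

Lemma rsum_pair0 I J (f : I * J -> R) : (forall p, 0 <= f p) -> rsummable f ->
  [/\ forall i, rsummable (fun j => f (i, j)),
      rsummable (fun i => rsum (fun j => f (i, j))) &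
      rsum f = rsum (fun i => rsum (fun j => f (i, j)))].
Proof.
move=> f0 sf; have si i : rsummable (fun j => f (i, j)).
  by apply: (rsummable_inj (e := fun j => (i, j)) _ sf) => j j' [].
have := @esum_esum R I J setT (fun _ => setT) (fun i j => (f (i, j))%:E)%E.
rewrite (_ : [set: I] `*`` _ = setT); last by apply/seteqP; split.
rewrite (_ : (fun k => _) = (fun i => (f i)%:E)); last by apply/funext => -[].
under eq_esum do rewrite rsumE0_EFin//.
move=> E; have {}E := E (fun _ _ _ _ => f0 _).
have [||s1 _] := @esum_le_rsum _ (fun i => rsum (fun j => f (i, j))) (rsum f).
- by move=> i; exact: rsum_ge0.
- by rewrite E rsumE0_EFin.
split=> //; rewrite [LHS]rsumE0// -E rsumE0// => i; exact: rsum_ge0.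
Qed.

(** Fubini: Tonelli ([rsum_pair0]) for the positive and the negative part separately. *)
Lemma rsum_pair I J (f : I * J -> R) : rsummable f ->
  [/\ forall i, rsummable (fun j => f (i, j)),
      rsummable (fun i => rsum (fun j => f (i, j))) &
      rsum f = rsum (fun i => rsum (fun j => f (i, j)))].
Proof.
move=> sf; have si i : rsummable (fun j => f (i, j)).
  by apply: (rsummable_inj (e := fun j => (i, j)) _ sf) => j j' [].
have [a1 b1 c1] := rsum_pair0 (@rpos_ge0 _ f) (rsummable_pos sf).
have [a2 b2 c2] := rsum_pair0 (@rpos_ge0 _ (fun p => - f p)) (rsummable_pos (rsummableN sf)).
have E : (fun i => rsum (fun j => f (i, j))) =
   (fun i => rsum (fun j => rpos f (i, j)) - rsum (fun j => rpos (fun p => - f p) (i, j))).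
  apply/funext => i; rewrite -rsumB//; by apply: eq_rsum => j; rewrite -rposB.
rewrite E; split=> //; first exact: rsummableB.
by rewrite rsumB// -c1 -c2 -rsum_pos.
Qed.

End RealSums.

(** * Complex unconditional sums *)

Section ComplexSums.
Variable R : realType.
Local Notation C := R[i].
Local Notation normc := Normc.normc.
Implicit Types (I J : choiceType).

Lemma normc_ge0 (z : C) : 0 <= normc z.
Proof. by case: z => a b; exact: sqrtr_ge0. Qed.

Lemma normcE2 (z : C) : normc z ^+ 2 = complex.Re z ^+ 2 + complex.Im z ^+ 2.
Proof. by case: z => a b /=; rewrite sqr_sqrtr// addr_ge0 ?sqr_ge0. Qed.

Lemma normr_Re (z : C) : `|complex.Re z| <= normc z.
Proof.
by rewrite -ler_sqr ?nnegrE ?normc_ge0// normcE2 real_normK ?num_real// lerDl sqr_ge0.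
Qed.

Lemma normr_Im (z : C) : `|complex.Im z| <= normc z.
Proof.
by rewrite -ler_sqr ?nnegrE ?normc_ge0// normcE2 real_normK ?num_real// lerDr sqr_ge0.
Qed.

Lemma normc_le (z : C) : normc z <= `|complex.Re z| + `|complex.Im z|.
Proof.
rewrite -ler_sqr ?nnegrE ?normc_ge0 ?addr_ge0// normcE2 sqrrD !real_normK ?num_real//.
rewrite -addrA lerD2l lerDr mulrn_wge0// mulr_ge0//.
Qed.

Lemma normc_real (a : R) : normc a%:C = `|a|.
Proof. by rewrite /= expr0n addr0 sqrtr_sqr. Qed.

Lemma normc_conj (z : C) : normc (conjc z) = normc z.
Proof. by case: z => a b /=; rewrite sqrrN. Qed.

Lemma normc0 : normc (0 : C) = 0. Proof. exact: Normc.normc0. Qed.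
Lemma normc1 : normc (1 : C) = 1. Proof. exact: Normc.normc1. Qed.
Lemma normcM (x y : C) : normc (x * y) = normc x * normc y.
Proof. exact: Normc.normcM. Qed.
Lemma normcD (x y : C) : normc (x + y) <= normc x + normc y.
Proof. exact: le_normcD. Qed.
Lemma normcB (x y : C) : normc (x - y) <= normc x + normc y.
Proof. by rewrite -[normc y]normcN; exact: le_normcD. Qed.
Lemma normcX (x : C) n : normc (x ^+ n) = normc x ^+ n.
Proof. by elim: n => [|n IH]; rewrite ?expr0 ?normc1// !exprS normcM IH. Qed.

Lemma conjcD (x y : C) : conjc (x + y) = conjc x + conjc y.
Proof. exact: rmorphD. Qed.
Lemma conjcB (x y : C) : conjc (x - y) = conjc x - conjc y.
Proof. exact: rmorphB. Qed.
Lemma conjcN (x : C) : conjc (- x) = - conjc x.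
Proof. exact: rmorphN. Qed.
Lemma conjcM (x y : C) : conjc (x * y) = conjc x * conjc y.
Proof. exact: rmorphM. Qed.

Lemma realCD (x y : R) : (x + y)%:C = x%:C + y%:C.
Proof. exact: rmorphD. Qed.
Lemma realCM (x y : R) : (x * y)%:C = x%:C * y%:C.
Proof. exact: rmorphM. Qed.
Lemma realCB (x y : R) : (x - y)%:C = x%:C - y%:C.
Proof. exact: rmorphB. Qed.
Lemma realC_eq0 (x : R) : (x%:C == 0) = (x == 0).
Proof. by rewrite eq_complex /= eqxx andbT. Qed.

Lemma mul_conjc (z : C) : conjc z * z = (normc z ^+ 2)%:C.
Proof.
by rewrite normcE2; case: z => a b; apply/eqP; rewrite eq_complex/=; apply/andP; split; apply/eqP; lra.
Qed.

Definition csummable I (f : I -> C) : Prop := rsummable (fun i => normc (f i)).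
Definition csum I (f : I -> C) : C :=
  rsum (fun i => complex.Re (f i)) +i* rsum (fun i => complex.Im (f i)).

Lemma csummable_Re I (f : I -> C) : csummable f -> rsummable (fun i => complex.Re (f i)).
Proof. by apply: rsummable_le => i; exact: normr_Re. Qed.

Lemma csummable_Im I (f : I -> C) : csummable f -> rsummable (fun i => complex.Im (f i)).
Proof. by apply: rsummable_le => i; exact: normr_Im. Qed.

Lemma csummable_le I (f : I -> C) (g : I -> R) : (forall i, normc (f i) <= g i) ->
  rsummable g -> csummable f.
Proof. by move=> fg; apply: rsummable_le => i; rewrite ger0_norm ?normc_ge0. Qed.

Lemma csummableD I (f g : I -> C) :
  csummable f -> csummable g -> csummable (fun i => f i + g i).
Proof.
by move=> sf sg; apply: csummable_le (rsummableD sf sg) => i; exact: normcD.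
Qed.

Lemma csummableZ I c (f : I -> C) : csummable f -> csummable (fun i => c * f i).
Proof.
by move=> /(rsummableZ (normc c)); apply: csummable_le => i; rewrite normcM.
Qed.

Lemma csummableN I (f : I -> C) : csummable f -> csummable (fun i => - f i).
Proof. by apply: csummable_le => i; rewrite normcN. Qed.

Lemma csummableB I (f g : I -> C) :
  csummable f -> csummable g -> csummable (fun i => f i - g i).
Proof. by move=> sf /csummableN sg; exact: csummableD. Qed.

Lemma csummable_bij I J (e : I -> J) (f : J -> C) : bijective e ->
  csummable (f \o e) -> csummable f.
Proof. exact: rsummable_bij. Qed.

Lemma csummable_inj I J (e : I -> J) (f : J -> C) : injective e ->
  csummable f -> csummable (f \o e).
Proof. by move=> ie; exact: (@rsummable_inj _ _ _ e (fun j => normc (f j))). Qed.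

Lemma eq_csum I (f g : I -> C) : f =1 g -> csum f = csum g.
Proof. by move=> /funext ->. Qed.

Lemma csum_bij I J (e : I -> J) (f : J -> C) : bijective e ->
  csum (f \o e) = csum f.
Proof.
move=> be; rewrite /csum -(rsum_bij (fun j => complex.Re (f j)) be).
by rewrite -(rsum_bij (fun j => complex.Im (f j)) be).
Qed.

Lemma csumD I (f g : I -> C) : csummable f -> csummable g ->
  csum (fun i => f i + g i) = csum f + csum g.
Proof.
move=> sf sg; rewrite /csum; apply/eqP; rewrite eq_complex/=; apply/andP; split; apply/eqP.
  rewrite -rsumD; [|exact: csummable_Re|exact: csummable_Re].
  by apply: eq_rsum => i; case: (f i) => a b; case: (g i).
rewrite -rsumD; [|exact: csummable_Im|exact: csummable_Im].
by apply: eq_rsum => i; case: (f i) => a b; case: (g i).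
Qed.

Lemma csumZ I c (f : I -> C) : csummable f -> csum (fun i => c * f i) = c * csum f.
Proof.
move=> sf; have sr := csummable_Re sf; have si := csummable_Im sf.
case: c => a b; rewrite /csum; apply/eqP; rewrite eq_complex/=; apply/andP; split; apply/eqP.
  rewrite -!rsumZ// -rsumB; [|exact: rsummableZ|exact: rsummableZ].
  by apply: eq_rsum => i; case: (f i).
rewrite -!rsumZ// -rsumD; [|exact: rsummableZ|exact: rsummableZ].
by apply: eq_rsum => i; case: (f i) => u v /=; lra.
Qed.

Lemma csumN I (f : I -> C) : csummable f -> csum (fun i => - f i) = - csum f.
Proof.
move=> sf; rewrite -mulN1r -csumZ//; by apply: eq_csum => i; rewrite mulN1r.
Qed.

Lemma csumB I (f g : I -> C) : csummable f -> csummable g ->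
  csum (fun i => f i - g i) = csum f - csum g.
Proof. by move=> sf sg; rewrite csumD ?csumN//; exact: csummableN. Qed.

Lemma csum_conj I (f : I -> C) : csummable f ->
  csum (fun i => conjc (f i)) = conjc (csum f).
Proof.
move=> sf; have si := csummable_Im sf; rewrite /csum/= -rsumN//.
by congr (_ +i* _); apply: eq_rsum => i; case: (f i).
Qed.

Lemma csum_real I (f : I -> R) : csum (fun i => (f i)%:C) = (rsum f)%:C.
Proof. by rewrite /csum rsum0. Qed.

(** Multiplying by the conjugate of the sum s makes it real: |s|^2 is the sum of Re (conj s f_i),
    hence at most |s| times the sum of the |f_i|. Bounding real and imaginary parts separately would
    lose a constant. *)
Lemma normc_csum I (f : I -> C) : csummable f ->
  normc (csum f) <= rsum (fun i => normc (f i)).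
Proof.
move=> sf; have [->|s0] := eqVneq (csum f) 0.
  by rewrite normc0 rsum_ge0// => i; exact: normc_ge0.
have [s sE] : exists s, s = csum f by exists (csum f).
rewrite -!sE in s0 *.
have n0 : 0 < normc s.
  rewrite lt_def normc_ge0 andbT; apply: contra s0 => /eqP E.
  by apply/eqP; exact: Normc.eq0_normc.
have E : complex.Re (conjc s * s) = rsum (fun i => complex.Re (conjc s * f i)).
  by rewrite {2}sE -csumZ.
have H : normc s ^+ 2 <= normc s * rsum (fun i => normc (f i)).
  rewrite mul_conjc/= in E; rewrite E -rsumZ//; apply: ler_rsum.
  - by apply: csummable_Re; exact: csummableZ.
  - exact: rsummableZ.
  - move=> i; apply: le_trans (ler_norm _) _; apply: le_trans (normr_Re _) _.
    by rewrite normcM normc_conj.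
by move: H; rewrite expr2 ler_pM2l.
Qed.

Lemma csum_supp1 I (i0 : I) (f : I -> C) : (forall i, i != i0 -> f i = 0) ->
  csummable f /\ csum f = f i0.
Proof.
move=> fi; split.
  by have [] := @rsum_supp1 R I i0 (fun i => normc (f i)); first by move=> i /fi ->; rewrite normc0.
have [|_ Er] := @rsum_supp1 R I i0 (fun i => complex.Re (f i)); first by move=> i /fi ->.
have [|_ Ei] := @rsum_supp1 R I i0 (fun i => complex.Im (f i)); first by move=> i /fi ->.
by rewrite /csum Er Ei; case: (f i0).
Qed.

Lemma csum0 I : csum (fun _ : I => 0 : C) = 0.
Proof. by rewrite /csum !rsum0. Qed.

Lemma csummable0 I : csummable (fun _ : I => 0 : C).
Proof. by rewrite /csummable; rewrite (_ : (fun _ => _) = fun=> 0) ?normc0//; exact: rsummable0. Qed.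

Lemma csum_seq I (s : seq I) (f : I -> C) : uniq s ->
  csummable (fun i => if i \in s then f i else 0) /\
  csum (fun i => if i \in s then f i else 0) = \sum_(i <- s) f i.
Proof.
elim: s => [_|i s IH /= /andP[nis us]].
  by rewrite big_nil /=; split; [exact: csummable0|exact: csum0].
have [ss sE] := IH us.
have E : (fun j => if j \in i :: s then f j else 0) =
    (fun j => (if j == i then f j else 0) + (if j \in s then f j else 0)).
  apply/funext => j; rewrite inE; case: eqP => [->|_] /=; last by rewrite add0r.
  by rewrite (negbTE nis) addr0.
have [|s1 s1E] := @csum_supp1 _ i (fun j => if j == i then f j else 0).
  by move=> j /negbTE ->.
by rewrite E; split; [exact: csummableD|rewrite csumD// s1E eqxx sE big_cons].
Qed.

Lemma csum_pair I J (f : I * J -> C) : csummable f ->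
  [/\ forall i, csummable (fun j => f (i, j)),
      csummable (fun i => csum (fun j => f (i, j))) &
      csum f = csum (fun i => csum (fun j => f (i, j)))].
Proof.
move=> sf; have [s1 s2 _] := rsum_pair sf.
have [r1 r2 r3] := rsum_pair (csummable_Re sf).
have [i1 i2 i3] := rsum_pair (csummable_Im sf).
split=> //; last by rewrite /csum r3 i3.
by apply: csummable_le s2 => i; exact: normc_csum (s1 i).
Qed.

Lemma csum_exchange I J (f : I -> J -> C) : csummable (fun p : I * J => f p.1 p.2) ->
  csum (fun i => csum (fun j => f i j)) = csum (fun j => csum (fun i => f i j)).
Proof.
move=> sf; have [_ _ /= <-] := csum_pair sf.
have bs : bijective (fun p : J * I => (p.2, p.1)).
  by exists (fun p => (p.2, p.1)) => -[].
rewrite -(csum_bij _ bs).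
have [|_ _ /= <-//] := @csum_pair J I (fun p => f p.2 p.1).
by apply: (csummable_bij (e := fun p : I * J => (p.2, p.1))) => //; exists (fun p => (p.2, p.1)) => -[].
Qed.

End ComplexSums.

Local Arguments ip : simpl never.
Local Arguments csum : simpl never.

(** * Square-summable families *)

Section HilbertSpaces.
Variable R : realType.
Local Notation C := R[i].
Local Notation normc := Normc.normc.
Implicit Types (I J : choiceType).

Definition sqn I (x : vec R I) : R := rsum (fun i => normc (x i) ^+ 2).

Lemma norm2_normc I (x : vec R I) :
  norm2 x = (\esum_(i in [set: I]) (normc (x i) ^+ 2)%:E)%E.
Proof. by apply: eq_esum => i _; rewrite normcE2. Qed.

Lemma l2P I (x : vec R I) : l2 x <-> rsummable (fun i => normc (x i) ^+ 2).
Proof.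
rewrite /l2 norm2_normc /rsummable.
by rewrite [in X in _ <-> X](eq_esum (b := fun i => (normc (x i) ^+ 2)%:E))// => i _; rewrite ger0_norm ?sqr_ge0.
Qed.

Lemma norm2E I (x : vec R I) : l2 x -> norm2 x = (sqn x)%:E.
Proof. by move=> /l2P lx; rewrite norm2_normc rsumE0_EFin// => i; rewrite sqr_ge0. Qed.

Lemma sqn_ge0 I (x : vec R I) : 0 <= sqn x.
Proof. by apply: rsum_ge0 => i; rewrite sqr_ge0. Qed.

Lemma norm2_le I (x : vec R I) M : (norm2 x <= M%:E)%E -> l2 x /\ sqn x <= M.
Proof.
rewrite norm2_normc => /esum_le_rsum[]; first by move=> i; rewrite sqr_ge0.
by move=> sx xM; split=> //; apply/l2P.
Qed.

Lemma norm2_lt I (x : vec R I) M : (norm2 x < M%:E)%E -> l2 x /\ sqn x < M.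
Proof.
move=> xM; have [lx _] := norm2_le (ltW xM); split=> //.
by rewrite -lte_fin -norm2E.
Qed.

Lemma l2_le I J (x : vec R I) (y : vec R J) (e : J -> I) :
  injective e -> (forall j, normc (y j) <= normc (x (e j))) -> l2 x -> l2 y.
Proof.
move=> ie yx /l2P lx; apply/l2P; have := rsummable_inj ie lx.
apply: rsummable_le_norm => j /=; rewrite !ger0_norm ?sqr_ge0//.
by rewrite lerXn2r ?nnegrE ?normc_ge0.
Qed.

Lemma l2_comp I J (x : vec R I) (e : J -> I) : injective e -> l2 x ->
  l2 (fun j => x (e j)).
Proof. by move=> ie; apply: (l2_le (e := e)). Qed.

Lemma sqn_comp I J (x : vec R I) (e : J -> I) : bijective e ->
  sqn (fun j => x (e j)) = sqn x.
Proof. by move=> be; rewrite /sqn -(rsum_bij _ be). Qed.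

Lemma sqrD_le (a b : R) : (a + b) ^+ 2 <= 2 * a ^+ 2 + 2 * b ^+ 2.
Proof. by rewrite -subr_ge0 (_ : _ - _ = (a - b) ^+ 2) ?sqr_ge0//; ring. Qed.

Lemma l2D I (x y : vec R I) : l2 x -> l2 y -> l2 (fun i => x i + y i).
Proof.
move=> /l2P lx /l2P ly; apply/l2P.
have := rsummableD (rsummableZ 2 lx) (rsummableZ 2 ly).
apply: rsummable_le => i; rewrite ger0_norm ?sqr_ge0//.
apply: le_trans (sqrD_le _ _); rewrite lerXn2r ?nnegrE ?addr_ge0 ?normc_ge0//.
exact: normcD.
Qed.

Lemma sqnD_le I (x y : vec R I) : l2 x -> l2 y ->
  sqn (fun i => x i + y i) <= 2 * sqn x + 2 * sqn y.
Proof.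
move=> lx ly; have /l2P lxy := l2D lx ly; move: lx ly => /l2P lx /l2P ly.
rewrite /sqn -!rsumZ// -rsumD; [|exact: rsummableZ|exact: rsummableZ].
apply: ler_rsum => //; first by apply: rsummableD; exact: rsummableZ.
move=> i; apply: le_trans (sqrD_le _ _); rewrite lerXn2r ?nnegrE ?addr_ge0 ?normc_ge0//.
exact: normcD.
Qed.

Lemma l2Z I c (x : vec R I) : l2 x -> l2 (fun i => c * x i).
Proof.
move=> /l2P lx; apply/l2P; have := rsummableZ (normc c ^+ 2) lx.
by apply: rsummable_le => i; rewrite normcM exprMn ger0_norm// mulr_ge0 ?sqr_ge0.
Qed.

Lemma sqnZ I c (x : vec R I) : l2 x -> sqn (fun i => c * x i) = normc c ^+ 2 * sqn x.
Proof.
by move=> /l2P lx; rewrite /sqn -rsumZ//; apply: eq_rsum => i; rewrite normcM exprMn.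
Qed.

Lemma l2N I (x : vec R I) : l2 x -> l2 (fun i => - x i).
Proof. by apply: (l2_le (e := id)) => // i; rewrite normcN. Qed.

Lemma sqnN I (x : vec R I) : sqn (fun i => - x i) = sqn x.
Proof. by apply: eq_rsum => i; rewrite normcN. Qed.

Lemma l2B I (x y : vec R I) : l2 x -> l2 y -> l2 (fun i => x i - y i).
Proof. by move=> lx /l2N ly; exact: (l2D lx ly). Qed.

Lemma sqnB_le I (x y : vec R I) : l2 x -> l2 y ->
  sqn (fun i => x i - y i) <= 2 * sqn x + 2 * sqn y.
Proof. by move=> lx ly; have := sqnD_le lx (l2N ly); rewrite sqnN. Qed.

Lemma l2_0 I : l2 (fun _ : I => 0 : C).
Proof.
apply/l2P; rewrite (_ : (fun _ => _) = fun=> 0); first exact: rsummable0.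
by apply/funext => i; rewrite normc0 expr0n.
Qed.

Lemma basis_same I (i : I) : basis R i i = 1.
Proof. by rewrite /basis eqxx. Qed.

Lemma basis_neq I (i j : I) : j != i -> basis R i j = 0.
Proof. by move=> /negbTE ji; rewrite /basis ji. Qed.

Lemma l2_basis I (i : I) : l2 (basis R i).
Proof.
apply/l2P; have [] := @rsum_supp1 R I i (fun j => normc (basis R i j) ^+ 2) => //.
by move=> j ji; rewrite (basis_neq ji) normc0 expr0n.
Qed.

Lemma sqn_basis I (i : I) : sqn (basis R i) = 1.
Proof.
have [|_ E] := @rsum_supp1 R I i (fun j => normc (basis R i j) ^+ 2).
  by move=> j ji; rewrite (basis_neq ji) normc0 expr0n.
by rewrite /sqn E basis_same normc1 expr1n.
Qed.

Lemma l2_conj I (x : vec R I) : l2 x -> l2 (cvec x).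
Proof. by apply: (l2_le (e := id)) => // i; rewrite normc_conj. Qed.

Lemma csummable_ip I (x y : vec R I) : l2 x -> l2 y ->
  csummable (fun i => conjc (x i) * y i).
Proof.
move=> /l2P lx /l2P ly; have := rsummableD lx ly.
apply: csummable_le => i; rewrite normcM normc_conj.
have := sqr_ge0 (normc (x i) - normc (y i)).
have := mulr_ge0 (normc_ge0 (x i)) (normc_ge0 (y i)); nra.
Qed.

Lemma ipE I (x y : vec R I) : ip x y = csum (fun i => conjc (x i) * y i).
Proof. by []. Qed.

Lemma ipDr I (x y z : vec R I) : l2 x -> l2 y -> l2 z ->
  ip x (fun i => y i + z i) = ip x y + ip x z.
Proof.
move=> lx ly lz; rewrite !ipE -csumD; [|exact: csummable_ip|exact: csummable_ip].
by apply: eq_csum => i; rewrite mulrDr.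
Qed.

Lemma ipZr I c (x y : vec R I) : l2 x -> l2 y ->
  ip x (fun i => c * y i) = c * ip x y.
Proof.
move=> lx ly; rewrite !ipE -csumZ; last exact: csummable_ip.
by apply: eq_csum => i; rewrite mulrCA.
Qed.

Lemma ip_conj I (x y : vec R I) : l2 x -> l2 y -> conjc (ip x y) = ip y x.
Proof.
move=> lx ly; rewrite !ipE -csum_conj; last exact: csummable_ip.
by apply: eq_csum => i; rewrite conjcM conjcK mulrC.
Qed.

Lemma ipDl I (x y z : vec R I) : l2 x -> l2 y -> l2 z ->
  ip (fun i => x i + y i) z = ip x z + ip y z.
Proof.
move=> lx ly lz; rewrite -[LHS](ip_conj lz (l2D lx ly)) ipDr// conjcD.
by rewrite (ip_conj lz lx) (ip_conj lz ly).
Qed.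

Lemma ipZl I c (x y : vec R I) : l2 x -> l2 y ->
  ip (fun i => c * x i) y = conjc c * ip x y.
Proof.
move=> lx ly; rewrite -[LHS](ip_conj ly (l2Z c lx)) ipZr// conjcM.
by rewrite (ip_conj ly lx).
Qed.

Lemma ipNr I (x y : vec R I) : l2 x -> l2 y -> ip x (fun i => - y i) = - ip x y.
Proof.
move=> lx ly; rewrite -mulN1r -ipZr//; congr ip; apply/funext => i; by rewrite mulN1r.
Qed.

Lemma ipBr I (x y z : vec R I) : l2 x -> l2 y -> l2 z ->
  ip x (fun i => y i - z i) = ip x y - ip x z.
Proof. by move=> lx ly lz; rewrite ipDr ?ipNr//; exact: l2N. Qed.

Lemma ipxx I (x : vec R I) : ip x x = (sqn x)%:C.
Proof. by rewrite ipE -csum_real; apply: eq_csum => i; rewrite mul_conjc. Qed.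

Lemma ip0r I (x : vec R I) : ip x (fun=> 0) = 0.
Proof. by rewrite ipE -[RHS](csum0 R I); apply: eq_csum => i; rewrite mulr0. Qed.

Lemma ip_basisl I (i : I) (x : vec R I) : ip (basis R i) x = x i.
Proof.
have [|_ E] := @csum_supp1 R I i (fun j => conjc (basis R i j) * x j).
  by move=> j ji; rewrite (basis_neq ji) conjc0 mul0r.
by rewrite ipE E basis_same conjc1 mul1r.
Qed.

Lemma ip_basisr I (i : I) (x : vec R I) : ip x (basis R i) = conjc (x i).
Proof.
have [|_ E] := @csum_supp1 R I i (fun j => conjc (x j) * basis R i j).
  by move=> j ji; rewrite (basis_neq ji) mulr0.
by rewrite ipE E basis_same mulr1.
Qed.

Lemma normc_le_sqn I (x : vec R I) i : l2 x -> normc (x i) ^+ 2 <= sqn x.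
Proof.
move=> lx; rewrite -lee_fin -norm2E// norm2_normc (esumID [set i])//=; last first.
  by move=> j _; rewrite lee_fin sqr_ge0.
rewrite setTI esum_set1 ?lee_fin ?sqr_ge0// leeDl// esum_ge0// => j _.
by rewrite lee_fin sqr_ge0.
Qed.

Lemma sqn_eq0 I (x : vec R I) : l2 x -> sqn x = 0 -> x = fun=> 0.
Proof.
move=> lx x0; apply/funext => i; apply: Normc.eq0_normc; apply/eqP.
have := normc_le_sqn i lx; rewrite x0 => H.
by rewrite -sqrf_eq0; apply/eqP/le_anti; rewrite H sqr_ge0.
Qed.

Lemma sqnD I (x y : vec R I) : l2 x -> l2 y ->
  sqn (fun i => x i + y i) = sqn x + sqn y + 2 * complex.Re (ip x y).
Proof.
move=> lx ly; have lxy := l2D lx ly.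
rewrite -[LHS]/(complex.Re (sqn _)%:C) -ipxx ipDr ?ipDl// !ipxx -(ip_conj lx ly).
by case: (ip x y) => a b /=; lra.
Qed.

Lemma rsum_approx I (f : I -> R) (e : R) : (forall i, 0 <= f i) -> rsummable f ->
  0 < e -> exists2 s : seq I, uniq s & rsum f - e < \sum_(i <- s) f i.
Proof.
move=> f0 sf e0; have fin := esum_fin f0 sf.
have [_ [A [finA _] <-]] := ub_ereal_sup_adherent e0 fin.
rewrite -/(esum _ _) rsumE0_EFin// fsbig_finite// => H.
exists (finmap.enum_fset (fset_set A)); first exact: finmap.fset_uniq.
by rewrite -lte_fin EFinB (lt_le_trans H)// sumEFin.
Qed.

Definition trunc I (s : seq I) (x : vec R I) : vec R I :=
  fun i => if i \in s then x i else 0.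

Lemma truncE I (s : seq I) (x : vec R I) : uniq s ->
  trunc s x = fun i => \sum_(j <- s) x j * basis R j i.
Proof.
move=> us; apply/funext => i; rewrite /trunc; case: ifPn => [is_|nis].
  rewrite (bigD1_seq i)//= basis_same mulr1 big1 ?addr0// => j ji.
  by rewrite basis_neq ?mulr0// eq_sym.
rewrite big_seq big1// => j js; rewrite basis_neq ?mulr0//.
by apply: contraNneq nis => ->.
Qed.

Lemma l2_trunc I (s : seq I) (x : vec R I) : uniq s -> l2 (trunc s x).
Proof.
move=> us; apply/l2P; have [] := rsum_seq (fun i => normc (x i) ^+ 2) us.
rewrite (_ : (fun i => if _ then _ else _) = fun i => normc (trunc s x i) ^+ 2)//.
by apply/funext => i; rewrite /trunc; case: ifP => // _; rewrite normc0 expr0n.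
Qed.

Lemma sqn_trunc_le I (s : seq I) (x : vec R I) e : uniq s -> l2 x ->
  sqn x - e < \sum_(i <- s) normc (x i) ^+ 2 ->
  sqn (fun i => x i - trunc s x i) < e.
Proof.
move=> us lx H; move: (lx) => /l2P sx.
have [s1 s2] := rsum_seq (fun i => normc (x i) ^+ 2) us.
rewrite (_ : sqn _ = sqn x - \sum_(i <- s) normc (x i) ^+ 2); first by lra.
rewrite -s2 /sqn -rsumB//; apply: eq_rsum => i; rewrite /trunc.
by case: ifP => _; rewrite ?subrr ?normc0 ?expr0n// !subr0.
Qed.

Lemma l2_approx I (x : vec R I) e : l2 x -> 0 < e ->
  exists2 s : seq I, uniq s & sqn (fun i => x i - trunc s x i) < e.
Proof.
move=> lx e0; move: (lx) => /l2P sx.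
have [s us H] := rsum_approx (fun i => sqr_ge0 (normc (x i))) sx e0.
by exists s => //; exact: sqn_trunc_le.
Qed.

(** One finite set has to serve both vectors: a point of a graph is approximated together with its
    image. *)
Lemma l2_approx2 I (x y : vec R I) e : l2 x -> l2 y -> 0 < e ->
  exists2 s : seq I, uniq s & sqn (fun i => x i - trunc s x i) < e /\
    sqn (fun i => y i - trunc s y i) < e.
Proof.
move=> lx ly e0; have [s us xs] := l2_approx lx e0; have [t ut yt] := l2_approx ly e0.
exists (undup (s ++ t)); first exact: undup_uniq.
have H (z : vec R I) (r : seq I) : l2 z -> uniq r -> {subset r <= undup (s ++ t)} ->
    sqn (fun i => z i - trunc r z i) < e ->
    sqn (fun i => z i - trunc (undup (s ++ t)) z i) < e.
  move=> lz ur sub; apply: le_lt_trans.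
  have /l2P H1 := l2B lz (l2_trunc z ur).
  have /l2P H2 := l2B lz (l2_trunc z (undup_uniq (s ++ t))).
  apply: ler_rsum => // i; rewrite lerXn2r ?nnegrE ?normc_ge0// /trunc.
  case: (ifP (i \in undup _)) => H; first by rewrite subrr normc0 normc_ge0.
  by case: ifP => // /sub; rewrite H.
split; [apply: (H x s)|apply: (H y t)] => // i; rewrite mem_undup mem_cat => ->//.
by rewrite orbT.
Qed.

Lemma linear_l2D I (T : op R I) x y : linear_l2 T -> l2 x -> l2 y ->
  T (fun i => x i + y i) = fun i => T x i + T y i.
Proof.
move=> lT lx ly; have := lT 1 x y lx ly.
by under eq_fun do rewrite mul1r; under [in RHS]eq_fun do rewrite mul1r.
Qed.

Lemma linear_l20 I (T : op R I) : linear_l2 T -> T (fun=> 0) = fun=> 0.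
Proof.
move=> lT; have := lT (-1) _ _ (l2_0 I) (l2_0 I).
rewrite (_ : (fun i : I => -1 * 0 + 0) = fun=> 0); last by apply/funext => i; rewrite mulr0 addr0.
by move=> ->; apply/funext => i; rewrite mulN1r addNr.
Qed.

Lemma linear_l2Z I (T : op R I) c x : linear_l2 T -> l2 x ->
  T (fun i => c * x i) = fun i => c * T x i.
Proof.
move=> lT lx; have := lT c x _ lx (l2_0 I).
rewrite (linear_l20 lT).
by under eq_fun do rewrite addr0; under [in RHS]eq_fun do rewrite addr0.
Qed.

Lemma linear_l2N I (T : op R I) x : linear_l2 T -> l2 x ->
  T (fun i => - x i) = fun i => - T x i.
Proof.
move=> lT lx; have := linear_l2Z (-1) lT lx.
by under eq_fun do rewrite mulN1r; under [in RHS]eq_fun do rewrite mulN1r.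
Qed.

Lemma linear_l2B I (T : op R I) x y : linear_l2 T -> l2 x -> l2 y ->
  T (fun i => x i - y i) = fun i => T x i - T y i.
Proof.
by move=> lT lx ly; rewrite linear_l2D ?(linear_l2N lT ly)//; exact: l2N.
Qed.

Lemma bounded_l2 I (T : op R I) : bounded_op T ->
  exists2 M, 0 <= M & forall x, l2 x -> l2 (T x) /\ sqn (T x) <= M * sqn x.
Proof.
move=> [_ [M HM]]; exists (Num.max M 0); first by rewrite le_max lexx orbT.
move=> x lx; have := HM x lx; rewrite (norm2E lx) -EFinM => /norm2_le[lT TM].
split=> //; apply: le_trans TM _; rewrite ler_wpM2r ?sqn_ge0// le_max lexx//.
Qed.

Lemma bounded_op_ext I (S T : op R I) : bounded_op S -> bounded_op T ->
  (forall i, S (basis R i) = T (basis R i)) -> eq_op_l2 S T.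
Proof.
move=> bS bT ST x lx; have [MS MS0 HS] := bounded_l2 bS; have [MT MT0 HT] := bounded_l2 bT.
case: bS bT => lS _ [lT _].
have tr s : uniq s -> S (trunc s x) = T (trunc s x).
  elim: s => [_|j s IH /= /andP[nj us]].
    by rewrite (_ : trunc [::] x = fun=> 0) ?(linear_l20 lS) ?(linear_l20 lT).
  rewrite (_ : trunc (j :: s) x = fun i => x j * basis R j i + trunc s x i).
    rewrite (lS _ _ _ (l2_basis j) (l2_trunc x us)) (lT _ _ _ (l2_basis j) (l2_trunc x us)).
    by rewrite (IH us) ST.
  rewrite !truncE//=; last by rewrite nj.
  by apply/funext => i; rewrite big_cons.
have lSx := (HS x lx).1; have lTx := (HT x lx).1.
have lST := l2B lSx lTx.
suff E : sqn (fun i => S x i - T x i) = 0.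
  have := sqn_eq0 lST E => /funeqP H; apply/funext => i.
  by apply/eqP; rewrite -subr_eq0; apply/eqP; exact: H.
apply/eqP; rewrite eq_le sqn_ge0 andbT; apply/ler_addgt0Pl => e e0; rewrite addr0.
(* On the tail u the two images differ by at most 2 (MS + MT) sqn u in squared norm; the extra 1
   keeps the denominator positive. *)
pose d := e / (2 * (MS + MT) + 1).
have M0 : 0 < 2 * (MS + MT) + 1 by rewrite ltr_wpDl// mulr_ge0// addr_ge0.
have d0 : 0 < d by rewrite divr_gt0.
have [s us xs] := l2_approx lx d0.
set u := fun i => x i - trunc s x i in xs.
have lt := l2_trunc x us; have lu : l2 u := l2B lx lt.
have E : (fun i => S x i - T x i) = fun i => S u i - T u i.
  by rewrite /u (linear_l2B lS lx lt) (linear_l2B lT lx lt) tr//; apply/funext => i; ring.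
rewrite E; have [lSu Su] := HS u lu; have [lTu Tu] := HT u lu.
apply: le_trans (sqnB_le lSu lTu) _.
apply: (@le_trans _ _ ((2 * (MS + MT) + 1) * sqn u)).
  by have := sqn_ge0 u; nra.
by rewrite mulrC -ler_pdivlMr// -/d ltW.
Qed.

End HilbertSpaces.

(** * Fourier coefficients of the quantum exponential function *)

Section IntSums.
Variable R : realType.
Implicit Type p : R.

Lemma rsummable_nat_geo p : 0 <= p < 1 -> rsummable (fun n : nat => p ^+ n).
Proof.
move=> /andP[p0 p1]; have p1' : 0 < 1 - p by rewrite subr_gt0.
rewrite /rsummable -(nneseries_esumT (a := fun n => `|p ^+ n|%:E)); last by [].
apply: (@le_lt_trans _ _ (1 - p)^-1%:E); last exact: ltry.
apply: lime_le; first exact: is_cvg_nneseries.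
apply: nearW => n; rewrite sumEFin lee_fin.
have -> : \sum_(0 <= i < n) `|p ^+ i| = (1 - p ^+ n) / (1 - p).
  elim: n => [|n IH]; first by rewrite big_nil expr0 subrr mul0r.
  rewrite big_nat_recr//= IH ger0_norm ?exprn_ge0// exprS; field; lra.
rewrite -[leRHS]mul1r ler_pM2r ?invr_gt0// gerBl; exact: exprn_ge0.
Qed.

Definition int_of_bool_nat (b : bool * nat) : int := if b.1 then Posz b.2 else Negz b.2.

Lemma int_of_bool_nat_bij : bijective int_of_bool_nat.
Proof.
exists (fun z => match z with Posz n => (true, n) | Negz n => (false, n) end).
  by move=> [[] n].
by case.
Qed.

Lemma rsummable_geo p : 0 <= p < 1 -> rsummable (fun j : int => p ^+ `|j|%N).
Proof.
move=> p01; apply: rsummable_bij int_of_bool_nat_bij _.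
have sg := rsummable_nat_geo p01; case/andP: p01 => p0 p1.
apply: rsummable_pair => [[]|]; first exact: sg.
  apply: rsummable_le sg => n; rewrite /= ger0_norm ?exprn_ge0//.
  by rewrite ler_wiXn2l// ?ltW.
set f := (X in rsummable X).
have [] := rsum_seq f (s := [:: true; false]); first by [].
by rewrite (_ : (fun i => _) = f)//; apply/funext => -[].
Qed.

Lemma bernoulli (d : R) n : 0 <= d -> n%:R * d <= (1 + d) ^+ n.
Proof.
move=> d0; apply: (@le_trans _ _ (1 + n%:R * d)); first by rewrite lerDr.
elim: n => [|n IH]; first by rewrite mul0r addr0 expr0.
rewrite exprS -natr1; have : 0 <= (n%:R : R) by exact: ler0n.
have : 1 <= 1 + d by lra.
move: ((1 + d) ^+ n) IH => x; nra.
Qed.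

(** Bernoulli absorbs the factor |j| into a geometric series whose ratio r lies between p and 1. *)
Lemma rsummable_geo1 p : 0 < p < 1 -> rsummable (fun j : int => `|j|%N%:R * p ^+ `|j|%N).
Proof.
move=> /andP[p0 p1]; pose r := (1 + p) / 2; pose d := r / p - 1.
have r01 : 0 <= r < 1 by rewrite /r; lra.
have d0 : 0 < d by rewrite subr_gt0 ltr_pdivlMr// mul1r /r; lra.
have := rsummableZ d^-1 (rsummable_geo r01); apply: rsummable_le => j.
have p0' := ltW p0; rewrite ger0_norm ?mulr_ge0 ?exprn_ge0//.
have -> : r = p * (1 + d) by rewrite /d addrC subrK mulrC divfK// gt_eqF.
rewrite exprMn mulrCA mulrC ler_wpM2l ?exprn_ge0//.
by rewrite mulrC ler_pdivlMr// bernoulli// ltW.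
Qed.

Lemma int_ind_pm (P : int -> Prop) : P 0 -> (forall n, P n -> P (n + 1)) ->
  (forall n, P n -> P (n - 1)) -> forall n, P n.
Proof.
move=> P0 PS PP [] n.
  by elim: n => [//|n IH]; rewrite -addn1 PoszD; exact: PS.
by elim: n => [|n IH]; [exact: (PP 0)|rewrite NegzE -[n.+2]addn1 PoszD opprD -NegzE; exact: PP].
Qed.

End IntSums.

Section Coefficients.
Variables (R : realType) (q : R).
Hypothesis hq : 0 < q < 1.

Let q0 : 0 < q. Proof. by case/andP: hq. Qed.
Let q1 : q < 1. Proof. by case/andP: hq. Qed.
Let qn0 : q != 0. Proof. by rewrite gt_eqF. Qed.

Lemma qz_gt0 (n : int) : 0 < q ^ n. Proof. exact: exprz_gt0. Qed.
Lemma qz_ge0 (n : int) : 0 <= q ^ n. Proof. exact/ltW/qz_gt0. Qed.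
Lemma qzD (m n : int) : q ^ (m + n) = q ^ m * q ^ n. Proof. exact: expfzDr. Qed.
Lemma qzN (n : int) : q ^ (- n) = (q ^ n)^-1.
Proof. by rewrite -exprN1 exprz_exp mulrN1. Qed.
Lemma qz_le (m n : int) : m <= n -> q ^ n <= q ^ m.
Proof.
move=> mn; rewrite -(subrK m n) addrC qzD -[leRHS]mulr1 ler_pM2l ?qz_gt0//.
have : 0 <= n - m by rewrite subr_ge0.
by case: (n - m) => // k _; rewrite -exprnP exprn_ile1// ltW.
Qed.
Lemma qz_abs (n : int) : q ^+ `|n|%N = q ^ `|n|.
Proof. by rewrite exprnP abszE. Qed.

(** This is 1 / (q^2; q^2)_n. With the value 0 at negative n, the recurrence [ipoch_rec] holds at
    every integer, so that sums over all of Z have no boundary terms. *)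
Definition ipoch (n : int) : R :=
  if n is Posz k then (\prod_(i < k) (1 - q ^+ (2 * i.+1)))^-1 else 0.

Lemma one_sub_qX_gt0 k : 0 < 1 - q ^+ (2 * k.+1).
Proof. by rewrite subr_gt0 mulnC exprM exprn_ilt1 ?exprn_ge0 ?ltW// exprn_ilt1// ltW. Qed.

Lemma ipoch_rec (n : int) : ipoch (n - 1) = (1 - q ^ (2 * n)) * ipoch n.
Proof.
case: n => [[|k]|k]; first by rewrite mulr0 expr0z subrr mul0r.
  rewrite (_ : Posz k.+1 - 1 = k)%R; last by lia.
  rewrite /= big_ord_recr/= invfM mulrCA.
  by rewrite (_ : q ^ (2 * k.+1)%R = q ^+ (2 * k.+1)) ?divff ?mulr1// gt_eqF ?one_sub_qX_gt0.
by rewrite (_ : Negz k - 1 = Negz k.+1)%R ?mulr0//; lia.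
Qed.

Lemma ipoch_ge0 n : 0 <= ipoch n.
Proof.
by case: n => //= k; rewrite invr_ge0 prodr_ge0// => i _; exact/ltW/one_sub_qX_gt0.
Qed.

Definition ipoch_bound : R := expR ((1 - q)^-1 / (1 - q ^+ 2)).

(** Each factor 1 / (1 - q^(2k+2)) is at most 1 + q^k / (1 - q^2), hence at most exp (q^k / (1 -
    q^2)); [ipoch_bound] sums these exponents as a geometric series. *)
Lemma ipoch_le n : ipoch n <= ipoch_bound.
Proof.
have q2 : 0 < 1 - q ^+ 2 by have := one_sub_qX_gt0 0.
have q1' : 0 < 1 - q by rewrite subr_gt0.
case: n => [k|k]; last exact: expR_ge0.
apply: (@le_trans _ _ (expR ((1 - q ^+ k) / (1 - q) / (1 - q ^+ 2)))); last first.
  rewrite ler_expR ler_pM2r ?invr_gt0// -[leRHS]mul1r ler_pM2r ?invr_gt0//.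
  by rewrite gerBl exprn_ge0// ltW.
elim: k => [|k IH]; first by rewrite /= big_ord0 invr1 expr0 subrr !mul0r expR0.
have -> : ipoch k.+1 = ipoch k / (1 - q ^+ (2 * k.+1)).
  by rewrite /= big_ord_recr/= invfM.
have -> : (1 - q ^+ k.+1) / (1 - q) / (1 - q ^+ 2) =
    (1 - q ^+ k) / (1 - q) / (1 - q ^+ 2) + q ^+ k / (1 - q ^+ 2).
  by rewrite exprS; field; rewrite !gt_eqF.
rewrite expRD ler_pM ?ipoch_ge0 ?invr_ge0 ?(ltW (one_sub_qX_gt0 k))//.
have := expR_ge1Dxn 0 (divr_ge0 (exprn_ge0 k (ltW q0)) (ltW q2)).
rewrite expr1 divr1; apply: le_trans.
have t0 := one_sub_qX_gt0 k.
rewrite -[(1 - q ^+ (2 * k.+1))^-1]mul1r ler_pdivrMr//.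
have t1 : q ^+ (2 * k.+1) <= q ^+ 2 by rewrite ler_wiXn2l ?ltW// leq_pmulr.
have t2 : q ^+ (2 * k.+1) <= q ^+ k by rewrite ler_wiXn2l ?ltW//; lia.
have t3 : 0 <= q ^+ (2 * k.+1) by rewrite exprn_ge0// ltW.
have t4 : q ^+ (2 * k.+1) <= q ^+ k / (1 - q ^+ 2) * (1 - q ^+ (2 * k.+1)).
  rewrite mulrAC ler_pdivlMr//.
  by apply: ler_pM => //; lra.
lra.
Qed.

(* Euler's expansions: the product of
     prod_k (1 + q^(2k) q^m z^-1) = sum_a q^(a(a-1)) q^(m a) z^-a / (q^2; q^2)_a and
     prod_k (1 + q^(2k) q^m z)^-1 = sum_b (-q^m z)^b / (q^2; q^2)_b
   has the coefficient sum_a (cterm j m a) at z^j (b = a + j).  The second series needs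
   q^m < 1, but the coefficient makes sense for every integer m. *)
Definition cterm (j m a : int) : R :=
  (-1) ^ (a + j) * q ^ (m * (2 * a + j) + a * (a - 1)) * (ipoch a * ipoch (a + j)).

Definition fqc (j m : int) : R := locked (rsum (cterm j m)).

Lemma fqcE j m : fqc j m = rsum (cterm j m).
Proof. by rewrite /fqc -lock. Qed.

Lemma norm_sign (n : int) : `|(-1) ^ n : R| = 1.
Proof. by rewrite expN1r normrX normrN1 expr1n. Qed.

(** Only a >= 0 matters because [ipoch a] vanishes for a < 0. The power q^|a| is set aside for
    summability in a, while [e] collects the decay in j and m. *)
Lemma cterm_le (j m a e : int) :
  (0 <= a -> a + e <= m * (2 * a + j) + a * (a - 1)) ->
  `|cterm j m a| <= ipoch_bound ^+ 2 * q ^ e * q ^+ `|a|%N.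
Proof.
move=> H; rewrite /cterm !normrM norm_sign mul1r (ger0_norm (qz_ge0 _)).
have b0 : 0 <= ipoch_bound by exact: expR_ge0.
rewrite !(ger0_norm (ipoch_ge0 _)).
case: (leP 0 a) => a0; last first.
  case: a a0 {H} => // k _; rewrite [ipoch (Negz k)]/= mul0r mulr0.
  by rewrite !mulr_ge0 ?sqr_ge0 ?qz_ge0 ?exprn_ge0// ltW.
rewrite -mulrA qz_abs (ger0_norm a0) -qzD mulrC ler_pM ?mulr_ge0 ?ipoch_ge0 ?qz_ge0//.
  by rewrite expr2 ler_pM ?ipoch_ge0 ?ipoch_le.
by apply: qz_le; rewrite addrC H.
Qed.

Lemma cterm_summable j m : rsummable (cterm j m).
Proof.
have q01 : 0 <= q < 1 by rewrite q1 ltW.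
have := rsummableZ (ipoch_bound ^+ 2 * q ^ (m * j - (m - 1) ^+ 2)) (rsummable_geo q01).
apply: rsummable_le => a; apply: cterm_le => a0.
(* Completing the square: the quadratic growth in a wins over the linear term whatever the sign of
   m. *)
have -> : m * (2 * a + j) + a * (a - 1) = a + (m * j - (m - 1) ^+ 2) + (a + m - 1) ^+ 2.
  by ring.
by rewrite lerDl sqr_ge0.
Qed.

Lemma cterm_A j m a :
  cterm j m a + q ^ m * cterm (j - 1) m a = q ^ j * cterm j (m + 1) a.
Proof.
rewrite /cterm.
rewrite (_ : (m + 1) * (2 * a + j) + a * (a - 1) =
  (m * (2 * a + (j - 1)) + a * (a - 1)) + m + (2 * (a + j)) - j); last by ring.
rewrite (_ : m * (2 * a + j) + a * (a - 1) =
  (m * (2 * a + (j - 1)) + a * (a - 1)) + m); last by ring.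
rewrite (_ : a + (j - 1) = a + j - 1); last by ring.
rewrite ipoch_rec !qzD [(-1) ^ (a + j - 1)]expfzDr ?oppr_eq0 ?oner_eq0//.
rewrite (_ : (-1) ^ (-1) = -1 :> R); last by rewrite expN1r expr1.
rewrite qzN.
have := qz_gt0 j; move: (q ^ j) => qj qj0.
by field; rewrite gt_eqF.
Qed.

(** Where [cterm_A] applies [ipoch_rec] to the factor of index a + j, this relation applies it to
    the factor of index a, so neighbouring terms get mixed. *)
Lemma cterm_B j m a :
  cterm j (m + 1) (a + 1) + q ^ (m - 1) * cterm (j + 1) (m + 1) a = q ^ j * cterm j m (a + 1).
Proof.
have E : ipoch a = (1 - q ^ (2 * (a + 1))) * ipoch (a + 1).
  by rewrite -ipoch_rec addrK.
rewrite /cterm.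
rewrite (_ : a + (j + 1) = a + 1 + j); last by ring.
set N := m * (2 * (a + 1) + j) + (a + 1) * (a + 1 - 1).
have -> : (m + 1) * (2 * (a + 1) + j) + (a + 1) * (a + 1 - 1) = N + j + 2 * (a + 1).
  by rewrite /N; ring.
have -> : (m + 1) * (2 * a + (j + 1)) + a * (a - 1) = N + j - (m - 1).
  by rewrite /N; ring.
rewrite E (qzD _ (2 * (a + 1))) (qzD _ (- (m - 1))) (qzD N j) (qzN (m - 1)).
by field; rewrite gt_eqF ?qz_gt0.
Qed.

(** For the generating series G_a(z) = sum_s g s a z^s these are, formally, (1 + q^a z) G_a(z) =
    G_(a+1)(q z) and (1 + q^(a-1) / z) G_(a+1)(z) = G_a(q z). *)
Definition ladder (g : int -> int -> R) : Prop :=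
  (forall s a, g s a + q ^ a * g (s - 1) a = q ^ s * g s (a + 1)) /\
  (forall s a, g s (a + 1) + q ^ (a - 1) * g (s + 1) (a + 1) = q ^ s * g s a).

Lemma addr_bij (z : int) : bijective (fun a => a + z).
Proof. by exists (fun a => a - z) => a; rewrite ?addrK ?subrK. Qed.

Lemma fqc_ladder : ladder fqc.
Proof.
split=> s a; rewrite !fqcE.
  rewrite -!rsumZ; [|exact: cterm_summable|exact: cterm_summable].
  rewrite -rsumD; [|exact: cterm_summable|exact/rsummableZ/cterm_summable].
  by apply: eq_rsum => b; exact: cterm_A.
rewrite -(rsum_bij (cterm s (a + 1)) (addr_bij 1)) -(rsum_bij (cterm s a) (addr_bij 1)).
have sc m : rsummable (cterm s m \o (fun a => a + 1)).
  by apply: rsummable_inj; [exact/bij_inj/addr_bij|exact: cterm_summable].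
rewrite -!rsumZ//; last exact: cterm_summable.
rewrite -rsumD//; last exact/rsummableZ/cterm_summable.
by apply: eq_rsum => b /=; exact: cterm_B.
Qed.

Lemma ladderB g h (c : R) : ladder g -> ladder h -> ladder (fun s a => g s a - c * h s a).
Proof.
move=> [gA gB] [hA hB]; split=> s a.
  by rewrite [in RHS]mulrBr [q ^ s * (c * _)]mulrCA -gA -hA; ring.
by rewrite [in RHS]mulrBr [q ^ s * (c * _)]mulrCA -gB -hB; ring.
Qed.

(** Powers of q do not vanish, so the second relation yields column s + 1 from column s and the
    first one yields column s - 1. *)
Lemma ladder_col g : ladder g -> (forall a, g 0 a = 0) -> forall s a, g s a = 0.
Proof.
move=> [gA gB] g0; apply: int_ind_pm => // s gs a.
  have := gB s (a - 1); rewrite subrK !gs mulr0 add0r => /eqP.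
  by rewrite mulf_eq0 (gt_eqF (qz_gt0 _)) => /eqP.
have := gA s a; rewrite !gs mulr0 add0r => /eqP.
by rewrite mulf_eq0 (gt_eqF (qz_gt0 _)) => /eqP.
Qed.

Lemma ladder_row g b : ladder g -> (forall s, g s b = 0) -> forall s a, g s a = 0.
Proof.
move=> [gA gB] gb; suff H a s : g s (b + a) = 0 by move=> s a; have := H (a - b) s; rewrite addrC subrK.
move: a s; apply: int_ind_pm => [s|a ga s|a ga s]; first by rewrite addr0.
  have := gA s (b + a); rewrite !ga mulr0 add0r addrA => /esym/eqP.
  by rewrite mulf_eq0 (gt_eqF (qz_gt0 _)) => /eqP.
have := gB s (b + (a - 1)); rewrite (_ : b + (a - 1) + 1 = b + a); last by ring.
rewrite !ga mulr0 add0r => /esym/eqP.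
by rewrite mulf_eq0 (gt_eqF (qz_gt0 _)) => /eqP.
Qed.

(** The map (s, a) -> (- s, a - s), together with the factor (-q)^s, exchanges the two ladder
    relations. Both sides are thus solutions, and they agree in the column s = 0. *)
Lemma fqc_sym j m : fqc j m = (- q) ^ j * fqc (- j) (m - j).
Proof.
have [fA fB] := fqc_ladder.
have nq0 : - q != 0 by rewrite oppr_eq0.
have gl : ladder (fun s a => (- q) ^ s * fqc (- s) (a - s)).
  split=> s a /=.
    rewrite (_ : a - (s - 1) = a - s + 1); last by ring.
    rewrite (_ : - (s - 1) = - s + 1); last by ring.
    rewrite (_ : a + 1 - s = a - s + 1); last by ring.
    have := fB (- s) (a - s).
    rewrite (_ : a - s - 1 = a - 1 - s); last by ring.
    rewrite [q ^ (a - 1 - s)]qzD [q ^ (a - 1)]qzD [(-q) ^ (s - 1)]expfzDr//.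
    rewrite (_ : (- q) ^ (-1) = - q^-1); last by rewrite exprN1 invrN.
    rewrite qzN.
    rewrite (_ : q ^ (-1) = q^-1); last by rewrite exprN1.
    have := qz_gt0 s; move: (q ^ s) => qs qs0 E.
    have -> : fqc (- s) (a - s) = qs * (fqc (- s) (a - s + 1) +
       q ^ a * q^-1 * qs^-1 * fqc (- s + 1) (a - s + 1)).
      by rewrite E mulrA divff ?mul1r// gt_eqF.
    by field; rewrite qn0 gt_eqF.
  rewrite (_ : a + 1 - (s + 1) = a - s); last by ring.
  rewrite (_ : - (s + 1) = - s - 1); last by ring.
  rewrite (_ : a + 1 - s = a - s + 1); last by ring.
  have := fA (- s) (a - s).
  rewrite [q ^ (a - s)]qzD [q ^ (a - 1)]qzD [(-q) ^ (s + 1)]expfzDr//.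
  rewrite (_ : (- q) ^ 1 = - q); last by [].
  rewrite qzN.
  rewrite (_ : q ^ (-1) = q^-1); last by rewrite exprN1.
  have := qz_gt0 s; move: (q ^ s) => qs qs0 E.
  have -> : fqc (- s) (a - s + 1) = qs * (fqc (- s) (a - s) + q ^ a * qs^-1 * fqc (- s - 1) (a - s)).
    by rewrite E mulrA divff ?mul1r// gt_eqF.
  by field; rewrite qn0 gt_eqF.
have := ladder_col (ladderB 1 fqc_ladder gl) _ j m.
rewrite mul1r => /(_ _)/eqP; rewrite subr_eq0 => H; apply/eqP/H => a.
by rewrite expr0z oppr0 subr0 !mul1r subrr.
Qed.

(** The map (s, a) -> (s + 1 - a, 2 - a) exchanges the two relations and fixes the row a = 1, where
    the solutions therefore agree. It carries the levels m <= 0 to levels >= 2, where the series can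
    be estimated directly. *)
Lemma fqc_reflect j m : fqc j m = fqc (j + 1 - m) (2 - m).
Proof.
have [fA fB] := fqc_ladder.
have gl : ladder (fun s a => fqc (s + 1 - a) (2 - a)).
  split=> s a /=.
    have := fB (s - a) (1 - a).
    rewrite (_ : 1 - a + 1 = 2 - a); last by ring.
    rewrite (_ : s - a + 1 = s + 1 - a); last by ring.
    rewrite (_ : s - 1 + 1 - a = s - a); last by ring.
    rewrite (_ : s + 1 - (a + 1) = s - a); last by ring.
    rewrite (_ : 2 - (a + 1) = 1 - a); last by ring.
    rewrite (_ : 1 - a - 1 = - a); last by ring.
    rewrite [q ^ (s - a)]qzD qzN.
    have := qz_gt0 a; move: (q ^ a) => qa qa0 E.
    have -> : q ^ s * fqc (s - a) (1 - a) = qa * (q ^ s / qa * fqc (s - a) (1 - a)).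
      by field; rewrite gt_eqF.
    by rewrite -E; field; rewrite gt_eqF.
  have := fA (s + 1 - a) (1 - a).
  rewrite (_ : 1 - a + 1 = 2 - a); last by ring.
  rewrite (_ : s + 1 - a - 1 = s - a); last by ring.
  rewrite (_ : s + 1 - (a + 1) = s - a); last by ring.
  rewrite (_ : s + 1 + 1 - (a + 1) = s + 1 - a); last by ring.
  rewrite (_ : 2 - (a + 1) = 1 - a); last by ring.
  rewrite (_ : s + 1 - a = s - (a - 1)); last by ring.
  rewrite [q ^ (s - (a - 1))]qzD.
  rewrite (_ : 1 - a = - (a - 1)); last by ring.
  rewrite qzN.
  have := qz_gt0 (a - 1); move: (q ^ (a - 1)) => qa qa0 E.
  have -> : q ^ s * fqc (s - (a - 1)) (2 - a) = qa * (q ^ s / qa * fqc (s - (a - 1)) (2 - a)).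
    by field; rewrite gt_eqF.
  by rewrite -E; field; rewrite gt_eqF.
have := ladder_row (b := 1) (ladderB 1 fqc_ladder gl) _ j m.
rewrite mul1r => /(_ _)/eqP; rewrite subr_eq0 => H; apply/eqP/H => s.
by rewrite addrK (_ : 2 - 1 = 1 :> int)// mul1r subrr.
Qed.

End Coefficients.

(** * Uniform bounds, decay and orthogonality of the coefficients *)

Section CoefficientBounds.
Variables (R : realType) (q : R).
Hypothesis hq : 0 < q < 1.
Local Notation fqc := (fqc q).
Local Notation ladder := (ladder q).

Let q0 : 0 < q. Proof. by case/andP: hq. Qed.
Let q1 : q < 1. Proof. by case/andP: hq. Qed.
Let qn0 : q != 0. Proof. by rewrite gt_eqF. Qed.
Let q01 : 0 <= q < 1. Proof. by rewrite q1 ltW. Qed.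

Lemma geo_small (M e : R) : 0 < e -> exists N : nat, forall n : nat, (N <= n)%N -> M * q ^+ n < e.
Proof.
move=> e0; pose d := q^-1 - 1.
have d0 : 0 < d by rewrite subr_gt0 invf_gt1.
exists (Num.bound (`|M| / (e * d))) => n Nn.
have H : `|M| / (e * d) < n%:R.
  apply: lt_le_trans (archi_boundP _) _; first by rewrite divr_ge0// mulr_ge0 ?ltW.
  by rewrite ler_nat.
have qn : 0 < q ^+ n by exact: exprn_gt0.
apply: le_lt_trans (ler_norm _) _; rewrite normrM (gtr0_norm qn).
have B := bernoulli n (ltW d0); rewrite (_ : 1 + d = q^-1) in B; last by rewrite /d; ring.
rewrite ltr_pdivrMr in H; last by rewrite mulr_gt0.
rewrite -ltr_pdivlMr// -exprVn; apply: lt_le_trans H _.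
by rewrite mulrCA ler_pM2l.
Qed.

(** Limit arguments below are phrased this way: a quantity independent of n is bounded by an
    explicit geometric sequence. *)
Lemma geo_bounded_eq0 (x M : R) : (forall n : nat, `|x| <= M * q ^+ n) -> x = 0.
Proof.
move=> H; apply/eqP; rewrite -normr_eq0 eq_le normr_ge0 andbT leNgt.
apply/negP => x0; have [N HN] := geo_small M x0.
by have := HN N (leqnn N); rewrite ltNge H.
Qed.

Definition geo_sum : R := locked (rsum (fun j : int => q ^+ `|j|%N)).
Definition fqc_bound : R := locked (ipoch_bound q ^+ 2 * geo_sum).
Definition wiener_bound : R := locked (fqc_bound * geo_sum).

Lemma geo_sumE : geo_sum = rsum (fun j : int => q ^+ `|j|%N).
Proof. by rewrite /geo_sum -lock. Qed.

Lemma fqc_boundE : fqc_bound = ipoch_bound q ^+ 2 * geo_sum.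
Proof. by rewrite /fqc_bound -lock. Qed.

Lemma wiener_boundE : wiener_bound = fqc_bound * geo_sum.
Proof. by rewrite /wiener_bound -lock. Qed.

Lemma geo_sum_ge0 : 0 <= geo_sum.
Proof. by rewrite geo_sumE; apply: rsum_ge0 => j; rewrite exprn_ge0// ltW. Qed.

Lemma fqc_bound_ge0 : 0 <= fqc_bound.
Proof. by rewrite fqc_boundE mulr_ge0 ?sqr_ge0 ?geo_sum_ge0. Qed.

Lemma wiener_bound_ge0 : 0 <= wiener_bound.
Proof. by rewrite wiener_boundE mulr_ge0 ?fqc_bound_ge0 ?geo_sum_ge0. Qed.

Lemma norm_mqz (n : int) : `|(- q) ^ n| = q ^ n.
Proof. by rewrite -mulN1r expfzMl normrM norm_sign mul1r gtr0_norm ?qz_gt0. Qed.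

(** For j >= 0 the exponent of q in each term of the series is at least a + m j. For j < 0,
    [fqc_sym] loses a factor q^j but raises the level to m - j, which gains q^(j^2). *)
Lemma fqc_pos_le (j m : int) : 1 <= m -> `|fqc j m| <= fqc_bound * q ^ (m * `|j|).
Proof.
move=> m1; wlog j0 : j m m1 / 0 <= j => [H|].
  case: (leP 0 j) => [j0|j0]; first exact: H.
  rewrite (fqc_sym hq) normrM norm_mqz.
  apply: (@le_trans _ _ (q ^ j * (fqc_bound * q ^ ((m - j) * `|- j|)))).
    by rewrite ler_pM2l ?qz_gt0// H//; lia.
  rewrite mulrCA ler_wpM2l ?fqc_bound_ge0// -qzD//; apply: qz_le => //.
  rewrite normrN (ltr0_norm j0); nia.
rewrite (ger0_norm j0) fqcE fqc_boundE mulrAC geo_sumE -rsumZ; last exact: rsummable_geo.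
have ct := cterm_summable hq j m.
apply: le_trans (ler_norm_rsum ct) _; apply: ler_rsum.
- exact: rsummable_abs.
- exact/rsummableZ/rsummable_geo.
- by move=> a; apply: cterm_le => // a0; nia.
Qed.

(** The index around which [fqc] at level m is concentrated: for m <= 0, [fqc_reflect] sends j = m -
    1 to 0. *)
Definition fqc_peak (m : int) : int := if 1 <= m then 0 else m - 1.

Lemma fqc_le (j m : int) : `|fqc j m| <= fqc_bound * q ^+ `|(j - fqc_peak m)%R|%N.
Proof.
have H (i k n : int) : 1 <= n -> `|k| = i -> `|fqc k n| <= fqc_bound * q ^ i.
  move=> n1 <-; apply: le_trans (fqc_pos_le _ n1) _.
  by rewrite ler_wpM2l ?fqc_bound_ge0//; apply: qz_le => //; nia.
rewrite qz_abs// /fqc_peak; case: (leP 1 m) => m1; first by apply: H => //; rewrite subr0.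
by rewrite (fqc_reflect hq); apply: H; [lia|congr `|_|; ring].
Qed.

Lemma fqc_le_bound (j m : int) : `|fqc j m| <= fqc_bound.
Proof.
apply: le_trans (fqc_le _ _) _; rewrite -[leRHS]mulr1 ler_wpM2l ?fqc_bound_ge0//.
by rewrite exprn_ile1// ltW.
Qed.

(** The peak only translates the geometric majorant, so the bound does not depend on m. *)
Lemma fqc_wiener (m : int) :
  rsummable (fun j => fqc j m) /\ rsum (fun j => `|fqc j m|) <= wiener_bound.
Proof.
have bs := addr_bij (- fqc_peak m).
have sg := rsummableZ fqc_bound (rsummable_inj (bij_inj bs) (rsummable_geo q01)).
have s : rsummable (fun j => fqc j m).
  by apply: rsummable_le sg => j /=; exact: fqc_le.
split=> //; rewrite wiener_boundE geo_sumE -(rsum_bij (fun j : int => q ^+ `|j|%N) bs) -rsumZ; last first.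
  exact: (rsummable_inj (bij_inj bs) (rsummable_geo q01)).
apply: ler_rsum => //; first exact: rsummable_abs.
by move=> j /=; exact: fqc_le.
Qed.

Lemma fqc_decay (m k : int) : exists2 C, 0 <= C & forall j, `|fqc (j + k) m| <= C * q ^+ `|j|%N.
Proof.
pose z := k - fqc_peak m; exists (fqc_bound / q ^+ `|z|%N).
  by rewrite divr_ge0 ?fqc_bound_ge0 ?exprn_ge0// ltW.
move=> j; apply: le_trans (fqc_le _ _) _; rewrite -[leRHS]mulrA ler_wpM2l ?fqc_bound_ge0//.
rewrite mulrC ler_pdivlMr ?exprn_gt0// -exprD.
by rewrite ler_wiXn2l ?ltW// /z; lia.
Qed.

Lemma fqc_decayN (m k : int) : exists2 C, 0 <= C & forall j, `|fqc (k - j) m| <= C * q ^+ `|j|%N.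
Proof.
have [C C0 HC] := fqc_decay m k; exists C => // j.
by have := HC (- j); rewrite abszN addrC.
Qed.

(** The absolute first moment, [phi_lip], serves as a Lipschitz constant of the Fourier series on
    the circle and bounds its tails. *)
Lemma fqc_moment (m : int) : rsummable (fun j => `|j|%N%:R * fqc j m).
Proof.
have [C C0 HC] := fqc_decay m 0.
have := rsummableZ C (rsummable_geo1 hq); apply: rsummable_le => j.
by rewrite normrM normr_nat mulrCA ler_wpM2l//; have := HC j; rewrite addr0.
Qed.

(** For j <> 0 this is [fqc_pos_le] with m |j| >= m + |j| - 1; the 1 lost here is the division by q.
    For j = 0 the term a = 0 of the series equals 1 and the others are O(q^m). *)
Lemma fqc_limit (j m : int) : 1 <= m ->
  `|fqc j m - (j == 0)%:R| <= fqc_bound / q * q ^ m * q ^+ `|j|%N.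
Proof.
move=> m1; have [->|jn0] := eqVneq j 0; last first.
  rewrite subr0; apply: le_trans (fqc_pos_le _ m1) _.
  rewrite -!mulrA ler_wpM2l ?fqc_bound_ge0// qz_abs// -[q^-1]exprN1 -!qzD//.
  apply: qz_le => //; have : 1 <= `|j| by lia.
  nia.
rewrite expr0 mulr1; apply: (@le_trans _ _ (fqc_bound * q ^ m)); last first.
  by rewrite ler_pM2r ?qz_gt0// -[leLHS]mulr1 ler_wpM2l ?fqc_bound_ge0// invf_ge1// ltW.
have [|s1 E1] := @rsum_supp1 R int 0 (fun a : int => (a == 0)%:R).
  by move=> a /negbTE ->.
have ct := cterm_summable hq 0 m.
have -> : fqc 0 m - true%:R = rsum (fun a => cterm q 0 m a - (a == 0)%:R).
  by rewrite fqcE rsumB// E1 eqxx.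
apply: le_trans (ler_norm_rsum (rsummableB ct s1)) _.
rewrite fqc_boundE mulrAC geo_sumE -rsumZ; last exact: rsummable_geo.
apply: ler_rsum; [exact/rsummable_abs/rsummableB|exact/rsummableZ/rsummable_geo|].
move=> a; have [->|an0] := eqVneq a 0.
  rewrite /cterm !(mulr0, mul0r, addr0) !expr0z !mul1r /= big_ord0 invr1 mulr1 subrr normr0.
  by rewrite !mulr_ge0 ?sqr_ge0 ?qz_ge0 ?expR_ge0.
rewrite mulr0n subr0; apply: cterm_le => // a0; nia.
Qed.

Definition corr (d m : int) : R := rsum (fun j => fqc j m * fqc (j + d) m).

(** The weight w may grow like q^(-|j|): one of the two decaying factors absorbs it and the other
    gives summability. *)
Lemma fqc_prod_summable (w : int -> R) C m n (k l : int) :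
  (forall j, `|w j| * q ^+ `|j|%N <= C) ->
  rsummable (fun j => w j * (fqc (j + k) m * fqc (j + l) n)).
Proof.
move=> wC; have [C1 C10 H1] := fqc_decay m k; have [C2 C20 H2] := fqc_decay n l.
have := rsummableZ (C * C1 * C2) (rsummable_geo q01); apply: rsummable_le => j.
rewrite !normrM; have qj : 0 <= q ^+ `|j|%N by rewrite exprn_ge0// ltW.
apply: (@le_trans _ _ (`|w j| * ((C1 * q ^+ `|j|%N) * (C2 * q ^+ `|j|%N)))).
  by rewrite ler_wpM2l// ler_pM.
rewrite (_ : `|w j| * _ = (`|w j| * q ^+ `|j|%N) * (C1 * C2 * q ^+ `|j|%N)); last by ring.
by rewrite -!mulrA mulrA ler_wpM2r// !mulr_ge0.
Qed.

Lemma qz_abs_le1 (j : int) : `|q ^ j| * q ^+ `|j|%N <= 1.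
Proof.
rewrite qz_abs// gtr0_norm ?qz_gt0// -qzD// -(expr0z q); apply: qz_le => //; lia.
Qed.

(** Summation by parts: the first ladder relation lowers the level of one factor; after an index
    shift by one in the second resulting sum, the second relation lowers the level of the other
    factor. *)
Lemma corr_step (d m : int) : corr d (m + 1) = q ^ d * corr d m.
Proof.
have [fA fB] := fqc_ladder hq.
have wb (j : int) : `|q ^ (- j)| * q ^+ `|j|%N <= 1.
  by have := qz_abs_le1 (- j); rewrite abszN.
have w1 (j : int) : `|1 : R| * q ^+ `|j|%N <= 1.
  by rewrite normr1 mul1r exprn_ile1// ltW.
have s1 := fqc_prod_summable m (m + 1) 0 d wb.
have s2 := rsummableZ (q ^ m) (fqc_prod_summable m (m + 1) (- 1) d wb).
have s3 := rsummableZ (q ^ (m - 1)) (fqc_prod_summable m (m + 1) 0 (d + 1) wb).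
have s4 := fqc_prod_summable m m 0 d w1.
rewrite /corr -rsumZ; last first.
  by move: s4; congr rsummable; apply/funext => j; rewrite mul1r addr0.
transitivity (rsum (fun j => q ^ (- j) * (fqc (j + 0) m * fqc (j + d) (m + 1)) +
   q ^ m * (q ^ (- j) * (fqc (j - 1) m * fqc (j + d) (m + 1))))).
  apply: eq_rsum => j; rewrite addr0.
  have -> : fqc j (m + 1) = q ^ (- j) * (fqc j m + q ^ m * fqc (j - 1) m).
    by rewrite fA mulrA -qzD// addNr expr0z mul1r.
  ring.
rewrite rsumD// -(rsum_bij (fun j => q ^ m * _) (addr_bij 1)).
rewrite (_ : rsum (_ \o _) = rsum (fun j => q ^ (m - 1) *
    (q ^ (- j) * (fqc (j + 0) m * fqc (j + (d + 1)) (m + 1))))); last first.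
  apply: eq_rsum => j /=; rewrite addrK addr0 (_ : j + 1 + d = j + (d + 1)); last by ring.
  by rewrite opprD [q ^ (- j - 1)]qzD// [q ^ (m - 1)]qzD//; ring.
rewrite -rsumD//; apply: eq_rsum => j; rewrite addr0 addrA.
have -> : q ^ d * (fqc j m * fqc (j + d) m) =
    q ^ (- j) * fqc j m * (q ^ (j + d) * fqc (j + d) m).
  by rewrite [q ^ (j + d)]qzD// qzN; field; rewrite gt_eqF ?qz_gt0.
rewrite -fB; ring.
Qed.

Lemma corr_le (d m : int) : `|corr d m| <= fqc_bound * wiener_bound.
Proof.
have [s1 s1le] := fqc_wiener m.
have w1 (j : int) : `|1 : R| * q ^+ `|j|%N <= 1.
  by rewrite normr1 mul1r exprn_ile1// ltW.
have s4 : rsummable (fun j => fqc j m * fqc (j + d) m).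
  have := fqc_prod_summable m m 0 d w1; congr rsummable.
  by apply/funext => j; rewrite mul1r addr0.
apply: le_trans (ler_norm_rsum s4) _.
apply: (@le_trans _ _ (fqc_bound * rsum (fun j => `|fqc j m|))); last first.
  by rewrite ler_wpM2l ?fqc_bound_ge0.
rewrite -rsumZ; last exact: rsummable_abs.
apply: ler_rsum; [exact: rsummable_abs|exact/rsummableZ/rsummable_abs|].
by move=> j; rewrite normrM mulrC ler_wpM2r// fqc_le_bound.
Qed.

Lemma corr_iter (d m : int) (n : nat) : corr d (m + n%:Z) = q ^ (d * n%:Z) * corr d m.
Proof.
elim: n => [|n IH]; first by rewrite addr0 mulr0 expr0z mul1r.
rewrite -addn1 PoszD addrA corr_step IH mulrA -qzD//; congr (q ^ _ * _); ring.
Qed.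

Lemma corr_neq0 (d m : int) : d != 0 -> corr d m = 0.
Proof.
move=> dn0; apply: (@geo_bounded_eq0 _ (fqc_bound * wiener_bound)) => n.
(* For d > 0 the value at m is q^(d n) times a bounded value at m - n; for d < 0 the value at m + n
   is bounded although the factor q^(d n) blows up. *)
case: d dn0 => [[//|d] _|d _].
  have := corr_iter d.+1%:Z (m - n%:Z) n; rewrite subrK => ->.
  rewrite normrM mulrC (gtr0_norm (qz_gt0 hq _)).
  apply: ler_pM; rewrite ?corr_le ?qz_ge0//.
  by rewrite exprnP; apply: qz_le => //; nia.
have := corr_le (Negz d) (m + n%:Z); rewrite corr_iter normrM (gtr0_norm (qz_gt0 hq _)) => H.
rewrite -ler_pdivrMr ?exprn_gt0//; apply: le_trans H; rewrite mulrC ler_wpM2r//.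
by rewrite exprnP -qzN; apply: qz_le => //; nia.
Qed.

(** For d = 0 the scaling factor is 1, so the value is constant in m and can be read off at large
    levels, where [fqc] is close to delta. *)
Lemma corr0 (m : int) : corr 0 m = 1.
Proof.
have C0 n : corr 0 (m + n%:Z) = corr 0 m by rewrite corr_iter mul0r expr0z mul1r.
suff H (a : int) : 1 <= a -> `|corr 0 a - 1| <= (fqc_bound / q * wiener_bound + fqc_bound / q) * q ^ a.
  apply/eqP; rewrite -subr_eq0; apply/eqP.
  (* This shift ensures m + N >= 1, the range in which the limit estimate holds. *)
  pose N := `|m|%N.+1.
  apply: (@geo_bounded_eq0 _ (fqc_bound / q * wiener_bound + fqc_bound / q)) => n.
  rewrite -(C0 (N + n)%N); apply: le_trans (H _ _) _; first by rewrite /N; lia.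
  rewrite ler_wpM2l//; last by rewrite exprnP; apply: qz_le => //; rewrite /N; lia.
  by rewrite addr_ge0 ?mulr_ge0 ?invr_ge0 ?fqc_bound_ge0 ?wiener_bound_ge0// ltW.
move=> a1.
have [s1 s1le] := fqc_wiener a.
have [|sd Ed] := @rsum_supp1 R int 0 (fun j : int => (j == 0)%:R * fqc j a).
  by move=> j /negbTE ->; rewrite mul0r.
have s4 : rsummable (fun j => (fqc j a - (j == 0)%:R) * fqc j a).
  have := rsummableZ (fqc_bound + 1) s1; apply: rsummable_le_norm => j.
  rewrite !normrM; apply: ler_wpM2r => //.
  apply: le_trans (ler_normB _ _) _; rewrite ger0_norm; last by rewrite addr_ge0 ?fqc_bound_ge0.
  by apply: lerD; [exact: fqc_le_bound|case: (j == 0); rewrite ?normr1 ?normr0].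
have -> : corr 0 a - 1 = rsum (fun j => (fqc j a - (j == 0)%:R) * fqc j a) + (fqc 0 a - 1).
  have -> : corr 0 a = rsum (fun j => (fqc j a - (j == 0)%:R) * fqc j a + (j == 0)%:R * fqc j a).
    by apply: eq_rsum => j; rewrite addr0; ring.
  by rewrite rsumD// Ed eqxx mul1r; ring.
apply: le_trans (ler_normD _ _) _; rewrite [leRHS]mulrDl; apply: lerD; last first.
  by have := @fqc_limit 0 a a1; rewrite eqxx absz0 expr0 mulr1.
apply: le_trans (ler_norm_rsum s4) _; rewrite mulrAC.
apply: (@le_trans _ _ (fqc_bound / q * q ^ a * rsum (fun j => `|fqc j a|))); last first.
  by rewrite ler_wpM2l// !mulr_ge0 ?fqc_bound_ge0 ?invr_ge0 ?qz_ge0// ltW.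
rewrite -rsumZ; last exact: rsummable_abs.
apply: ler_rsum; [exact: rsummable_abs|exact/rsummableZ/rsummable_abs|].
move=> j; rewrite normrM ler_wpM2r//; apply: le_trans (fqc_limit _ a1) _.
rewrite -[leRHS]mulr1 ler_wpM2l ?exprn_ile1 ?(ltW q0) ?(ltW q1)//.
by rewrite !mulr_ge0 ?fqc_bound_ge0 ?invr_ge0 ?qz_ge0// ltW.
Qed.

End CoefficientBounds.

(** * The product formula *)

Section ProductFormula.
Variables (R : realType) (q : R).
Hypothesis hq : 0 < q < 1.
Local Notation fqc := (fqc q).
Local Notation ladder := (ladder q).

Let q0 : 0 < q. Proof. by case/andP: hq. Qed.
Let q1 : q < 1. Proof. by case/andP: hq. Qed.
Let qn0 : q != 0. Proof. by rewrite gt_eqF. Qed.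
Let q01 : 0 <= q < 1. Proof. by rewrite q1 ltW. Qed.

(** Provides a row in which one can divide by [fqc 0 a]. *)
Lemma fqc0_large : exists a0 : int, 1 <= a0 /\ forall a, a0 <= a -> 1 / 2 <= fqc 0 a.
Proof.
have [N HN] := geo_small hq (fqc_bound q / q) (e := 1 / 2) ltac:(lra).
exists N.+1; split=> // a aN.
have a1 : 1 <= a by lia.
have := fqc_limit hq 0 a1; rewrite eqxx absz0 expr0 mulr1.
case: a aN a1 => // a aN _; have := HN a; rewrite exprnP => /(_ _) H1 H2.
have := H1 (ltac:(lia)); have := ler_norm (1 - fqc 0 a); rewrite distrC; lra.
Qed.

(** The two relations express (g (s + 1) (a + 1), g s (a + 1)) linearly in (g s a, g (s - 1) a), by
    a 2 x 2 matrix whose determinant is q for all s and a. *)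
Lemma wronskian_step g h s a : ladder g -> ladder h ->
  g (s + 1) (a + 1) * h s (a + 1) - g s (a + 1) * h (s + 1) (a + 1) =
  q * (g s a * h (s - 1) a - g (s - 1) a * h s a).
Proof.
move=> [gA gB] [hA hB].
have qa : q ^ (a - 1) = q ^ a / q by rewrite qzD// exprN1.
have := gA s a; have := hA s a; have := gB s a; have := hB s a; rewrite qa.
have := qz_gt0 hq s; have := qz_gt0 hq a.
move: (q ^ s) (q ^ a) => x y y0 x0 hb gb ha ga.
have -> : h (s + 1) (a + 1) = q / y * (x * h s a - h s (a + 1)).
  by rewrite -hb; field; rewrite qn0 gt_eqF.
have -> : g (s + 1) (a + 1) = q / y * (x * g s a - g s (a + 1)).
  by rewrite -gb; field; rewrite qn0 gt_eqF.
have -> : h s (a + 1) = x^-1 * (h s a + y * h (s - 1) a).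
  by rewrite ha mulrA mulVf ?mul1r// gt_eqF.
have -> : g s (a + 1) = x^-1 * (g s a + y * g (s - 1) a).
  by rewrite ga mulrA mulVf ?mul1r// gt_eqF.
by field; rewrite !gt_eqF.
Qed.

(* The Wronskian of two bounded solutions grows geometrically along a diagonal, hence
   vanishes. *)
Lemma ladder_bounded_unique g M : ladder g -> (forall s a, `|g s a| <= M) ->
  exists l, forall s a, g s a = l * fqc s a.
Proof.
move=> gl gM; have fl := fqc_ladder hq.
pose W s a := g s a * fqc (s - 1) a - g (s - 1) a * fqc s a.
have Wn s a (n : nat) : W s a = q ^+ n * W (s - n%:Z) (a - n%:Z).
  elim: n => [|n IH]; first by rewrite !subr0 mul1r.
  rewrite IH exprSr -mulrA; congr (_ * _).
  have := wronskian_step (s - n.+1%:Z) (a - n.+1%:Z) gl fl.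
  rewrite (_ : s - n.+1%:Z + 1 = s - n%:Z); last by lia.
  rewrite (_ : a - n.+1%:Z + 1 = a - n%:Z); last by lia.
  move=> <-; rewrite /W (_ : s - n%:Z - 1 = s - n.+1%:Z)//; lia.
have W0 s a : W s a = 0.
  apply: (@geo_bounded_eq0 _ _ hq _ (2 * (M * fqc_bound q))) => n.
  rewrite (Wn s a n) normrM (ger0_norm (exprn_ge0 _ (ltW q0))) mulrC ler_wpM2r ?exprn_ge0 ?(ltW q0)//.
  rewrite /W; apply: le_trans (ler_normB _ _) _; rewrite !normrM mulr2n mulrDl mul1r.
  by apply: lerD; apply: ler_pM => //; exact: fqc_le_bound.
have [a0 [a01 Ha0]] := fqc0_large.
have F0 a : a0 <= a -> fqc 0 a != 0.
  by move=> /Ha0 H; rewrite gt_eqF//; lra.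
pose l := g 0 a0 / fqc 0 a0; exists l => s a; apply/eqP; rewrite -subr_eq0; apply/eqP.
pose h s a := g s a - l * fqc s a.
have hl : ladder h := ladderB l gl fl.
have hW s' b : h s' b * fqc (s' - 1) b = h (s' - 1) b * fqc s' b.
  by have := W0 s' b; rewrite /W /h => H; apply/eqP; rewrite -subr_eq0; apply/eqP; rewrite -[RHS]H; ring.
have [hA hB] := hl; have [fA fB] := fl.
(* Upwards in the column s = 0: if h vanishes at (0, a), the vanishing Wronskian and fqc 0 a <> 0
   make it vanish at (-1, a), and the first relation then gives (0, a + 1). *)
have h0 (n : nat) : h 0 (a0 + n%:Z) = 0.
  elim: n => [|n IH]; first by rewrite addr0 /h /l divfK ?subrr// F0.
  rewrite -addn1 PoszD addrA.
  have E := hA 0 (a0 + n%:Z); rewrite IH expr0z mul1r add0r in E.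
  have := hW 0 (a0 + n%:Z); rewrite IH mul0r => /esym/eqP.
  rewrite mulf_eq0 (negbTE (F0 _ _)) ?orbF; last by lia.
  by move=> /eqP Z; rewrite -E Z mulr0.
have h1 (n : nat) : h (- 1) (a0 + n%:Z) = 0.
  have := hA 0 (a0 + n%:Z); rewrite h0 -addrA (_ : n%:Z + 1 = n.+1%:Z); last by lia.
  rewrite h0 mulr0 add0r sub0r => /eqP.
  by rewrite mulf_eq0 (gt_eqF (qz_gt0 hq _)) => /eqP.
(* Below a0 there is no control on the zeros of [fqc 0 a], so the zeros of h are carried down in the
   columns 0 and -1 together. *)
have hd (n : nat) : h 0 (a0 - n%:Z) = 0 /\ h (- 1) (a0 - n%:Z) = 0.
  elim: n => [|n [IH0 IH1]]; first by split; [exact: (h0 0)|exact: (h1 0)].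
  have E : a0 - n.+1%:Z + 1 = a0 - n%:Z by lia.
  have H1 : h (- 1) (a0 - n.+1%:Z) = 0.
    have := hB (- 1) (a0 - n.+1%:Z); rewrite E IH1 addNr IH0 mulr0 addr0 => /esym/eqP.
    by rewrite mulf_eq0 (gt_eqF (qz_gt0 hq _)) => /eqP.
  split=> //; have := hA 0 (a0 - n.+1%:Z).
  by rewrite E IH0 sub0r H1 !mulr0 addr0.
apply: (ladder_col hq hl) => b.
case: (leP a0 b) => ab.
  by have := h0 `|(b - a0)%R|%N; rewrite (_ : a0 + _ = b)//; lia.
by have := (hd `|(a0 - b)%R|%N).1; rewrite (_ : a0 - _ = b)//; lia.
Qed.

(** In the pentagon, s and t are the total shifts along the two neighbouring pairs of tensor
    factors, and r is the part contributed by the braided middle operator, which shifts along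
    both. *)
Definition pent_term (s t a b r : int) : R :=
  fqc (s - r) (a - t) * fqc r (a + b - 1 - t + r) * fqc (t - r) b.

Definition pent_sum (s t a b : int) : R := rsum (pent_term s t a b).

Lemma tri_summable (w G : int -> R) C D (s t m n : int) :
  (forall r, `|w r| * q ^+ `|r|%N <= C) -> (forall r, `|G r| <= D) ->
  rsummable (fun r => w r * (fqc (s - r) m * G r * fqc (t - r) n)).
Proof.
move=> wC GD; have [C1 C10 H1] := fqc_decayN hq m s; have [C2 C20 H2] := fqc_decayN hq n t.
have := rsummableZ (C * C1 * C2 * D) (rsummable_geo q01); apply: rsummable_le => j.
rewrite !normrM; have qj : 0 <= q ^+ `|j|%N by rewrite exprn_ge0// ltW.
apply: (@le_trans _ _ (`|w j| * ((C1 * q ^+ `|j|%N) * D * (C2 * q ^+ `|j|%N)))).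
  by rewrite ler_wpM2l// !ler_pM ?mulr_ge0.
rewrite (_ : `|w j| * _ = (`|w j| * q ^+ `|j|%N) * (C1 * C2 * D * q ^+ `|j|%N)); last by ring.
have D0 : 0 <= D by exact: le_trans (normr_ge0 _) (GD j).
rewrite (_ : C * C1 * C2 * D * _ = C * (C1 * C2 * D * q ^+ `|j|%N)); last by ring.
by rewrite ler_wpM2r// !mulr_ge0.
Qed.

Lemma pent_summable s t a b : rsummable (pent_term s t a b).
Proof.
have w1 (j : int) : `|1 : R| * q ^+ `|j|%N <= 1.
  by rewrite normr1 mul1r exprn_ile1// ltW.
have := tri_summable s t (a - t) b w1 (fun r => fqc_le_bound hq r (a + b - 1 - t + r)).
by congr rsummable; apply/funext => r; rewrite mul1r.
Qed.

Lemma rsum_telescope (V U : int -> R) : rsummable V ->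
  (forall r, U r = V (r + 1) - V r) -> rsum U = 0.
Proof.
move=> sV UV; rewrite (eq_rsum UV) rsumB//.
  by rewrite (rsum_bij V (addr_bij 1)) subrr.
exact: (rsummable_inj (bij_inj (addr_bij 1)) sV).
Qed.

Lemma qzw_le (c r : int) : `|q ^ (c + r)| * q ^+ `|r|%N <= q ^ c.
Proof.
rewrite qzD// normrM (gtr0_norm (qz_gt0 hq c)) -mulrA.
by rewrite -[leRHS]mulr1 ler_wpM2l ?qz_ge0// qz_abs_le1.
Qed.

(** Creative telescoping: the relation fails term by term, but the defect is the difference of a
    summable certificate [V]. *)
Lemma pent_telescope (s t a b s1 t1 a1 b1 s2 t2 a2 b2 : int) (x y : R) (V : int -> R) :
  rsummable V ->
  (forall r, pent_term s t a b r + x * pent_term s1 t1 a1 b1 r - y * pent_term s2 t2 a2 b2 r =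
     V (r + 1) - V r) ->
  pent_sum s t a b + x * pent_sum s1 t1 a1 b1 = y * pent_sum s2 t2 a2 b2.
Proof.
move=> sV E; apply/eqP; rewrite -subr_eq0; apply/eqP.
rewrite -[RHS](rsum_telescope sV E) /pent_sum.
have S := pent_summable.
rewrite rsumB; [|exact/rsummableD/rsummableZ|exact: rsummableZ].
by rewrite rsumD ?rsumZ//; exact: rsummableZ.
Qed.

Local Ltac norm_exp := rewrite ?qzD// ?qzN ?exprN1 ?expr1z.

Lemma pent_L1 s t a b :
  pent_sum s t a b + q ^ a * pent_sum (s - 1) t a (b + 1) = q ^ s * pent_sum s t (a + 1) b.
Proof.
have [fA fB] := fqc_ladder hq.
(* With M = a + b - 1 - t + r, the certificate is the summand in which the middle factor fqc r M is
   replaced by q^M fqc (r - 1) M, the other term of the first relation at (r, M). *)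
apply: (pent_telescope (V := fun r => q ^ (a + b - 1 - t + r) *
  (fqc (s - r) (a - t) * fqc (r - 1) (a + b - 1 - t + r) * fqc (t - r) b))).
  apply: tri_summable; first exact: qzw_le.
  by move=> r; exact: fqc_le_bound.
move=> r; rewrite /pent_term.
rewrite (_ : s - 1 - r = s - r - 1); last by ring.
rewrite (_ : a + (b + 1) - 1 - t + r = a + b - 1 - t + r + 1); last by ring.
rewrite (_ : a + 1 - t = a - t + 1); last by ring.
rewrite (_ : a + 1 + b - 1 - t + r = a + b - 1 - t + r + 1); last by ring.
rewrite (_ : a + b - 1 - t + (r + 1) = a + b - 1 - t + r + 1); last by ring.
rewrite (_ : s - (r + 1) = s - r - 1); last by ring.
rewrite (_ : t - (r + 1) = t - r - 1); last by ring.
rewrite (_ : r + 1 - 1 = r); last by ring.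
have := fA (s - r) (a - t); have := fA r (a + b - 1 - t + r); have := fA (t - r) b.
norm_exp.
have := qz_gt0 hq a; have := qz_gt0 hq b; have := qz_gt0 hq t; have := qz_gt0 hq r; have := qz_gt0 hq s.
move: (q ^ a) (q ^ b) (q ^ t) (q ^ r) (q ^ s) => xa xb xt xr xs s0 r0 t0 b0 a0 h1 h2 h3.
have -> : fqc (s - r) (a - t + 1) = xr / xs * (fqc (s - r) (a - t) + xa / xt * fqc (s - r - 1) (a - t)).
  by rewrite h3; field; rewrite !gt_eqF.
have -> : fqc (t - r) (b + 1) = xr / xt * (fqc (t - r) b + xb * fqc (t - r - 1) b).
  by rewrite h1; field; rewrite !gt_eqF.
have -> : fqc r (a + b - 1 - t + r) = xr * fqc r (a + b - 1 - t + r + 1) -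
   xa * xb / q / xt * xr * fqc (r - 1) (a + b - 1 - t + r).
  by rewrite -h2; ring.
by field; rewrite !gt_eqF.
Qed.

Lemma pent_L2 s t a b :
  pent_sum s t (a + 1) b + q ^ (a - 1) * pent_sum (s + 1) t (a + 1) (b - 1) =
  q ^ s * pent_sum s t a b.
Proof.
have [fA fB] := fqc_ladder hq.
(* The same with the second relation: - V (r + 1) is the summand of the first sum in which fqc r (M
   + 1) is replaced by q^(M - 1) fqc (r + 1) (M + 1). *)
apply: (pent_telescope (V := fun r => - (q ^ (a + b - 1 - 1 - 1 - t + r) *
  (fqc (s + 1 - r) (a - t + 1) * fqc r (a + b - 1 - t + r) * fqc (t + 1 - r) b)))).
  apply/rsummableN/tri_summable; first exact: qzw_le.
  by move=> r; exact: fqc_le_bound.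
move=> r; rewrite /pent_term.
rewrite (_ : a + 1 - t = a - t + 1); last by ring.
rewrite (_ : a + 1 + (b - 1) - 1 - t + r = a + b - 1 - t + r); last by ring.
rewrite (_ : a + 1 + b - 1 - t + r = a + b - 1 - t + r + 1); last by ring.
rewrite (_ : a + b - 1 - t + (r + 1) = a + b - 1 - t + r + 1); last by ring.
rewrite (_ : s + 1 - (r + 1) = s - r); last by ring.
rewrite (_ : t + 1 - (r + 1) = t - r); last by ring.
rewrite (_ : s + 1 - r = s - r + 1); last by ring.
rewrite (_ : t + 1 - r = t - r + 1); last by ring.
have := fB (s - r) (a - t); have := fB r (a + b - 1 - t + r); have := fB (t - r) (b - 1).
rewrite (_ : b - 1 + 1 = b); last by ring.
norm_exp.
have := qz_gt0 hq a; have := qz_gt0 hq b; have := qz_gt0 hq t; have := qz_gt0 hq r; have := qz_gt0 hq s.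
move: (q ^ a) (q ^ b) (q ^ t) (q ^ r) (q ^ s) => xa xb xt xr xs s0 r0 t0 b0 a0 h1 h2 h3.
have -> : fqc (s - r) (a - t) = xr / xs * (fqc (s - r) (a - t + 1) + xa / xt / q * fqc (s - r + 1) (a - t + 1)).
  by rewrite h3; field; rewrite !gt_eqF.
have -> : fqc (t - r) (b - 1) = xr / xt * (fqc (t - r) b + xb / q / q * fqc (t - r + 1) b).
  by rewrite h1; field; rewrite !gt_eqF.
have -> : fqc r (a + b - 1 - t + r + 1) = xr * fqc r (a + b - 1 - t + r) -
   xa * xb / q / xt * xr / q * fqc (r + 1) (a + b - 1 - t + r + 1).
  by rewrite -h2; ring.
by field; rewrite qn0 !gt_eqF.
Qed.

(** Exchanging the outer factors of each summand swaps (s, a) with (t, b + s); so the recurrences in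
    the second pair follow from those in the first. *)
Lemma pent_sumC s t a b : pent_sum s t a b = pent_sum t s (b + s) (a - t).
Proof.
apply: eq_rsum => r; rewrite /pent_term addrK mulrC [_ * fqc r _]mulrC mulrA.
by congr (_ * fqc r _ * _); ring.
Qed.

Lemma pent_L3 s t a b :
  pent_sum s t a b + q ^ (b + s) * pent_sum s (t - 1) a b = q ^ t * pent_sum s t a (b + 1).
Proof.
rewrite !(pent_sumC s) (addrAC b) (_ : a - (t - 1) = a - t + 1); last by ring.
exact: pent_L1.
Qed.

Lemma pent_L4 s t a b :
  pent_sum s t a (b + 1) + q ^ (b + s - 1) * pent_sum s (t + 1) a (b + 1) =
  q ^ t * pent_sum s t a b.
Proof.
rewrite !(pent_sumC s) (addrAC b) (_ : a - (t + 1) = a - t - 1); last by ring.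
exact: pent_L2.
Qed.

Lemma pent_le s t a b : `|pent_sum s t a b| <= fqc_bound q ^+ 2 * wiener_bound q.
Proof.
have [s1 s1le] := fqc_wiener hq b; have P := pent_summable s t a b.
have bij : bijective (fun r : int => t - r) by exists (fun r => t - r) => r; rewrite subKr.
have s2 := rsummable_inj (bij_inj bij) s1.
have B0 := fqc_bound_ge0 hq.
rewrite /pent_sum; apply: le_trans (ler_norm_rsum P) _.
apply: (@le_trans _ _ (fqc_bound q ^+ 2 * rsum (fun j => `|fqc j b|))); last first.
  by rewrite ler_wpM2l ?sqr_ge0.
rewrite -(rsum_bij (fun j => `|fqc j b|) bij) -rsumZ; last exact: (rsummable_abs s2).
apply: ler_rsum; [exact: rsummable_abs|exact: (rsummableZ _ (rsummable_abs s2))|].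
move=> j /=; rewrite /pent_term !normrM ler_wpM2r// expr2.
by apply: ler_pM => //; exact: fqc_le_bound.
Qed.

Lemma product_formula s t a b : fqc s a * fqc t (b + s) = pent_sum s t a b.
Proof.
(* [pent_L1] and [pent_L2] move s and b in opposite directions, so b + s is the parameter to hold
   fixed. *)
have L (t' be : int) : exists l, forall s' a', pent_sum s' t' a' (be - s') = l * fqc s' a'.
  apply: (ladder_bounded_unique (g := fun s' a' => pent_sum s' t' a' (be - s')) (M := fqc_bound q ^+ 2 * wiener_bound q)).
    split=> s' a'.
      by rewrite -pent_L1; congr (_ + _ * pent_sum _ _ _ _); ring.
    by rewrite -pent_L2; congr (_ + _ * pent_sum _ _ _ _); ring.
  by move=> s' a'; exact: pent_le.
have M (s' a' : int) : exists m, forall t' b', pent_sum s' t' a' (b' - s') = m * fqc t' b'.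
  apply: (ladder_bounded_unique (g := fun t' b' => pent_sum s' t' a' (b' - s')) (M := fqc_bound q ^+ 2 * wiener_bound q)).
    split=> t' b'.
      have := pent_L3 s' t' a' (b' - s').
      by rewrite subrK (_ : b' - s' + 1 = b' + 1 - s')//; ring.
    have := pent_L4 s' t' a' (b' - s').
    by rewrite subrK (_ : b' - s' + 1 = b' + 1 - s')//; ring.
  by move=> t' b'; exact: pent_le.
have [a0 [a01 Ha0]] := fqc0_large.
have [m0 Hm0] := M 0 a0.
have F0 : fqc 0 a0 != 0 by rewrite gt_eqF//; have := Ha0 a0 (lexx _); lra.
pose k := m0 / fqc 0 a0.
have K s' t' a' b' : pent_sum s' t' a' b' = k * (fqc s' a' * fqc t' (b' + s')).
  have [l Hl] := L t' (b' + s'); have := Hl s' a'; rewrite addrK => ->.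
  have : l * fqc 0 a0 = m0 * fqc t' (b' + s') by rewrite -Hl Hm0.
  move=> /(canRL (mulfK F0)) ->; rewrite /k; ring.
suff k1 : k = 1 by rewrite K k1 mul1r.
apply/eqP; rewrite -subr_eq0; apply/eqP.
have B0 := fqc_bound_ge0 hq; have W0 := wiener_bound_ge0 hq.
pose A := fqc_bound q / q; have A0 : 0 <= A by rewrite divr_ge0// ltW.
(* [A] is the constant of [fqc_limit], and the 4 undoes a division by fqc 0 a' ^+ 2 >= 1 / 4. *)
pose D := 4 * (fqc_bound q ^+ 2 * A * geo_sum q) + A.
apply: (@geo_bounded_eq0 _ _ hq _ D) => n.
pose a' : int := a0 + n%:Z.
have a'1 : 1 <= a' by rewrite /a'; lia.
have qa' : q ^ a' <= q ^+ n by rewrite exprnP; apply: qz_le => //; rewrite /a'; lia.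
have aa' : a0 <= a' by rewrite /a' lerDl.
have a2 : 1 <= 2 * a' - 1 by lia.
have a3 : a' <= 2 * a' - 1 by lia.
have E := K 0 0 a' a'; rewrite addr0 in E.
have u := Ha0 a' aa'.
set v := fqc 0 (2 * a' - 1).
have hv : `|v - 1| <= A * q ^ a'.
  have := fqc_limit hq 0 a2; rewrite eqxx absz0 expr0 mulr1 -/v -/A => H.
  by apply: le_trans H _; rewrite ler_wpM2l//; exact: qz_le.
(* At s = t = 0 every summand with r <> 0 contains the factor fqc (- r) a', of order q^a'; only r =
   0 survives in the limit. *)
have hs : `|pent_sum 0 0 a' a' - fqc 0 a' * fqc 0 a' * v| <= fqc_bound q ^+ 2 * A * geo_sum q * q ^ a'.
  have [|s1 E1] := @rsum_supp1 R int 0 (fun r : int => if r == 0 then fqc 0 a' * fqc 0 a' * v else 0).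
    by move=> r /negbTE ->.
  rewrite eqxx in E1; rewrite -E1 /pent_sum -rsumB//; last exact: pent_summable.
  apply: le_trans (ler_norm_rsum (rsummableB (pent_summable _ _ _ _) s1)) _.
  rewrite geo_sumE [leRHS]mulrAC -[leRHS]rsumZ; last exact: rsummable_geo.
  apply: ler_rsum; [apply/rsummable_abs/rsummableB => //; exact: pent_summable|exact/rsummableZ/rsummable_geo|].
  move=> r; rewrite /pent_term !sub0r !subr0.
  have [->|rn0] := eqVneq r 0.
    rewrite oppr0 addr0 /v (_ : a' + a' - 1 = 2 * a' - 1); last by ring.
    rewrite (_ : _ - _ = 0) ?normr0; last by ring.
    apply: mulr_ge0; last by apply: exprn_ge0; exact: ltW.
    by apply: mulr_ge0; [apply: mulr_ge0; [exact: sqr_ge0|exact: A0]|exact: qz_ge0].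
  rewrite subr0 !normrM.
  have := fqc_limit hq (- r) a'1; rewrite oppr_eq0 (negbTE rn0) subr0 abszN -/A => H.
  rewrite (_ : fqc_bound q ^+ 2 * A * q ^ a' * q ^+ `|r|%N =
    (A * q ^ a' * q ^+ `|r|%N) * fqc_bound q * fqc_bound q); last by ring.
  apply: ler_pM; rewrite ?mulr_ge0 ?normr_ge0 ?fqc_le_bound//.
  by apply: ler_pM; rewrite ?normr_ge0 ?fqc_le_bound.
rewrite {}E in hs.
have Q : (fqc 0 a') ^+ 2 * `|k - 1| <= (fqc_bound q ^+ 2 * A * geo_sum q + (fqc 0 a') ^+ 2 * A) * q ^ a'.
  have -> : fqc 0 a' ^+ 2 * `|k - 1| = `|(k * (fqc 0 a' * fqc 0 a') - fqc 0 a' * fqc 0 a' * v) + fqc 0 a' ^+ 2 * (v - 1)|.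
    by rewrite -[X in X * _ = _]ger0_norm ?sqr_ge0// -normrM; congr `|_|; ring.
  apply: le_trans (ler_normD _ _) _; rewrite [leRHS]mulrDl; apply: lerD => //.
  by rewrite normrM ger0_norm ?sqr_ge0// -mulrA ler_wpM2l ?sqr_ge0.
have u2 : 1 / 4 <= fqc 0 a' ^+ 2 by nra.
have G0 := geo_sum_ge0 hq.
have X0 : 0 <= fqc_bound q ^+ 2 * A * geo_sum q.
  by apply: mulr_ge0 => //; apply: mulr_ge0 => //; exact: sqr_ge0.
have Y0 : 0 <= q ^ a' by exact: qz_ge0.
have u20 : 0 < fqc 0 a' ^+ 2 by lra.
rewrite -(ler_pM2l u20); apply: le_trans Q _; rewrite [leRHS]mulrA.
apply: ler_pM => //; first by apply: addr_ge0 => //; apply: mulr_ge0 => //; exact: sqr_ge0.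
rewrite /D [leRHS]mulrDr; apply: lerD => //.
have := mulr_ge0 (ltac:(lra) : 0 <= fqc 0 a' ^+ 2 - 1 / 4) X0.
move: (fqc 0 a' ^+ 2) (fqc_bound q ^+ 2 * A * geo_sum q) => U X; lra.
Qed.

End ProductFormula.

(** * Values of F_q on circles as sums of Fourier series *)

Section FourierSeries.
Variables (R : realType) (q : R).
Hypothesis hq : 0 < q < 1.
Local Notation C := R[i].
Local Notation normc := Normc.normc.
Local Notation fqc := (fqc q).

Let q0 : 0 < q. Proof. by case/andP: hq. Qed.
Let q1 : q < 1. Proof. by case/andP: hq. Qed.
Let qn0 : q != 0. Proof. by rewrite gt_eqF. Qed.
Let q01 : 0 <= q < 1. Proof. by rewrite q1 ltW. Qed.

Lemma normc_unit_neq0 (z : C) : normc z = 1 -> z != 0.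
Proof. by move=> z1; apply/eqP => z0; move: z1; rewrite z0 normc0 => /esym/eqP; rewrite oner_eq0. Qed.

Lemma normc_expz (z : C) (j : int) : normc z = 1 -> normc (z ^ j) = 1.
Proof.
move=> z1; case: j => n; first by rewrite -exprnP normcX z1 expr1n.
by rewrite NegzE -exprz_inv -exprnP normcX Normc.normcV z1 invr1 expr1n.
Qed.

Lemma conjc_unit (z : C) : normc z = 1 -> conjc z = z ^ (- 1).
Proof.
move=> z1; have zn0 := normc_unit_neq0 z1; apply: (mulIf zn0).
by rewrite mul_conjc z1 expr1n exprN1 mulVf.
Qed.

Definition phi (m : int) (z : C) : C := locked (csum (fun j : int => (fqc j m)%:C * z ^ j)).

Lemma phiE m z : phi m z = csum (fun j : int => (fqc j m)%:C * z ^ j).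
Proof. by rewrite /phi -lock. Qed.

Lemma phi_summable m z : normc z = 1 -> csummable (fun j : int => (fqc j m)%:C * z ^ j).
Proof.
move=> z1; apply: csummable_le (rsummable_abs (fqc_wiener hq m).1) => j.
by rewrite normcM normc_real normc_expz ?mulr1.
Qed.

Lemma csum_shift (f : int -> C) k : csum (fun j => f (j + k)) = csum f.
Proof. exact: (csum_bij f (addr_bij k)). Qed.

Lemma csummable_shift (f : int -> C) k : csummable f -> csummable (fun j => f (j + k)).
Proof. exact: (csummable_inj (bij_inj (addr_bij k))). Qed.

(** The coefficient of z^j is q^j fqc j (m + 1) on both sides: by the first ladder relation on the
    left, by the second on the right, where conj z = 1 / z. *)
Lemma phi_step m z : normc z = 1 ->
  (1 + (q ^ m)%:C * z) * phi m z = (1 + (q ^ m)%:C * conjc z) * phi (m + 2) z.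
Proof.
move=> z1; have zn0 := normc_unit_neq0 z1; have [fA fB] := fqc_ladder hq.
have sm n := phi_summable n z1.
rewrite (conjc_unit z1) !mulrDl !mul1r !phiE -!mulrA.
rewrite -(csumZ z (sm m)) -(csumZ (z ^ (- 1)) (sm (m + 2))).
rewrite -[csum (fun i => z * _)](csum_shift _ (- 1)) -[csum (fun i => z ^ (- 1) * _)](csum_shift _ 1).
have s1 := csummable_shift (- 1) (csummableZ z (sm m)).
have s2 := csummable_shift 1 (csummableZ (z ^ (- 1)) (sm (m + 2))).
rewrite -(csumZ _ s1) -(csumZ _ s2) -csumD; [|exact: sm|exact: csummableZ].
rewrite -csumD; [|exact: sm|exact: csummableZ].
apply: eq_csum => j; rewrite [z ^ (j + 1)]expfzDr// [z ^ (j - 1)]expfzDr// expr1z exprN1.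
transitivity ((fqc j m + q ^ m * fqc (j - 1) m)%:C * z ^ j).
  by rewrite realCD realCM; field.
have E := fB j (m + 1); rewrite addrK (_ : m + 1 + 1 = m + 2) in E; last by ring.
rewrite fA -E realCD realCM; field; exact: zn0.
Qed.

Lemma phi_limit m z : 1 <= m -> normc z = 1 ->
  normc (phi m z - 1) <= fqc_bound q / q * geo_sum q * q ^ m.
Proof.
move=> m1 z1.
have [|s1 E1] := @csum_supp1 R int 0 (fun j : int => (j == 0)%:R).
  by move=> j /negbTE ->.
rewrite [X in phi m z - X](_ : 1 = csum (fun j : int => (j == 0)%:R : C)); last by rewrite E1.
have sm := phi_summable m z1.
rewrite !phiE -csumB//; apply: le_trans (normc_csum (csummableB sm s1)) _.
rewrite mulrAC geo_sumE -rsumZ; last exact: rsummable_geo.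
apply: ler_rsum; [exact: csummableB|exact/rsummableZ/rsummable_geo|].
move=> j; apply: le_trans (fqc_limit hq j m1).
have [->|jn0] := eqVneq j 0; last first.
  by rewrite !subr0 normcM normc_real normc_expz ?mulr1.
by rewrite expr0z mulr1 -[1]/(1%:C) -realCB normc_real.
Qed.

Lemma phi_iter m z (n : nat) : normc z = 1 ->
  (\prod_(k < n) (1 + (q ^+ (2 * k))%:C * ((q ^ m)%:C * z))) * phi m z =
  (\prod_(k < n) (1 + (q ^+ (2 * k))%:C * conjc ((q ^ m)%:C * z))) * phi (m + 2 * n%:Z) z.
Proof.
move=> z1; elim: n => [|n IH]; first by rewrite !big_ord0 mulr0 addr0.
rewrite !big_ord_recr/= mulrAC IH.
have E (w : C) : (q ^+ (2 * n))%:C * ((q ^ m)%:C * w) = (q ^ (m + 2 * n%:Z))%:C * w.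
  by rewrite mulrA -realCM qzD// mulrC -PoszM -exprnP mulrC [_ ^+ _ * _]mulrC.
have Ec : (q ^+ (2 * n))%:C * conjc ((q ^ m)%:C * z) = (q ^ (m + 2 * n%:Z))%:C * conjc z.
  by rewrite (conjcM _ z) conjc_real E.
have -> : m + 2 * n.+1%:Z = m + 2 * n%:Z + 2 by lia.
by rewrite Ec E -[LHS]mulrA [phi _ _ * _]mulrC (phi_step _ z1) mulrA.
Qed.

Lemma phi_lim1 z : normc z = 1 -> (forall n : nat, phi (2 + 2 * n%:Z) z = phi 2 z) -> phi 2 z = 1.
Proof.
move=> z1 H; apply/eqP; rewrite -subr_eq0; apply/eqP; apply: Normc.eq0_normc.
apply: (@geo_bounded_eq0 _ _ hq _ (fqc_bound q / q * geo_sum q)) => n.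
rewrite ger0_norm ?normc_ge0// -(H n); apply: le_trans (phi_limit _ z1) _; first by lia.
rewrite ler_wpM2l//; last by rewrite exprnP; apply: qz_le => //; lia.
by rewrite mulr_ge0 ?geo_sum_ge0// divr_ge0 ?fqc_bound_ge0// ltW.
Qed.

(** These are the exceptional points. [phi_step] makes phi m (-1) and phi (m + 2) (-1) equal unless
    m = 0, where its factor 1 - q^m vanishes; that gap is crossed by [fqc_reflect], whose index
    shift j -> j + 1 produces the sign. *)
Lemma phi_N1 (k : nat) : phi (- (2 * k%:Z)) (- 1) = - 1.
Proof.
have n1 : normc (- 1 : C) = 1 by rewrite normcN normc1.
have st m : m != 0 -> phi m (- 1) = phi (m + 2) (- 1).
  move=> m0; have := phi_step m n1; rewrite conjcN conjc1 => /mulfI; apply.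
  rewrite mulrN1 -[1]/(1%:C) -realCB realC_eq0 subr_eq0 eq_sym.
  by rewrite pexprz_eq1 ?(ltW q0)// (negbTE m0) (lt_eqF q1).
have p2 : phi 2 (- 1) = 1.
  apply: (phi_lim1 n1); elim=> [|n IH]; first by rewrite mulr0 addr0.
  have -> : 2 + 2 * n.+1%:Z = 2 + 2 * n%:Z + 2 by lia.
  by rewrite -(st (2 + 2 * n%:Z))//; lia.
elim: k => [|k IH]; last first.
  rewrite st; last by lia.
  by have -> : - (2 * k.+1%:Z) + 2 = - (2 * k%:Z) by lia.
rewrite mulr0 oppr0; suff -> : phi 0 (- 1) = - 1 * phi 2 (- 1) by rewrite p2 mulr1.
rewrite !phiE -csumZ; last exact: phi_summable.
rewrite -[RHS](csum_shift _ 1); apply: eq_csum => j.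
have -> : fqc j 0 = fqc (j + 1) 2 by rewrite (fqc_reflect hq j 0) !subr0.
by rewrite expfzDr ?oppr_eq0 ?oner_eq0// expr1z [RHS]mulN1r mulrN1 mulrN opprK.
Qed.

Lemma climitP (u : nat -> C) (l : C) M N0 :
  (forall n, (N0 <= n)%N -> normc (u n - l) <= M * q ^+ n) -> climit u = l.
Proof.
move=> H; rewrite /climit.
have K (f : C -> R) : (forall z w, `|f z - f w| <= normc (z - w)) ->
    (fun n => f (u n)) @ \oo --> f l.
  move=> fL; apply/cvgrPdist_lt => e e0; have [N HN] := geo_small hq M e0.
  exists (maxn N N0) => // n /=; rewrite geq_max => /andP[Nn N0n].
  rewrite distrC; apply: le_lt_trans (fL _ _) _.
  exact: le_lt_trans (H n N0n) (HN n Nn).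
rewrite (cvg_lim _ (K (@complex.Re R) _)); last 2 first.
- exact: Rhausdorff.
- by move=> z w; rewrite -raddfB; exact: normr_Re.
rewrite (cvg_lim _ (K (@complex.Im R) _)); last 2 first.
- exact: Rhausdorff.
- by move=> z w; rewrite -raddfB; exact: normr_Im.
by case: l {H K}.
Qed.

Lemma qexp_phi m z : normc z = 1 -> qexp q ((q ^ m)%:C * z) = phi m z.
Proof.
move=> z1; rewrite /qexp; case: asboolP => [[k E]|nex].
  have Em : q ^ m = q ^- (2 * k).
    have : normc ((q ^ m)%:C * z) = normc (- (q ^- (2 * k))%:C) by rewrite E.
    rewrite normcM z1 mulr1 normcN !normc_real.
    by rewrite !ger0_norm ?invr_ge0 ?exprn_ge0 ?qz_ge0// ltW.
  have mk : m = - (2 * k%:Z).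
    have qn1 : q != 1 by rewrite lt_eqF.
    by have := Em; rewrite exprnN => /(ieexprIz q0 qn1) ->; rewrite PoszM.
  have Ez : z = - 1.
    have qm0 : (q ^ m)%:C != 0 :> C.
      by rewrite realC_eq0 gt_eqF ?qz_gt0.
    by apply: (mulfI qm0); rewrite E -Em mulrN1.
  by rewrite Ez mk phi_N1.
have nz (k : nat) : 1 + (q ^+ (2 * k))%:C * ((q ^ m)%:C * z) != 0.
  apply/eqP => H; apply: nex; exists k.
  have qk : (q ^+ (2 * k))%:C != 0 :> C.
    by rewrite realC_eq0 gt_eqF ?exprn_gt0.
  apply: (mulfI qk); rewrite mulrN -realCM divff ?gt_eqF ?exprn_gt0//.
  by apply/eqP; rewrite -subr_eq0 opprK addrC H.
set w := (q ^ m)%:C * z in nz *.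
set u := fun n => _.
have un n : normc (u n) = 1.
  rewrite /u; elim: n => [|n IH]; first by rewrite big_ord0 normc1.
  rewrite big_ord_recr/= normcM IH mul1r normcM Normc.normcV.
  have -> : normc (1 + (q ^+ (2 * n))%:C * conjc w) = normc (1 + (q ^+ (2 * n))%:C * w).
    by rewrite -normc_conj conjcD (conjcM _ (conjc w)) conjc1 conjc_real conjcK.
  by rewrite divff//; apply/eqP => /Normc.eq0_normc /eqP H; have := nz n; rewrite H.
(* From N on, m + 2 n is at least 1 and at least n, so [phi_limit] gives a rate q^n. *)
pose N : nat := `|m|%N.+1.
have uphi n : u n * phi (m + 2 * n%:Z) z = phi m z.
  have pn0 : \prod_(k < n) (1 + (q ^+ (2 * k))%:C * w) != 0.
    by apply/prodf_neq0 => i _; exact: nz.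
  apply: (mulfI pn0); rewrite [RHS]phi_iter// -/w mulrA /u big_split/=.
  rewrite prodfV; field; exact: pn0.
apply: (@climitP _ _ (fqc_bound q / q * geo_sum q) N) => n Nn.
rewrite -(uphi n) -[X in normc (X - _)]mulr1 -mulrBr normcM un mul1r -normcN opprB.
apply: le_trans (phi_limit _ z1) _; first by rewrite /N in Nn; lia.
rewrite ler_wpM2l//; last by rewrite exprnP; apply: qz_le => //; rewrite /N in Nn; lia.
by rewrite mulr_ge0 ?geo_sum_ge0// divr_ge0 ?fqc_bound_ge0// ltW.
Qed.

Lemma expz_lipschitz (z w : C) (j : int) : normc z = 1 -> normc w = 1 ->
  normc (z ^ j - w ^ j) <= `|j|%N%:R * normc (z - w).
Proof.
move=> z1 w1; have P (x y : C) (n : nat) : normc x = 1 -> normc y = 1 ->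
    normc (x ^+ n - y ^+ n) <= n%:R * normc (x - y).
  move=> x1 y1; elim: n => [|n IH]; first by rewrite !expr0 subrr normc0 mul0r.
  rewrite !exprS (_ : _ - _ = x * (x ^+ n - y ^+ n) + (x - y) * y ^+ n); last by ring.
  apply: le_trans (normcD _ _) _; rewrite !normcM x1 mul1r normcX y1 expr1n mulr1.
  by rewrite -natr1 mulrDl mul1r lerD.
case: j => n; first exact: P.
have V (x : C) : normc x = 1 -> x ^ (Negz n) = conjc (x ^+ n.+1).
  move=> x1; rewrite NegzE -exprz_inv -exprnP -exprN1 -(conjc_unit x1).
  by rewrite rmorphXn.
by rewrite !V// -conjcB normc_conj; exact: P.
Qed.

Definition phi_lip (m : int) : R := rsum (fun j : int => `|j|%N%:R * `|fqc j m|).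

Lemma phi_lip_summable m : rsummable (fun j : int => `|j|%N%:R * `|fqc j m|).
Proof.
by apply: rsummable_le_norm (fqc_moment hq m) => j; rewrite !normrM normr_id.
Qed.

Lemma phi_lip_ge0 m : 0 <= phi_lip m.
Proof. by apply: rsum_ge0 => j; rewrite mulr_ge0. Qed.

Lemma phi_lipschitz m z w : normc z = 1 -> normc w = 1 ->
  normc (phi m z - phi m w) <= phi_lip m * normc (z - w).
Proof.
move=> z1 w1; have sz := phi_summable m z1; have sw := phi_summable m w1.
rewrite !phiE -(csumB sz sw); apply: le_trans (normc_csum (csummableB sz sw)) _.
have sl := phi_lip_summable m.
rewrite mulrC /phi_lip -(rsumZ _ sl).
apply: ler_rsum; [exact: (csummableB sz sw)|exact: (rsummableZ _ sl)|].
move=> j; rewrite -mulrBr normcM normc_real mulrC.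
rewrite [leRHS]mulrA; apply: ler_wpM2r; first exact: normr_ge0.
by rewrite mulrC; exact: expz_lipschitz.
Qed.

Lemma normc_phi_le m z : normc z = 1 -> normc (phi m z) <= wiener_bound q.
Proof.
move=> z1; rewrite phiE; apply: le_trans (normc_csum (phi_summable m z1)) _.
apply: le_trans (fqc_wiener hq m).2; rewrite le_eqVlt; apply/orP; left; apply/eqP.
by apply: eq_rsum => j; rewrite normcM normc_real normc_expz ?mulr1.
Qed.

End FourierSeries.

(** * Convolution operators *)

Section Convolution.
Variables (R : realType) (I : choiceType) (sh : int -> I -> I) (m : I -> int).
Local Notation C := R[i].
Local Notation normc := Normc.normc.
Implicit Types (c d : int -> int -> R) (x y : vec R I).

Definition conv c (x : vec R I) : vec R I :=
  fun al => csum (fun j => (c j (m al))%:C * x (sh (- j) al)).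

Definition wiener c (A : R) : Prop :=
  forall n, rsummable (fun j => c j n) /\ rsum (fun j => `|c j n|) <= A.

Definition crev c : int -> int -> R := fun j n => c (- j) n.

Hypothesis sh0 : forall al, sh 0 al = al.
Hypothesis shD : forall i j al, sh (i + j) al = sh i (sh j al).
Hypothesis msh : forall j al, m (sh j al) = m al.

Lemma oppz_bij : bijective (fun j : int => - j).
Proof. by exists (fun j => - j) => j; rewrite opprK. Qed.

Lemma wiener_rev c A : wiener c A -> wiener (crev c) A.
Proof.
move=> wc n; have [s1 s2] := wc n; split.
  exact: (rsummable_inj (bij_inj oppz_bij) s1).
by rewrite (rsum_bij (fun j => `|c j n|) oppz_bij).
Qed.

Lemma wiener_ge0 c A : wiener c A -> 0 <= A.
Proof. by move=> /(_ 0)[_]; apply: le_trans; apply: rsum_ge0 => j. Qed.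

Lemma normc_le_l2 (x : vec R I) : l2 x -> forall al, normc (x al) <= 1 + sqn x.
Proof.
move=> lx al; have := normc_le_sqn al lx; have := normc_ge0 (x al).
have := sqr_ge0 (normc (x al) - 1 / 2); nra.
Qed.

Lemma conv_summable c A x al : wiener c A -> l2 x ->
  csummable (fun j => (c j (m al))%:C * x (sh (- j) al)).
Proof.
move=> wc lx; have [s1 _] := wc (m al).
have := rsummableZ (1 + sqn x) (rsummable_abs s1); apply: csummable_le => j.
by rewrite normcM normc_real mulrC ler_wpM2r// normc_le_l2.
Qed.

Definition slide (p : I * int) : I * int := (sh (- p.2) p.1, p.2).

Lemma slide_bij : bijective slide.
Proof.
by exists (fun p => (sh p.2 p.1, p.2)) => -[al j]; rewrite /slide /= -shD ?subrr ?addNr sh0.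
Qed.

Lemma weighted_summable c A (f : I -> R) : wiener c A -> (forall al, 0 <= f al) ->
  rsummable f ->
  rsummable (fun p : I * int => `|c p.2 (m p.1)| * f p.1) /\
  rsum (fun p : I * int => `|c p.2 (m p.1)| * f p.1) <= A * rsum f.
Proof.
move=> wc f0 sf; have A0 := wiener_ge0 wc.
have E al : rsum (fun j => `|c j (m al)| * f al) = rsum (fun j => `|c j (m al)|) * f al.
  have [s1 _] := wc (m al).
  by rewrite mulrC -(rsumZ _ (rsummable_abs s1)); apply: eq_rsum => j; rewrite mulrC.
have sE : rsummable (fun al => rsum (fun j => `|c j (m al)|) * f al).
  have := rsummableZ A sf; apply: rsummable_le => al.
  have [_ s2] := wc (m al).
  by rewrite normrM (ger0_norm (f0 al)) ger0_norm ?rsum_ge0// ler_wpM2r.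
have S : rsummable (fun p : I * int => `|c p.2 (m p.1)| * f p.1).
  apply: rsummable_pair => [al|] /=.
    have [s1 _] := wc (m al).
    have := rsummableZ (f al) (rsummable_abs s1).
    by apply: rsummable_le_norm => j; rewrite mulrC.
  apply: rsummable_le_norm sE => al; rewrite -E.
  rewrite (eq_rsum (g := fun j => `|c j (m al)| * f al))// => j.
  by rewrite normrM normr_id (ger0_norm (f0 al)).
split=> //; have [_ _ ->] := rsum_pair S.
rewrite -(rsumZ _ sf) /= (eq_rsum E); apply: ler_rsum => //; first exact: rsummableZ.
by move=> al; have [_ s2] := wc (m al); rewrite ler_wpM2r.
Qed.

Lemma slide_summable c A x : wiener c A -> l2 x ->
  rsummable (fun p : I * int => `|c p.2 (m p.1)| * normc (x (sh (- p.2) p.1)) ^+ 2) /\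
  rsum (fun p : I * int => `|c p.2 (m p.1)| * normc (x (sh (- p.2) p.1)) ^+ 2) <= A * sqn x.
Proof.
move=> wc /l2P lx.
have [s1 s2] := weighted_summable wc (fun al => sqr_ge0 (normc (x al))) lx.
have E : (fun p : I * int => `|c p.2 (m p.1)| * normc (x (sh (- p.2) p.1)) ^+ 2) =
   (fun p : I * int => `|c p.2 (m p.1)| * normc (x p.1) ^+ 2) \o slide.
  by apply/funext => -[al j] /=; rewrite msh.
rewrite E; split; first exact: (rsummable_inj (bij_inj slide_bij) s1).
by rewrite (rsum_bij (fun p : I * int => `|c p.2 (m p.1)| * normc (x p.1) ^+ 2) slide_bij).
Qed.

Lemma weighted_cauchy (a b : int -> R) A : 0 < A -> rsummable a ->
  rsum (fun j => `|a j|) <= A -> (forall j, 0 <= b j) ->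
  rsummable (fun j => `|a j| * b j) -> rsummable (fun j => `|a j| * b j ^+ 2) ->
  rsum (fun j => `|a j| * b j) ^+ 2 <= A * rsum (fun j => `|a j| * b j ^+ 2).
Proof.
move=> A0 sa aA b0 sab sabb; have saa := rsummable_abs sa.
set S := rsum (fun j => `|a j| * b j); set T := rsum (fun j => `|a j| * b j ^+ 2).
set N := rsum (fun j => `|a j|) in aA.
(* The sum of |a j| (b j - t)^2 is at most T - 2 S t + A t^2; t = S / A minimizes this bound. *)
have [t E] : exists t, S = t * A by exists (S / A); rewrite divfK// gt_eqF.
have : 0 <= T - 2 * t * S + t ^+ 2 * N.
  rewrite /T /S /N -(rsumZ _ sab) -(rsumZ _ saa) -rsumB//; last exact: rsummableZ.
  rewrite -rsumD; [|exact/rsummableB/rsummableZ|exact: rsummableZ].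
  apply: rsum_ge0 => j.
  rewrite (_ : _ + _ = `|a j| * (b j - t) ^+ 2); last by ring.
  by rewrite mulr_ge0 ?sqr_ge0.
have : t ^+ 2 * N <= t ^+ 2 * A by rewrite ler_wpM2l ?sqr_ge0.
rewrite E; move: aA; move: T N => T N; nra.
Qed.

Lemma conv_l2 c A x : wiener c A -> l2 x -> l2 (conv c x) /\ sqn (conv c x) <= A ^+ 2 * sqn x.
Proof.
move=> wc lx; have A0 := wiener_ge0 wc.
pose A' := A + 1; have A'0 : 0 < A' by rewrite ltr_wpDl.
(* [weighted_cauchy] asks for a positive constant while A may be 0; so the estimate is made with
   every positive B >= A, and B then tends to A. *)
have key (B : R) : 0 < B -> A <= B -> l2 (conv c x) /\ sqn (conv c x) <= B * (A * sqn x).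
  move=> B0 AB; have [s1 s2] := slide_summable wc lx.
  have [s3 s4 s5] := rsum_pair s1.
  have bnd al : normc (conv c x al) ^+ 2 <=
      B * rsum (fun j => `|c j (m al)| * normc (x (sh (- j) al)) ^+ 2).
    have cs := conv_summable al wc lx; have [sc cA] := wc (m al).
    have E : (fun j => normc ((c j (m al))%:C * x (sh (- j) al))) =
        (fun j => `|c j (m al)| * normc (x (sh (- j) al))).
      by apply/funext => j; rewrite normcM normc_real.
    have sE := cs; rewrite /csummable E in sE.
    apply: le_trans (weighted_cauchy B0 sc (le_trans cA AB) _ sE (s3 al)); last first.
      by move=> j; exact: normc_ge0.
    rewrite lerXn2r ?nnegrE ?normc_ge0//.
      by apply: rsum_ge0 => j; rewrite mulr_ge0 ?normc_ge0.
    by rewrite -E; exact: normc_csum.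
  have sB := rsummableZ B s4.
  have sq : rsummable (fun al => normc (conv c x al) ^+ 2).
    by apply: rsummable_le sB => al; rewrite ger0_norm ?sqr_ge0//; exact: bnd.
  split; first exact/l2P.
  apply: (@le_trans _ _ (B * rsum (fun al => rsum (fun j => `|c j (m al)| * normc (x (sh (- j) al)) ^+ 2)))).
    rewrite -(rsumZ _ s4); exact: ler_rsum.
  by rewrite ler_pM2l// -s5.
have [l2c _] := key A' A'0 (ltac:(by rewrite /A' lerDl)).
split=> //; apply/ler_addgt0Pl => e e0; rewrite addrC.
pose M := A * sqn x + 1; have M0 : 0 < M by rewrite ltr_wpDl// mulr_ge0// sqn_ge0.
have B0 : 0 < A + e / M by rewrite ltr_wpDl// divr_gt0.
have AB : A <= A + e / M by rewrite lerDl divr_ge0// ltW.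
have [_ H] := key _ B0 AB; apply: le_trans H _.
rewrite mulrDl expr2 -mulrA lerD2l mulrAC ler_pdivrMr// ler_pM2l//.
by rewrite /M lerDl.
Qed.

Lemma bilinear_summable c A x y : wiener c A -> l2 x -> l2 y ->
  csummable (fun p : I * int => conjc (y p.1) * ((c p.2 (m p.1))%:C * x (sh (- p.2) p.1))).
Proof.
move=> wc lx ly; have [s1 _] := slide_summable wc lx; move: (ly) => /l2P sy.
have [s2 _] := weighted_summable wc (fun al => sqr_ge0 (normc (y al))) sy.
have := rsummableD s1 s2; apply: csummable_le => -[al j] /=.
rewrite !normcM normc_conj normc_real mulrCA -mulrDr ler_wpM2l//.
have := sqr_ge0 (normc (y al) - normc (x (sh (- j) al))).
have := mulr_ge0 (normc_ge0 (y al)) (normc_ge0 (x (sh (- j) al))); nra.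
Qed.

Lemma ip_conv c A x y : wiener c A -> l2 x -> l2 y ->
  ip y (conv c x) =
  csum (fun p : I * int => conjc (y p.1) * ((c p.2 (m p.1))%:C * x (sh (- p.2) p.1))).
Proof.
move=> wc lx ly; have [_ _ ->] := csum_pair (bilinear_summable wc lx ly).
by rewrite ipE; apply: eq_csum => al; rewrite -(csumZ _ (conv_summable al wc lx)).
Qed.

Lemma conv_linear c A : wiener c A -> linear_l2 (conv c).
Proof.
move=> wc k x y lx ly; apply/funext => al; rewrite /conv.
have s1 := conv_summable al wc lx; have s2 := conv_summable al wc ly.
rewrite -(csumZ k s1) -(csumD (csummableZ k s1) s2).
by apply: eq_csum => j; rewrite mulrDr mulrCA.
Qed.

Lemma conv_bounded c A : wiener c A -> bounded_op (conv c).
Proof.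
move=> wc; split; first exact: conv_linear wc.
exists (A ^+ 2) => x lx; have [l1 l2'] := conv_l2 wc lx.
by rewrite !norm2E// -EFinM lee_fin.
Qed.

(** The coefficients are real and [m] is constant on orbits, so the substitution (al, j) -> (sh (-
    j) al, - j) moves the shift to the other vector. *)
Lemma conv_adjoint c A x y : wiener c A -> l2 x -> l2 y ->
  ip (conv c x) y = ip x (conv (crev c) y).
Proof.
move=> wc lx ly; have [lcx _] := conv_l2 wc lx.
rewrite -[LHS](ip_conj ly lcx) (ip_conv wc lx ly) (ip_conv (wiener_rev wc) ly lx).
rewrite -(csum_conj (bilinear_summable wc lx ly)).
have b : bijective (fun p : I * int => (sh (- p.2) p.1, - p.2)).
  by exists (fun p => (sh (- p.2) p.1, - p.2)) => -[al j] /=;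
    rewrite opprK -shD ?subrr ?addNr sh0.
rewrite -[RHS](csum_bij _ b); apply: eq_csum => -[al j] /=.
rewrite /crev !conjcM conjcK conjc_real msh !opprK -shD subrr sh0.
by rewrite mulrC -mulrA mulrCA.
Qed.

Lemma conv_comp c d A B x al : wiener c A -> wiener d B -> l2 x ->
  conv c (conv d x) al =
  csum (fun k => csum (fun i => (c i (m al) * d (k - i) (m al))%:C) * x (sh (- k) al)).
Proof.
move=> wc wd lx; have [sc cA] := wc (m al); have [sd dB] := wd (m al).
pose f (p : int * int) : C :=
  (c p.1 (m al) * d (p.2 - p.1) (m al))%:C * x (sh (- p.2) al).
pose g (p : int * int) : C :=
  (c p.1 (m al) * d p.2 (m al))%:C * x (sh (- (p.1 + p.2)) al).
have b : bijective (fun p : int * int => (p.1, p.2 - p.1)).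
  by exists (fun p => (p.1, p.2 + p.1)) => -[i j] /=; rewrite ?subrK ?addrK.
have sg0 : rsummable (fun p : int * int => `|c p.1 (m al)| * `|d p.2 (m al)|).
  apply: rsummable_pair => [i|] /=; first exact/rsummableZ/rsummable_abs.
  have := rsummableZ (rsum (fun j => `|d j (m al)|)) (rsummable_abs sc).
  apply: rsummable_le_norm => i; rewrite mulrC -(rsumZ _ (rsummable_abs sd)).
  rewrite (eq_rsum (g := fun j => `|c i (m al)| * `|d j (m al)|))// => j.
  by rewrite normrM !normr_id.
have sg : csummable g.
  have := rsummableZ (1 + sqn x) sg0; apply: csummable_le => -[i j] /=.
  by rewrite /g /= normcM normc_real normrM mulrC ler_wpM2r ?mulr_ge0// normc_le_l2.
have fg : f = g \o (fun p : int * int => (p.1, p.2 - p.1)).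
  by apply/funext => -[i k]; rewrite /f /g /= [i + _]addrC subrK.
have sf : csummable f by rewrite fg; exact: (csummable_inj (bij_inj b) sg).
transitivity (csum g).
  have [_ _ ->] := csum_pair sg; apply: eq_csum => i.
  rewrite /conv -(csumZ _ (conv_summable _ wd lx)); apply: eq_csum => j.
  by rewrite /g /= msh opprD addrC shD realCM mulrA.
rewrite -(csum_bij g b) -fg.
have sf' : csummable (fun p : int * int => f (p.2, p.1)).
  by apply: (csummable_inj (e := fun p : int * int => (p.2, p.1)) _ sf) => -[? ?] [? ?] [-> ->].
have [s1 _ E] := csum_pair sf'.
have bs : bijective (fun p : int * int => (p.2, p.1)) by exists (fun p => (p.2, p.1)) => -[].
rewrite -(csum_bij f bs) [LHS]E; apply: eq_csum => k /=.
rewrite mulrC /f /= -csumZ; first by apply: eq_csum => i; rewrite mulrC.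
have sk : rsummable (fun i => c i (m al) * d (k - i) (m al)).
  apply: rsummable_le_norm (rsummable_inj (e := fun i : int => (i, k - i)) _ sg0).
    by move=> i /=; rewrite !normrM !normr_id.
  by move=> i i' [].
by move: sk; rewrite /csummable; apply: rsummable_le_norm => i; rewrite normc_real normr_id.
Qed.

Lemma conv_delta c d A B x : wiener c A -> wiener d B -> l2 x ->
  (forall k n, rsum (fun i => c i n * d (k - i) n) = (k == 0)%:R) ->
  conv c (conv d x) = x.
Proof.
move=> wc wd lx H; apply/funext => al; rewrite (conv_comp al wc wd lx).
have E k : csum (fun i => (c i (m al) * d (k - i) (m al))%:C) = ((k == 0)%:R : R)%:C.
  by rewrite csum_real H.
have [|_ ->] := @csum_supp1 R int 0 (fun k =>
    csum (fun i => (c i (m al) * d (k - i) (m al))%:C) * x (sh (- k) al)).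
  by move=> k /negbTE kn0; rewrite E kn0 mul0r.
by rewrite E eqxx mul1r oppr0 sh0.
Qed.

(** For summable coefficients: at each level n the Fourier series sum_i c i n z^i has modulus one on
    the unit circle. *)
Definition orthogonal_coef c : Prop :=
  forall k n, rsum (fun i => c i n * c (i + k) n) = (k == 0)%:R.

Lemma conv_revK c A x : wiener c A -> orthogonal_coef c -> l2 x ->
  conv (crev c) (conv c x) = x.
Proof.
move=> wc oc lx; apply: (conv_delta (wiener_rev wc) wc lx) => k n.
rewrite -(oc k n) -(rsum_bij (fun i => c i n * c (i + k) n) oppz_bij).
by apply: eq_rsum => i /=; rewrite /crev addrC.
Qed.

Lemma conv_revVK c A x : wiener c A -> orthogonal_coef c -> l2 x ->
  conv c (conv (crev c) x) = x.
Proof.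
move=> wc oc lx; apply: (conv_delta wc (wiener_rev wc) lx) => k n.
rewrite (_ : (k == 0) = (- k == 0)); last by rewrite oppr_eq0.
rewrite -(oc (- k) n); apply: eq_rsum => i /=; rewrite /crev; congr (_ * c _ _); ring.
Qed.

Lemma conv_unitary c A : wiener c A -> orthogonal_coef c -> unitary (conv c).
Proof.
move=> wc oc; split.
- exact: conv_linear wc.
- by move=> x lx; have [] := conv_l2 wc lx.
- move=> x y lx ly; have [lcy _] := conv_l2 wc ly.
  by rewrite (conv_adjoint wc lx lcy) (conv_revK wc oc ly).
- move=> y ly; have [lcy _] := conv_l2 (wiener_rev wc) ly.
  by exists (conv (crev c) y) => //; exact: conv_revVK wc oc ly.
Qed.

End Convolution.

(** * Additivity in the measure and mean value estimate for real integrals *)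

Section MeasureLemmas.
Context {d : measure_display} {T : measurableType d} {R : realType}.
Implicit Types (mu : {measure set T -> \bar R}) (f : T -> R) (S A : set T).

Lemma Rintegral_measureD mu mu1 mu2 S f : measurable S ->
  (forall B, measurable B -> mu B = (mu1 B + mu2 B)%E) -> measurable_fun S f ->
  mu1.-integrable S (EFin \o f) -> mu2.-integrable S (EFin \o f) ->
  \int[mu]_(z in S) f z = \int[mu1]_(z in S) f z + \int[mu2]_(z in S) f z.
Proof.
move=> mS mE mf i1 i2; rewrite /Rintegral -fineD.
- congr fine; have mf' : measurable_fun S (EFin \o f) by exact/measurable_EFinP.
  rewrite -(integral_measure_add mS i1 i2).
  by apply: eq_measure_integral => B mB _; rewrite [RHS]measure_addE; exact: mE.
- exact: integrable_fin_num.
- exact: integrable_fin_num.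
Qed.

Lemma integrable_cst_fin mu S (r : R) : measurable S -> (mu S < +oo)%E ->
  mu.-integrable S (EFin \o cst r).
Proof.
move=> mS muS; apply: measurable_bounded_integrable => //.
by exists `|r|; split; [exact: num_real|move=> x rx y _ /=; exact: ltW].
Qed.

Lemma Rintegral_near mu S A f (r e : R) : measurable S -> measurable A ->
  (mu setT < +oo)%E -> mu (~` A) = 0%E -> mu (~` S) = 0%E ->
  mu.-integrable S (EFin \o f) -> 0 <= e ->
  (forall z, A z -> S z -> `|f z - r| <= e) ->
  `|\int[mu]_(z in S) f z - r * fine (mu setT)| <= e * fine (mu setT).
Proof.
move=> mS mA muT muA muS intf e0 fe.
have mfin (B : set T) : measurable B -> mu B \is a fin_num.
  move=> mB; rewrite ge0_fin_numE//; apply: le_lt_trans muT.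
  by apply: le_measure; rewrite ?inE.
have mSA : measurable (S `&` A) by exact: measurableI.
have mSA' : measurable (S `\` A) by exact: measurableD.
have null (B N : set T) : measurable B -> measurable N -> B `<=` N -> mu N = 0%E -> mu B = 0%E.
  move=> mB mN BN N0; apply/eqP; rewrite eq_le measure_ge0 andbT -N0.
  by apply: le_measure; rewrite ?inE.
have mCA : measurable (~` A) by exact: measurableC.
have mCS : measurable (~` S) by exact: measurableC.
have nullSA : mu (~` (S `&` A)) = 0%E.
  rewrite setCI; apply/eqP; rewrite eq_le measure_ge0 andbT.
  have : (mu (~` S `|` ~` A) <= mu (~` S) + mu (~` A))%E by exact: measureU2.
  by rewrite muA muS adde0.
have mT : fine (mu setT) = fine (mu (S `&` A)).
  have mC : measurable (~` (S `&` A)) by exact: measurableC.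
  have : mu ((S `&` A) `|` ~` (S `&` A)) = (mu (S `&` A) + mu (~` (S `&` A)))%E.
    by apply: measureU => //; rewrite setICr.
  by rewrite setUv nullSA adde0 => ->.
have intA : mu.-integrable (S `&` A) (EFin \o f).
  by apply: integrableS intf => //; exact: subIsetl.
have -> : \int[mu]_(z in S) f z = \int[mu]_(z in S `&` A) f z.
  transitivity (\int[mu]_(z in (S `&` A) `|` (S `\` A)) f z); first by rewrite setUIDK.
  have iU : mu.-integrable ((S `&` A) `|` (S `\` A)) (EFin \o f) by rewrite setUIDK.
  have dj : [disjoint S `&` A & S `\` A].
    by apply/disj_setPRL => z [Sz nAz] [_]; exact: nAz.
  rewrite (Rintegral_setU mSA mSA' iU dj).
  rewrite [X in _ + X](_ : _ = 0) ?addr0// /Rintegral null_set_integral//.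
    apply: measurable_funS (measurable_int _ intf) => //; exact: subDsetl.
  by apply: (null _ (~` A)) => // z [].
have muSA : (mu (S `&` A) < +oo)%E by rewrite -ge0_fin_numE//; exact: mfin.
have intr := integrable_cst_fin r mSA muSA.
rewrite mT -(Rintegral_cst mu mSA r) -(Rintegral_cst mu mSA e).
rewrite -(RintegralB mSA intA intr).
have intB := integrableB mSA intA intr.
apply: le_trans (le_normr_Rintegral mSA intB) _.
apply: le_Rintegral => //; first exact: (integrable_abse intB).
  exact: integrable_cst_fin.
by move=> z [Sz Az]; exact: fe.
Qed.

End MeasureLemmas.

Lemma conjc_i (R : realType) : conjc 'i%C = - 'i%C :> R[i].
Proof. by apply/eqP; rewrite eq_complex /= oppr0 !eqxx. Qed.

(** * Operators given by spectral integrals *)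

Section SpectralMeasures.
Variables (R : realType) (I : choiceType).
Variable (E : set (R * R) -> op R I).
Hypothesis hE : spectral_measure E.
Local Notation C := R[i].
Local Notation normc := Normc.normc.
Implicit Types (x y u v w : vec R I) (A B : set (R * R)).

Lemma sm_lin A : measurable A -> linear_l2 (E A).
Proof. by move=> mA; have [[]] := sm_proj hE mA. Qed.

Lemma sm_l2 A x : measurable A -> l2 x -> l2 (E A x).
Proof.
move=> mA lx; have [bE _ _] := sm_proj hE mA.
by have [M _ HM] := bounded_l2 bE; have [] := HM x lx.
Qed.

Lemma sm_idem A x : measurable A -> l2 x -> E A (E A x) = E A x.
Proof. by move=> mA lx; have [_ + _] := sm_proj hE mA; apply. Qed.

Lemma sm_sym A x y : measurable A -> l2 x -> l2 y -> ip (E A x) y = ip x (E A y).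
Proof. by move=> mA lx ly; have [_ _ +] := sm_proj hE mA; apply. Qed.

Lemma sm_ip A x : measurable A -> l2 x -> ip x (E A x) = (sqn (E A x))%:C.
Proof.
move=> mA lx; have lE := sm_l2 mA lx.
by rewrite -ipxx (sm_sym mA lx lE) (sm_idem mA lx).
Qed.

Lemma sm_scalar x mu A : scalar_measure E x mu -> l2 x -> measurable A ->
  mu A = (sqn (E A x))%:E.
Proof. by move=> hmu lx mA; rewrite (hmu A mA) (sm_ip mA lx). Qed.

Lemma sm_T x : l2 x -> E setT x = x.
Proof. by move=> lx; exact: (sm_setT hE lx). Qed.

Lemma sm_scalarT x mu : scalar_measure E x mu -> l2 x -> mu setT = (sqn x)%:E.
Proof. by move=> hmu lx; rewrite (sm_scalar hmu lx measurableT) sm_T. Qed.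

Lemma sm_comp A B x : measurable A -> measurable B -> l2 x -> E A (E B x) = E (A `&` B) x.
Proof. by move=> mA mB lx; rewrite (sm_setI hE mA mB lx). Qed.

Lemma sm_set0 x : l2 x -> E set0 x = fun=> 0.
Proof.
move=> lx; have [mu hmu] := sm_sigma_additive hE lx.
have := sm_scalar hmu lx measurable0; rewrite measure0 => -[/esym H].
by apply: sqn_eq0 H; exact: sm_l2.
Qed.

Lemma sm_orth A B x y : measurable A -> measurable B -> A `&` B = set0 -> l2 x -> l2 y ->
  ip (E A x) (E B y) = 0.
Proof.
move=> mA mB AB lx ly; rewrite sm_sym//; last exact: sm_l2.
by rewrite sm_comp// AB sm_set0// ip0r.
Qed.

Lemma sm_split A x : measurable A -> l2 x -> (fun i => E A x i + E (~` A) x i) = x.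
Proof.
move=> mA lx; have mC : measurable (~` A) by exact: measurableC.
have lA := sm_l2 mA lx; have lC := sm_l2 mC lx; have lAC := l2D lA lC.
have [mu hmu] := sm_sigma_additive hE lx.
have S : sqn x = sqn (E A x) + sqn (E (~` A) x).
  have : mu setT = (mu A + mu (~` A))%E.
    by rewrite -(setUv A); apply: measureU => //; rewrite setICr.
  by rewrite (sm_scalarT hmu lx) (sm_scalar hmu lx mA) (sm_scalar hmu lx mC) => -[].
have lD := l2B lx lAC.
suff D0 : sqn (fun i => x i - (E A x i + E (~` A) x i)) = 0.
  have /funeqP H := sqn_eq0 lD D0.
  by apply/funext => i; apply/eqP; rewrite eq_sym -subr_eq0; apply/eqP; exact: H.
have lN := l2N lAC; rewrite (sqnD lx lN) sqnN (sqnD lA lC) (ipNr lx lAC) (ipDr lx lA lC).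
rewrite (sm_ip mA lx) (sm_ip mC lx) (sm_orth mA mC (setICr A) lx lx) -realCD S /=.
lra.
Qed.

Lemma sm_sqn_add A B u w : measurable A -> measurable B -> l2 u -> l2 w ->
  E A w = w -> E (~` A) u = u -> sqn (E B (fun i => u i + w i)) = sqn (E B u) + sqn (E B w).
Proof.
move=> mA mB lu lw Aw Au; have mC : measurable (~` A) by exact: measurableC.
rewrite (linear_l2D (sm_lin mB) lu lw) (sqnD (sm_l2 mB lu) (sm_l2 mB lw)).
suff -> : ip (E B u) (E B w) = 0 by rewrite mulr0 addr0.
rewrite -Au -Aw !sm_comp//; apply: sm_orth => //; try exact: measurableI.
by rewrite setIACA setICl setI0.
Qed.

(** u and w lie in complementary spectral subspaces, so E B u and E B w are orthogonal for every
    B. *)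
Lemma sm_add_measure A u w mu mu1 mu2 : measurable A -> l2 u -> l2 w ->
  E A w = w -> E (~` A) u = u ->
  scalar_measure E (fun i => u i + w i) mu -> scalar_measure E u mu1 ->
  scalar_measure E w mu2 ->
  forall B, measurable B -> mu B = (mu1 B + mu2 B)%E.
Proof.
move=> mA lu lw Aw Au h h1 h2 B mB.
rewrite (sm_scalar h (l2D lu lw) mB) (sm_scalar h1 lu mB) (sm_scalar h2 lw mB).
by rewrite (sm_sqn_add mA mB lu lw Aw Au) EFinD.
Qed.

(** * Operators known through their quadratic form, applied below to X and to F *)

Section FormOperator.
Variables (dom : set (vec R I)) (T : op R I) (S : set (R * R)) (g : C -> C).
Hypothesis dom_l2 : forall x, dom x -> l2 x.
Hypothesis dom_lin : forall c x y, dom x -> dom y -> dom (fun i => c * x i + y i).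
Hypothesis T_lin : forall c x y, dom x -> dom y ->
  T (fun i => c * x i + y i) = fun i => c * T x i + T y i.
Hypothesis T_l2 : forall x, dom x -> l2 (T x).
Hypothesis dom_E : forall A x, measurable A -> dom x -> dom (E A x).
Hypothesis dom_basis : forall i, dom (basis R i).
Hypothesis mS : measurable S.
Hypothesis mRe : measurable_fun S (fun z : R * R => complex.Re (g (z.1 +i* z.2))).
Hypothesis mIm : measurable_fun S (fun z : R * R => complex.Im (g (z.1 +i* z.2))).
Hypothesis form : forall w mu, dom w -> scalar_measure E w mu ->
  [/\ mu.-integrable S (EFin \o (fun z : R * R => complex.Re (g (z.1 +i* z.2)))),
      mu.-integrable S (EFin \o (fun z : R * R => complex.Im (g (z.1 +i* z.2))))
    & ip w (T w) = cint mu S g].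

Lemma dom_D x y : dom x -> dom y -> dom (fun i => x i + y i).
Proof.
move=> dx dy; have := dom_lin 1 dx dy; congr dom.
by apply/funext => i; rewrite mul1r.
Qed.

Lemma T_D x y : dom x -> dom y -> T (fun i => x i + y i) = fun i => T x i + T y i.
Proof.
move=> dx dy; have := T_lin 1 dx dy.
rewrite (_ : (fun i => 1 * x i + y i) = fun i => x i + y i); last first.
  by apply/funext => i; rewrite mul1r.
by move=> ->; apply/funext => i; rewrite mul1r.
Qed.

Lemma dom_Z c x : dom x -> dom (fun i => c * x i) /\ T (fun i => c * x i) = fun i => c * T x i.
Proof.
move=> dx; have E1 : (fun i => (c - 1) * x i + x i) = fun i => c * x i.
  by apply/funext => i; rewrite mulrBl mul1r subrK.
have := T_lin (c - 1) dx dx; have := dom_lin (c - 1) dx dx; rewrite E1 => d1 ->.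
by split=> //; apply/funext => i; rewrite mulrBl mul1r subrK.
Qed.

(* The scalar measure of u + c w is the sum of those of u and c w, hence
   c (u | T w) + conj c (w | T u) = 0; take c = 1 and c = 'i. *)
Lemma form_orth A u w : measurable A -> dom u -> dom w -> E A w = w -> E (~` A) u = u ->
  ip u (T w) = 0.
Proof.
move=> mA du dw Aw Au; have lu := dom_l2 du; have lw := dom_l2 dw.
have lTu := T_l2 du; have lTw := T_l2 dw.
have key c : c * ip u (T w) + conjc c * ip w (T u) = 0.
  have [dcw Tcw] := dom_Z c dw; have lcw := dom_l2 dcw.
  have Acw : E A (fun i => c * w i) = fun i => c * w i.
    by rewrite (linear_l2Z _ (sm_lin mA) lw) Aw.
  have dD := dom_D du dcw; have lD := dom_l2 dD.
  have [mu hmu] := sm_sigma_additive hE lD.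
  have [mu1 hmu1] := sm_sigma_additive hE lu.
  have [mu2 hmu2] := sm_sigma_additive hE lcw.
  have [_ _ f] := form dD hmu; have [r1 i1 f1] := form du hmu1.
  have [r2 i2 f2] := form dcw hmu2.
  have mE := sm_add_measure mA lu lcw Acw Au hmu hmu1 hmu2.
  have Q : ip (fun i => u i + c * w i) (T (fun i => u i + c * w i)) =
      ip u (T u) + ip (fun i => c * w i) (T (fun i => c * w i)).
    rewrite f f1 f2 /cint (Rintegral_measureD mS mE mRe r1 r2).
    by rewrite (Rintegral_measureD mS mE mIm i1 i2).
  have lcTw := l2Z c lTw.
  rewrite (T_D du dcw) Tcw (ipDr lD lTu lcTw) (ipDl lu lcw lTu) (ipDl lu lcw lcTw) in Q.
  rewrite (ipZr c lu lTw) (ipZl c lw lTu) in Q.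
  set a := ip u (T u) in Q; set b := ip u (T w) in Q *; set d := ip w (T u) in Q *.
  set e := ip (fun i => c * w i) _ in Q.
  have -> : c * b + conjc c * d = (a + conjc c * d + (c * b + e)) - (a + e) by ring.
  by rewrite Q subrr.
have := key 1; rewrite conjc1 !mul1r => k1.
have := key 'i%C; rewrite (conjc_i R).
rewrite mulNr -mulrBr => /eqP; rewrite mulf_eq0 => /orP[|].
  by rewrite eq_complex /= oner_eq0 andbF.
rewrite subr_eq0 => /eqP k2; move: k1; rewrite -k2 -mulr2n => /eqP.
by rewrite mulrn_eq0 => /eqP.
Qed.

Lemma form_commute A x : measurable A -> dom x -> E A (T x) = T (E A x).
Proof.
move=> mA dx; have lx := dom_l2 dx.
have off B y : measurable B -> dom y -> E (~` B) (T (E B y)) = fun=> 0.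
  move=> mB dy; have mC : measurable (~` B) by exact: measurableC.
  have ly := dom_l2 dy; have dBy := dom_E mB dy; have lT := T_l2 dBy.
  apply/funext => i; rewrite -ip_basisl -(sm_sym mC (l2_basis R i) lT).
  apply: (form_orth mB) => //.
  - exact: dom_E.
  - exact: sm_idem.
  - by apply: sm_idem => //; exact: l2_basis.
have mC : measurable (~` A) by exact: measurableC.
have dA := dom_E mA dx; have dC := dom_E mC dx.
have lTA := T_l2 dA; have lTC := T_l2 dC.
have o1 := off A x mA dx; have := off (~` A) x mC dx; rewrite setCK => o2.
have -> : T x = fun i => T (E A x) i + T (E (~` A) x) i by rewrite -T_D// sm_split.
rewrite (linear_l2D (sm_lin mA) lTA lTC) o2.
have := sm_split mA lTA; rewrite o1 => H.
by rewrite -[RHS]H.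
Qed.

Hypothesis ES : forall x, l2 x -> E (~` S) x = fun=> 0.

(* On the range of E A the numerical range of T - g0 is within 2 e of 0; polarize. *)
Lemma form_near A w g0 e : measurable A -> dom w -> E A w = w ->
  dom (fun i => T w i - g0 * w i) -> 0 < e ->
  (forall z : R * R, A z -> S z -> normc (g (z.1 +i* z.2) - g0) <= e) ->
  sqn (fun i => T w i - g0 * w i) <= (12 * e) ^+ 2 * sqn w.
Proof.
move=> mA dw Aw dv e0 ge.
pose T0 x : vec R I := fun i => T x i - g0 * x i.
have T0l2 x : dom x -> l2 (T0 x) by move=> dx; exact: (l2B (T_l2 dx) (l2Z g0 (dom_l2 dx))).
(* The real and the imaginary part of the integral contribute e each. *)
have qle x : dom x -> E A x = x -> normc (ip x (T0 x)) <= 2 * e * sqn x.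
  move=> dx Ax; have lx := dom_l2 dx; have lTx := T_l2 dx; have lgx := l2Z g0 lx.
  have [mu hmu] := sm_sigma_additive hE lx.
  have [r i f] := form dx hmu.
  have muT := sm_scalarT hmu lx.
  have muTf : (mu setT < +oo)%E by rewrite muT ltry.
  have mC : measurable (~` A) by exact: measurableC.
  have muA : mu (~` A) = 0%E.
    rewrite (sm_scalar hmu lx mC) -Ax sm_comp// setICl sm_set0//.
    by have := ipxx (fun=> 0 : C) : ip (fun _ : I => 0) _ = _; rewrite ip0r => -[<-].
  have mCS : measurable (~` S) by exact: measurableC.
  have muS : mu (~` S) = 0%E.
    rewrite (sm_scalar hmu lx mCS) ES//.
    by have := ipxx (fun=> 0 : C) : ip (fun _ : I => 0) _ = _; rewrite ip0r => -[<-].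
  rewrite /T0 (ipBr lx lTx lgx) (ipZr g0 lx lx) ipxx f.
  apply: le_trans (normc_le _) _; rewrite -mulrA mulr2n mulrDl mul1r.
  have hr := Rintegral_near mS mA muTf muA muS r (ltW e0) (r := complex.Re g0).
  have hi := Rintegral_near mS mA muTf muA muS i (ltW e0) (r := complex.Im g0).
  rewrite muT /= in hr hi; apply: lerD.
    have -> : complex.Re (cint mu S g - g0 * (sqn x)%:C) =
      \int[mu]_(z in S) complex.Re (g (z.1 +i* z.2)) - complex.Re g0 * sqn x.
      by case: (g0) => a b /=; rewrite mulr0 subr0.
    apply: hr => z Az Sz; apply: le_trans (ge z Az Sz).
    rewrite (_ : _ - _ = complex.Re (g (z.1 +i* z.2) - g0)); first exact: normr_Re.
    by case: (g _) => ? ?; case: (g0).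
  have -> : complex.Im (cint mu S g - g0 * (sqn x)%:C) =
    \int[mu]_(z in S) complex.Im (g (z.1 +i* z.2)) - complex.Im g0 * sqn x.
    by case: (g0) => a b /=; rewrite mulr0 add0r.
  apply: hi => z Az Sz; apply: le_trans (ge z Az Sz).
  rewrite (_ : _ - _ = complex.Im (g (z.1 +i* z.2) - g0)); first exact: normr_Im.
  by case: (g _) => ? ?; case: (g0).
have lw := dom_l2 dw; have lTw := T_l2 dw.
have Av : E A (T0 w) = T0 w.
  rewrite /T0 (linear_l2B (sm_lin mA) lTw (l2Z g0 lw)) (linear_l2Z _ (sm_lin mA) lw).
  by rewrite form_commute// Aw.
have T0_lin c x y : dom x -> dom y -> T0 (fun i => x i + c * y i) = fun i => T0 x i + c * T0 y i.
  move=> dx dy; have [dcy Tcy] := dom_Z c dy.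
  by rewrite /T0 (T_D dx dcy) Tcy; apply/funext => i; ring.
(* For |c| = 1 the forms at u + c w, u and w add up to 2 e (2 sqn u + 2 sqn w + sqn u + sqn w);
   averaging c = 1 and c = 'i isolates (u | T0 w). *)
have bil u : dom u -> E A u = u -> normc (ip u (T0 w)) <= 6 * e * (sqn u + sqn w).
  move=> du Au; have lu := dom_l2 du.
  have lT0u := T0l2 u du; have lT0w := T0l2 w dw.
  have ex c : normc c = 1 -> normc (c * ip u (T0 w) + conjc c * ip w (T0 u)) <= 6 * e * (sqn u + sqn w).
    move=> c1; have [dcw _] := dom_Z c dw; have lcw := l2Z c lw.
    have dD := dom_D du dcw; have lD := dom_l2 dD.
    have AD : E A (fun i => u i + c * w i) = fun i => u i + c * w i.
      by rewrite (linear_l2D (sm_lin mA) lu lcw) (linear_l2Z _ (sm_lin mA) lw) Au Aw.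
    have q1 := qle _ dD AD; have q2 := qle _ du Au; have q3 := qle _ dw Aw.
    have lcT := l2Z c lT0w.
    have X : ip (fun i => u i + c * w i) (T0 (fun i => u i + c * w i)) =
       ip u (T0 u) + ip w (T0 w) + (c * ip u (T0 w) + conjc c * ip w (T0 u)).
      rewrite (T0_lin c u w du dw) (ipDr lD lT0u lcT) (ipDl lu lcw lT0u) (ipDl lu lcw lcT).
      rewrite (ipZr c lu lT0w) (ipZl c lw lT0u) (ipZr c lcw lT0w) (ipZl c lw lT0w).
      rewrite [c * (conjc c * _)]mulrA [c * conjc c]mulrC mul_conjc c1 expr1n mul1r.
      ring.
    rewrite X in q1.
    have := normcB (ip u (T0 u) + ip w (T0 w) + (c * ip u (T0 w) + conjc c * ip w (T0 u)))
       (ip u (T0 u) + ip w (T0 w)).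
    rewrite addrC addKr => H.
    have := normcD (ip u (T0 u)) (ip w (T0 w)).
    have := sqnD_le lu lcw; rewrite (sqnZ c lw) c1 expr1n mul1r.
    move: q1 q2 q3 H.
    move: (normc (_ + _)) (normc (ip u (T0 u))) (normc (ip w (T0 w))) (normc (ip u _ + _)).
    have := sqn_ge0 u; have := sqn_ge0 w.
    move: (sqn u) (sqn w) (sqn _) => su sw sD ? ? n1 n2 n3 n4; nra.
  have h1 := ex 1 (@normc1 R); have ni : normc ('i%C : C) = 1.
    by rewrite /= expr0n /= add0r expr1n sqrtr1.
  have hi := ex _ ni.
  rewrite conjc1 !mul1r in h1.
  rewrite conjc_i in hi.
  rewrite mulNr -mulrBr normcM ni mul1r in hi.
  have H : ip u (T0 w) *+ 2 = (ip u (T0 w) + ip w (T0 u)) + (ip u (T0 w) - ip w (T0 u)) by ring.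
  have := normcD (ip u (T0 w) + ip w (T0 u)) (ip u (T0 w) - ip w (T0 u)).
  rewrite -H normcMn; lra.
(* With u = t T0 w, a = sqn (T0 w) and b = sqn w, the bound [bil] becomes a <= a / 2 + (12 e)^2 b /
   2. *)
pose t : R := (12 * e)^-1; have t0 : 0 < t by rewrite invr_gt0 mulr_gt0.
have [dtv _] := dom_Z t%:C dv; have lv := dom_l2 dv.
have Atv : E A (fun i => t%:C * T0 w i) = fun i => t%:C * T0 w i.
  by rewrite (linear_l2Z _ (sm_lin mA) lv) Av.
have := bil _ dtv Atv; rewrite (ipZl _ lv lv) ipxx conjc_real -realCM normc_real (sqnZ _ lv) normc_real.
rewrite ger0_norm ?mulr_ge0 ?sqn_ge0 ?(ltW t0)// ger0_norm ?(ltW t0)//.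
have te : t * (12 * e) = 1 by rewrite mulVf// gt_eqF// mulr_gt0.
have := sqn_ge0 w; rewrite -/(T0 w); have := sqn_ge0 (T0 w).
move: (sqn (T0 w)) (sqn w) => a b a0 b0 H.
have H1 : (12 * e) * (t * a) <= (12 * e) * (6 * e * (t ^+ 2 * a + b)) by rewrite ler_wpM2l// mulr_ge0// ltW.
have E1 : (12 * e) * (t * a) = a by rewrite mulrA [_ * t]mulrC te mul1r.
have E2 : (12 * e) * (6 * e * (t ^+ 2 * a + b)) = (t * (12 * e)) ^+ 2 * a / 2 + (12 * e) ^+ 2 * b / 2 by field.
rewrite E1 E2 te expr1n mul1r in H1; lra.
Qed.

End FormOperator.

(** The half-open boxes of a grid of mesh dl partition the plane, so countable additivity of the
    scalar measures of v and x sums the local bounds. *)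
Lemma sm_grid (K dl : R) v x : 0 < dl -> 0 <= K -> l2 v -> l2 x ->
  (forall A (a b : R), measurable A ->
    (forall z, A z -> a <= z.1 < a + dl /\ b <= z.2 < b + dl) ->
    sqn (E A v) <= K * sqn (E A x)) ->
  sqn v <= K * sqn x.
Proof.
move=> d0 K0 lv lx H.
pose itv (i : int) : set R := [set t : R | i%:~R * dl <= t < (i + 1)%:~R * dl].
pose box (p : int * int) : set (R * R) := [set z | itv p.1 z.1] `&` [set z | itv p.2 z.2].
(* Numbers that code no pair of integers get the empty set, which keeps the sequence disjoint. *)
pose B n : set (R * R) := if @pickle_inv (int * int)%type n is Some p then box p else set0.
have mi i : measurable (itv i).
  rewrite (_ : itv i = `[i%:~R * dl, (i + 1)%:~R * dl[%classic); first exact: measurable_itv.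
  by apply/seteqP; split=> t /=; rewrite in_itv.
have mbox p : measurable (box p).
  apply: measurableI.
    rewrite -[X in measurable X]setTI; exact: (measurable_fst _ _ (mi p.1)).
  rewrite -[X in measurable X]setTI; exact: (measurable_snd _ _ (mi p.2)).
have mB n : measurable (B n) by rewrite /B; case: pickle_inv.
have itv_floor i t : itv i t -> Num.floor (t / dl) = i.
  move=> /andP[h1 h2]; apply: floor_def.
  by rewrite ler_pdivlMr// h1 ltr_pdivrMr.
have floor_itv' t : itv (Num.floor (t / dl)) t.
  have /andP[h1 h2] := floor_itv (t / dl).
  by rewrite /itv /= -ler_pdivlMr// h1 -ltr_pdivrMr.
have tB : trivIset setT B.
  apply/trivIsetP => i j _ _ ij; rewrite /B.
  case Ei : (pickle_inv i) => [p|]; last by rewrite set0I.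
  case Ej : (pickle_inv j) => [p'|]; last by rewrite setI0.
  apply/seteqP; split=> // z [[h1 h2] [h3 h4]]; exfalso.
  move/eqP: ij; apply.
  have pp' : p = p'.
    rewrite [p]surjective_pairing [p']surjective_pairing.
    by rewrite -(itv_floor _ _ h1) -(itv_floor _ _ h2) -(itv_floor _ _ h3) -(itv_floor _ _ h4).
  have := pickle_invK (T := (int * int)%type) i; have := pickle_invK (T := (int * int)%type) j.
  by rewrite Ei Ej /= pp' => <- <-.
have cB : \bigcup_n B n = setT.
  apply/seteqP; split=> // z _.
  exists (pickle (Num.floor (z.1 / dl), Num.floor (z.2 / dl))); first exact: Logic.I.
  by rewrite /B pickleK_inv; split; exact: floor_itv'.
have [mu hmu] := sm_sigma_additive hE lv; have [mu' hmu'] := sm_sigma_additive hE lx.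
have ser (nu : {measure set (R * R) -> \bar R}) : nu setT = (\sum_(n <oo) nu (B n))%E.
  rewrite -cB; apply: measure_semi_bigcup => //.
  by rewrite cB; exact: measurableT.
have := ser mu; rewrite (sm_scalarT hmu lv) => E1.
have := ser mu'; rewrite (sm_scalarT hmu' lx) => E2.
rewrite -lee_fin EFinM E1 E2 -nneseriesZl; last by move=> i _; exact: measure_ge0.
apply: lee_nneseries => [i _ _|i _]; first exact: measure_ge0.
rewrite (sm_scalar hmu lv (mB i)) (sm_scalar hmu' lx (mB i)) -EFinM lee_fin.
have Bi : (exists p, B i = box p) \/ B i = set0.
  by rewrite /B; case: pickle_inv => [p|]; [left; exists p|right].
case: Bi => [[p Bp]|Bp]; last first.
  by apply: (H _ 0 0) => //; rewrite Bp.
apply: (H _ (p.1%:~R * dl) (p.2%:~R * dl)) => // z; rewrite Bp => -[/= h1 h2].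
have D (k : int) : (k + 1)%:~R * dl = k%:~R * dl + dl by rewrite intrD mulrDl mul1r.
by rewrite -!D.
Qed.

End SpectralMeasures.

(** * The Hilbert norm and the Cauchy-Schwarz inequality *)

Section HilbertNorm.
Variables (R : realType) (I : choiceType).
Implicit Types (x y : vec R I).
Local Notation C := R[i].
Local Notation normc := Normc.normc.

Definition nrm x : R := Num.sqrt (sqn x).

Lemma nrm_ge0 x : 0 <= nrm x. Proof. exact: sqrtr_ge0. Qed.

Lemma nrm_sqr x : nrm x ^+ 2 = sqn x.
Proof. by rewrite sqr_sqrtr// sqn_ge0. Qed.

Lemma nrm_le x (a : R) : 0 <= a -> sqn x <= a ^+ 2 -> nrm x <= a.
Proof. by move=> a0 H; rewrite -ler_sqr ?nnegrE ?nrm_ge0// nrm_sqr. Qed.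

Lemma nrmZ c x : l2 x -> nrm (fun i => c * x i) = normc c * nrm x.
Proof.
by move=> lx; rewrite /nrm sqnZ// sqrtrM ?sqr_ge0// sqrtr_sqr ger0_norm ?normc_ge0.
Qed.

Lemma nrmN x : nrm (fun i => - x i) = nrm x.
Proof. by rewrite /nrm sqnN. Qed.

Lemma Re_ip_le x y : l2 x -> l2 y -> complex.Re (ip x y) <= nrm x * nrm y.
Proof.
move=> lx ly; have [x0|x0] := eqVneq (nrm x) 0.
  have sx : sqn x = 0 by rewrite -nrm_sqr x0 expr0n.
  rewrite x0 mul0r -(ip_conj ly lx) (sqn_eq0 lx sx) ip0r conjc0//=.
have [y0|y0] := eqVneq (nrm y) 0.
  have sy : sqn y = 0 by rewrite -nrm_sqr y0 expr0n.
  by rewrite y0 mulr0 (sqn_eq0 ly sy) ip0r.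
set a := nrm x in x0 *; set b := nrm y in y0 *.
have a0 : 0 < a by rewrite lt_def x0 nrm_ge0.
have b0 : 0 < b by rewrite lt_def y0 nrm_ge0.
have lbx := l2Z b%:C lx; have lay := l2Z (- a%:C) ly.
have := sqn_ge0 (fun i => b%:C * x i + - a%:C * y i).
rewrite (sqnD lbx lay) (sqnZ _ lx) (sqnZ _ ly) (ipZl _ lx lay) (ipZr _ lx ly).
rewrite conjc_real normcN !normc_real (gtr0_norm a0) (gtr0_norm b0) -!nrm_sqr -/a -/b.
have -> : complex.Re (b%:C * (- a%:C * ip x y)) = - (a * b * complex.Re (ip x y)).
  case: (ip x y) => u v /=; ring.
have ab : 0 < a * b by rewrite mulr_gt0.
move=> H; rewrite -(ler_pM2l ab); nra.
Qed.

Lemma nrmD x y : l2 x -> l2 y -> nrm (fun i => x i + y i) <= nrm x + nrm y.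
Proof.
move=> lx ly; apply: nrm_le; first by rewrite addr_ge0 ?nrm_ge0.
rewrite (sqnD lx ly) sqrrD !nrm_sqr; have := Re_ip_le lx ly.
rewrite mulr_natl; lra.
Qed.

Lemma nrmB x y : l2 x -> l2 y -> nrm x - nrm y <= nrm (fun i => x i - y i).
Proof.
move=> lx ly; rewrite lerBlDr; have := nrmD (l2B lx ly) ly.
by rewrite (_ : (fun i => x i - y i + y i) = x)//; apply/funext => i; rewrite subrK.
Qed.

Lemma normc_le_nrm x i : l2 x -> normc (x i) <= nrm x.
Proof.
move=> lx; rewrite -ler_sqr ?nnegrE ?normc_ge0 ?nrm_ge0// nrm_sqr.
exact: normc_le_sqn.
Qed.

Lemma nrm_eq0 x : l2 x -> nrm x = 0 -> x = fun=> 0.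
Proof. by move=> lx x0; apply: sqn_eq0 => //; rewrite -nrm_sqr x0 expr0n. Qed.

End HilbertNorm.

(** * The operators X and F *)

Section OperatorX.
Variables (R : realType) (q : R).
Hypothesis hq : 0 < q < 1.
Local Notation C := R[i].
Local Notation normc := Normc.normc.
Local Notation J := (L * L)%type.

Let q0 : 0 < q. Proof. by case/andP: hq. Qed.
Let q1 : q < 1. Proof. by case/andP: hq. Qed.

Definition shF (j : int) (a : J) : J := let: (k, l, (n, p)) := a in (k, l + j, (n, p - j)).
Definition mF (a : J) : int := let: (k, l, (n, p)) := a in 2 * (k - n) - (l + p) + 1.

Lemma shF0 a : shF 0 a = a.
Proof. by case: a => -[k l] [n p]; rewrite /shF addr0 subr0. Qed.

Lemma shFD i j a : shF (i + j) a = shF i (shF j a).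
Proof.
case: a => -[k l] [n p]; rewrite /shF.
by rewrite (_ : l + (i + j) = l + j + i) 1?(_ : p - (i + j) = p - j - i)//; ring.
Qed.

Lemma shFK j : cancel (shF j) (shF (- j)).
Proof. by move=> a; rewrite -shFD addNr shF0. Qed.

Lemma shFNK j : cancel (shF (- j)) (shF j).
Proof. by move=> a; rewrite -shFD subrr shF0. Qed.

Lemma shF_bij j : bijective (shF j).
Proof. by exists (shF (- j)); [exact: shFK|exact: shFNK]. Qed.

Lemma mF_sh j a : mF (shF j a) = mF a.
Proof. by case: a => -[k l] [n p]; rewrite /mF /shF; ring. Qed.

Definition wt (a : J) : R := q ^ mF a.

Lemma weightXE a : weightX q a = wt a.
Proof. by case: a => -[k l] [n p]. Qed.

Lemma wt_sh j a : wt (shF j a) = wt a.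
Proof. by rewrite /wt mF_sh. Qed.

Lemma wt_gt0 a : 0 < wt a.
Proof. exact: qz_gt0. Qed.

Definition TX (x : vec R J) : vec R J := fun a => (wt a)%:C * x (shF (- 1) a).
Definition domX (x : vec R J) : Prop := l2 x /\ l2 (fun a => (wt a)%:C * x a).

Lemma opXE x y : opX q (x, y) <-> domX x /\ y = TX x.
Proof.
have E (x' : vec R J) : phaseX (fun a => (weightX q a)%:C * x' a) = TX x'.
  apply/funext => -[[k l] [n p]]; rewrite /phaseX /TX /shF -weightXE /weightX opprK.
  congr ((q ^ _)%:C * _); ring.
have W (x' : vec R J) : (fun a => (weightX q a)%:C * x' a) = (fun a => (wt a)%:C * x' a).
  by apply/funext => a; rewrite weightXE.
split.
  move=> [y' [/= l1 l2' Ey'] /= ->]; rewrite Ey' in l2' *.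
  by rewrite E; split=> //; split=> //; rewrite -W.
move=> [[l1 l2'] ->]; exists (fun a => (weightX q a)%:C * x a); last by rewrite /= E.
by split=> //=; rewrite W.
Qed.

Lemma TX_l2 x : domX x -> l2 (TX x) /\ sqn (TX x) = sqn (fun a => (wt a)%:C * x a).
Proof.
move=> [lx lw]; have E : TX x = fun a => (fun a' => (wt a')%:C * x a') (shF (- 1) a).
  by apply/funext => a; rewrite /TX wt_sh.
rewrite E; split; first exact: (l2_comp (bij_inj (shF_bij _)) lw).
exact: (sqn_comp _ (shF_bij _)).
Qed.

Lemma domX_lin c x y : domX x -> domX y -> domX (fun a => c * x a + y a).
Proof.
move=> [lx wx] [ly wy]; split; first exact: l2D (l2Z c lx) ly.
have := l2D (l2Z c wx) wy; congr l2; apply/funext => a; ring.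
Qed.

Lemma TX_lin c x y : TX (fun a => c * x a + y a) = fun a => c * TX x a + TX y a.
Proof. by apply/funext => a; rewrite /TX; ring. Qed.

Lemma domX_basis b : domX (basis R b) /\ TX (basis R b) = fun a => (wt b)%:C * basis R (shF 1 b) a.
Proof.
split.
  split; first exact: l2_basis.
  have := l2Z (wt b)%:C (l2_basis R b); congr l2; apply/funext => a.
  by have [->//|ab] := eqVneq a b; rewrite basis_neq// !mulr0.
apply/funext => a; rewrite /TX; have [->|ab] := eqVneq a (shF 1 b).
  by rewrite shFK wt_sh !basis_same.
rewrite !basis_neq ?mulr0//; apply: contra ab => /eqP <-.
by rewrite -shFD subrr shF0.
Qed.

Variable E : set (R * R) -> op R J.
Hypothesis hsm : spectral_measure_of (opX q) E.
Let hE := smo_spectral hsm.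

Definition sq2 (z : R * R) : R := z.1 ^+ 2 + z.2 ^+ 2.

Lemma measurable_sq2 : measurable_fun setT sq2.
Proof.
by apply: measurable_funD; apply: measurable_funX;
  [exact: measurable_fst|exact: measurable_snd].
Qed.

Lemma domXP x mu : l2 x -> scalar_measure E x mu ->
  domX x <-> (\int[mu]_z (sq2 z)%:E < +oo)%E.
Proof.
move=> lx hmu; rewrite -(smo_domain hsm lx hmu); split.
  by move=> dx; exists (TX x); apply/opXE.
by move=> [y /opXE[]].
Qed.

Lemma formX w mu : domX w -> scalar_measure E w mu ->
  [/\ mu.-integrable setT (EFin \o (fun z : R * R => complex.Re (id (z.1 +i* z.2)))),
      mu.-integrable setT (EFin \o (fun z : R * R => complex.Im (id (z.1 +i* z.2))))
    & ip w (TX w) = cint mu setT id].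
Proof.
move=> dw hmu; have [lw _] := dw.
have H := (domXP lw hmu).1 dw.
have muT : (mu setT < +oo)%E by rewrite (sm_scalarT hE hmu lw) ltry.
have i2 : mu.-integrable setT (EFin \o sq2).
  apply/integrableP; split; first by apply/measurable_EFinP; exact: measurable_sq2.
  apply: le_lt_trans H; rewrite le_eqVlt; apply/orP; left; apply/eqP.
  by apply: eq_integral => z _ /=; rewrite ger0_norm// addr_ge0 ?sqr_ge0.
have i1 := integrable_cst_fin 1 measurableT muT.
(* The coordinates of z are dominated by 1 + |z|^2, which is integrable because mu is finite. *)
have i12 := integrableD measurableT i1 i2.
split; last by have [_] := smo_value hsm ((opXE _ _).2 (conj dw erefl)) hmu.
  apply: (le_integrable measurableT _ _ i12); first by apply/measurable_EFinP; exact: measurable_fst.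
  move=> z _ /=; rewrite lee_fin [leRHS]ger0_norm ?addr_ge0 ?sqr_ge0// /sq2.
  rewrite -[X in _ <= _ + (X + _)]real_normK ?num_real//.
  have := sqr_ge0 z.2; have := sqr_ge0 (`|z.1| - 1 / 2); nra.
apply: (le_integrable measurableT _ _ i12); first by apply/measurable_EFinP; exact: measurable_snd.
move=> z _ /=; rewrite lee_fin [leRHS]ger0_norm ?addr_ge0 ?sqr_ge0// /sq2.
rewrite -[X in _ <= _ + (_ + X)]real_normK ?num_real//.
have := sqr_ge0 z.1; have := sqr_ge0 (`|z.2| - 1 / 2); nra.
Qed.

(** If mu is the scalar measure of x, that of E A x is B -> mu (B [&] A), so the integral of |z|^2
    does not increase. *)
Lemma domX_E A x : measurable A -> domX x -> domX (E A x).
Proof.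
move=> mA dx; have [lx _] := dx; have lA := sm_l2 hE mA lx.
have [mu hmu] := sm_sigma_additive hE lx; have [mu' hmu'] := sm_sigma_additive hE lA.
apply/(domXP lA hmu'); apply: le_lt_trans ((domXP lx hmu).1 dx).
apply: ge0_le_measure_integral => //.
- move=> B mB; rewrite (sm_scalar hE hmu' lA mB) (sm_comp hE mB mA lx).
  rewrite -(sm_scalar hE hmu lx (measurableI _ _ mB mA)).
  by apply: le_measure; rewrite ?inE//; exact: measurableI.
- by move=> z; rewrite lee_fin addr_ge0 ?sqr_ge0.
- apply/measurable_EFinP; exact: measurable_sq2.
Qed.

Lemma domX_bounded A w (M : R) : measurable A -> l2 w -> E A w = w ->
  (forall z, A z -> sq2 z <= M) -> domX w.
Proof.
move=> mA lw Aw AM; have [mu hmu] := sm_sigma_additive hE lw.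
apply/(domXP lw hmu); have mC : measurable (~` A) by exact: measurableC.
have muC : mu (~` A) = 0%E.
  rewrite (sm_scalar hE hmu lw mC) -Aw (sm_comp hE mC mA lw) setICl (sm_set0 hE lw).
  by rewrite /sqn; under eq_rsum do rewrite normc0 expr0n; rewrite rsum0.
have ms : measurable_fun setT (EFin \o sq2) by apply/measurable_EFinP; exact: measurable_sq2.
have dj : [disjoint A & ~` A] by apply/disj_setPCl.
have f0 : forall z, (A `|` ~` A) z -> (0 <= (EFin \o sq2) z)%E.
  by move=> z _; rewrite lee_fin addr_ge0 ?sqr_ge0.
rewrite -(setUv A) ge0_integral_setU//; last by rewrite setUv.
rewrite [X in (_ + X)%E]null_set_integral ?adde0//; last first.
  by apply: measurable_funS ms.
have H : (\int[mu]_(z in A) (sq2 z)%:E <= \int[mu]_(z in A) (cst (Num.max M 0)%:E z))%E.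
  apply: ge0_le_integral => //.
  - by move=> z _; rewrite lee_fin addr_ge0 ?sqr_ge0.
  - by apply: measurable_funS ms.
  - by move=> z Az; rewrite lee_fin le_max AM.
apply: le_lt_trans H _.
rewrite integral_cst// (sm_scalar hE hmu lw mA) -EFinM; exact: ltry.
Qed.

End OperatorX.

(** * Range of a spectral projection of X for a small disc *)

Section SupportX.
Variables (R : realType) (q : R).
Hypothesis hq : 0 < q < 1.
Local Notation C := R[i].
Local Notation normc := Normc.normc.
Local Notation J := (L * L)%type.
Local Notation wt := (wt q).
Local Notation TX := (TX q).
Local Notation domX := (domX q).

Let q0 : 0 < q. Proof. by case/andP: hq. Qed.
Let q1 : q < 1. Proof. by case/andP: hq. Qed.

Variable E : set (R * R) -> op R J.
Hypothesis hsm : spectral_measure_of (opX q) E.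
Let hE := smo_spectral hsm.

Lemma domX_l2 x : domX x -> l2 x. Proof. by case. Qed.

Lemma mfst_id : measurable_fun setT (fun z : R * R => complex.Re (id (z.1 +i* z.2))).
Proof. exact: measurable_fst. Qed.

Lemma msnd_id : measurable_fun setT (fun z : R * R => complex.Im (id (z.1 +i* z.2))).
Proof. exact: measurable_snd. Qed.

Lemma TX_commute A x : measurable A -> domX x -> E A (TX x) = TX (E A x).
Proof.
move=> mA dx; apply: (@form_commute _ _ _ hE domX TX setT id) => //.
- exact: domX_l2.
- exact: domX_lin.
- by move=> c y z _ _; exact: TX_lin.
- by move=> y /TX_l2[].
- exact: (domX_E hsm).
- by move=> i; have [] := domX_basis q i.
- exact: mfst_id.
- exact: msnd_id.
- exact: (formX hsm).
Qed.

Variables (A : set (R * R)) (z0 : C) (e : R).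
Hypothesis mA : measurable A.
Hypothesis e0 : 0 < e.
Hypothesis Az0 : forall z : R * R, A z -> normc ((z.1 +i* z.2) - z0) <= e.

Lemma ball_bounded z : A z -> sq2 z <= (normc z0 + e) ^+ 2.
Proof.
move=> Az; rewrite /sq2 (_ : _ + _ = normc (z.1 +i* z.2) ^+ 2); last by rewrite normcE2.
rewrite lerXn2r ?nnegrE ?normc_ge0 ?addr_ge0 ?normc_ge0 ?(ltW e0)//.
have := normcD ((z.1 +i* z.2) - z0) z0; rewrite subrK; have := Az0 Az; lra.
Qed.

Lemma ran_dom w : l2 w -> E A w = w -> domX w.
Proof. by move=> lw Aw; apply: (domX_bounded hsm mA lw Aw ball_bounded). Qed.

Lemma ran_TX w : l2 w -> E A w = w -> l2 (TX w) /\ E A (TX w) = TX w.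
Proof.
move=> lw Aw; have dw := ran_dom lw Aw; split; first by have [] := TX_l2 dw.
by rewrite (TX_commute mA dw) Aw.
Qed.

Lemma near_X w : l2 w -> E A w = w ->
  nrm (fun a => TX w a - z0 * w a) <= 12 * e * nrm w.
Proof.
move=> lw Aw; have dw := ran_dom lw Aw; have [lT AT] := ran_TX lw Aw.
have lv := l2B lT (l2Z z0 lw).
have Av : E A (fun a => TX w a - z0 * w a) = (fun a => TX w a - z0 * w a).
  by rewrite (linear_l2B (sm_lin hE mA) lT (l2Z z0 lw)) (linear_l2Z _ (sm_lin hE mA) lw) Aw AT.
have dv := ran_dom lv Av.
apply: nrm_le; first by rewrite mulr_ge0 ?nrm_ge0// mulr_ge0// ltW.
rewrite exprMn nrm_sqr; apply: (@form_near _ _ _ hE domX TX setT id _ _ _ _ _ _ _ _ _ _ _ A) => //.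
- exact: domX_l2.
- exact: domX_lin.
- by move=> c y z _ _; exact: TX_lin.
- by move=> y /TX_l2[].
- exact: (domX_E hsm).
- by move=> i; have [] := domX_basis q i.
- exact: mfst_id.
- exact: msnd_id.
- exact: (formX hsm).
- by move=> x lx; rewrite setCT (sm_set0 hE lx).
- by move=> z Az _; exact: Az0.
Qed.

Lemma iter_ran w n : l2 w -> E A w = w ->
  l2 (iter n TX w) /\ E A (iter n TX w) = iter n TX w.
Proof.
by move=> lw Aw; elim: n => [//|n [l1 l2']] /=; exact: ran_TX.
Qed.

Lemma TX_bounds w : l2 w -> E A w = w ->
  (normc z0 - 12 * e) * nrm w <= nrm (TX w) <= (normc z0 + 12 * e) * nrm w.
Proof.
move=> lw Aw; have H := near_X lw Aw; have [lT _] := ran_TX lw Aw.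
have lz := l2Z z0 lw; have nz := nrmZ z0 lw.
have h1 := nrmB lT lz.
have h2 := nrmB lz lT.
have h3 : nrm (fun i => z0 * w i - TX w i) = nrm (fun a => TX w a - z0 * w a).
  rewrite -(nrmN (fun a => TX w a - z0 * w a)); congr nrm; apply/funext => a.
  by rewrite opprB.
rewrite h3 in h2; rewrite nz in h1 h2.
move: h1 h2 H; move: (nrm (TX w)) (nrm (fun a => _)) => u v h1 h2 H.
apply/andP; split; rewrite ?mulrBl ?mulrDl; lra.
Qed.

Lemma iter_upper w n : l2 w -> E A w = w ->
  nrm (iter n TX w) <= (normc z0 + 12 * e) ^+ n * nrm w.
Proof.
move=> lw Aw; elim: n => [|n IH]; first by rewrite expr0 mul1r.
have [l1 A1] := iter_ran n lw Aw; have /andP[_ H] := TX_bounds l1 A1.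
rewrite /= exprS; apply: le_trans H _; rewrite -mulrA ler_wpM2l//.
by rewrite addr_ge0 ?normc_ge0// mulr_ge0// ltW.
Qed.

Lemma iter_lower w n : l2 w -> E A w = w -> 0 <= normc z0 - 12 * e ->
  (normc z0 - 12 * e) ^+ n * nrm w <= nrm (iter n TX w).
Proof.
move=> lw Aw r0; elim: n => [|n IH]; first by rewrite expr0 mul1r.
have [l1 A1] := iter_ran n lw Aw; have /andP[H _] := TX_bounds l1 A1.
by rewrite /= exprS; apply: le_trans H; rewrite -mulrA ler_wpM2l.
Qed.

Lemma iterXE w n a : iter n TX w a = (wt a)%:C ^+ n * w (shF (- n%:Z) a).
Proof.
elim: n a => [|n IH] a; first by rewrite expr0 mul1r oppr0 shF0.
rewrite [iter _ _ _]/= /TX -/TX IH wt_sh exprS mulrA -shFD.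
by rewrite (_ : - n%:Z + -1 = - n.+1%:Z)//; lia.
Qed.

Lemma iter_basis n b : iter n TX (basis R b) = fun a => (wt b)%:C ^+ n * basis R (shF n%:Z b) a.
Proof.
apply/funext => a; rewrite iterXE; have [->|ab] := eqVneq a (shF n%:Z b).
  by rewrite shFK wt_sh !basis_same.
rewrite !basis_neq ?mulr0//; apply: contra ab => /eqP <-.
by rewrite shFNK.
Qed.

Lemma iter_commute n b : E A (iter n TX (basis R b)) = iter n TX (E A (basis R b)).
Proof.
have db m : domX (iter m TX (basis R b)).
  rewrite iter_basis; have [d1 _] := domX_basis q (shF m%:Z b).
  have := domX_lin ((wt b)%:C ^+ m - 1) d1 d1; congr domX.
  by apply/funext => a; rewrite mulrBl mul1r subrK.
by elim: n => [//|n IH]; rewrite /= (TX_commute mA (db n)) IH.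
Qed.

Lemma ran_E x : l2 x -> l2 (E A x) /\ E A (E A x) = E A x.
Proof. by move=> lx; split; [exact: sm_l2|exact: sm_idem]. Qed.

Lemma sqn_E_le x : l2 x -> sqn (E A x) <= sqn x.
Proof.
move=> lx; have [mu hmu] := sm_sigma_additive hE lx.
rewrite -lee_fin -(sm_scalar hE hmu lx mA) -(sm_scalarT hE hmu lx).
by apply: le_measure; rewrite ?inE.
Qed.

Lemma nrm_E_le x : l2 x -> nrm (E A x) <= nrm x.
Proof.
move=> lx; apply: nrm_le; rewrite ?nrm_ge0// nrm_sqr; exact: sqn_E_le.
Qed.

(** The n-th power of X carries the coordinate w a along the orbit and multiplies it by (wt a)^n,
    whereas on the range of E A it grows at most like (|z0| + 12 e)^n. *)
Lemma ran_low w a : l2 w -> E A w = w -> normc z0 + 12 * e < wt a -> w a = 0.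
Proof.
move=> lw Aw H; apply: Normc.eq0_normc.
have r0 : 0 < normc z0 + 12 * e by rewrite ltr_wpDl ?normc_ge0// mulr_gt0.
have w0 : 0 < wt a by exact: qz_gt0.
pose r := (normc z0 + 12 * e) / wt a.
have hr : 0 < r < 1 by rewrite divr_gt0//= ltr_pdivrMr// mul1r.
apply: (geo_bounded_eq0 hr (M := nrm w)) => n.
rewrite (ger0_norm (normc_ge0 _)) /r expr_div_n mulrA ler_pdivlMr ?exprn_gt0//.
have [l1 _] := iter_ran n lw Aw.
have := normc_le_nrm (shF n%:Z a) l1; rewrite iterXE shFK wt_sh normcM normcX normc_real.
rewrite (gtr0_norm w0) => h1; rewrite mulrC [nrm w * _]mulrC.
exact: le_trans h1 (iter_upper n lw Aw).
Qed.

(** The n-th power of X maps the basis vector at b to (wt b)^n times a basis vector, whose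
    projection has norm at most (wt b)^n; but this norm is at least (|z0| - 12 e)^n times that of
    the projection of the original vector. *)
Lemma ran_basis_high b : wt b < normc z0 - 12 * e -> E A (basis R b) = fun=> 0.
Proof.
move=> H; have [l1 A1] := ran_E (l2_basis R b).
apply: nrm_eq0 => //.
have w0 : 0 < wt b by exact: qz_gt0.
have r0 : 0 < normc z0 - 12 * e by exact: lt_trans H.
pose r := wt b / (normc z0 - 12 * e).
have hr : 0 < r < 1 by rewrite divr_gt0//= ltr_pdivrMr// mul1r.
apply: (geo_bounded_eq0 hr (M := 1)) => n.
rewrite (ger0_norm (nrm_ge0 _)) /r expr_div_n mulrA ler_pdivlMr ?exprn_gt0//.
have := iter_lower n l1 A1 (ltW r0); rewrite -iter_commute mulrC => h1.
apply: le_trans h1 _; rewrite iter_basis.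
have lb := l2Z ((wt b)%:C ^+ n) (l2_basis R (shF n%:Z b)).
apply: le_trans (nrm_E_le lb) _; rewrite (nrmZ _ (l2_basis R _)) normcX normc_real (gtr0_norm w0).
by rewrite mulrC ler_wpM2r ?exprn_ge0 ?(ltW w0)// nrm_le// sqn_basis expr1n.
Qed.

Lemma ran_support w a : l2 w -> E A w = w -> w a != 0 -> `|wt a - normc z0| <= 12 * e.
Proof.
move=> lw Aw wa; rewrite leNgt; apply/negP => H; move/negP: wa; apply; apply/eqP.
case: (ltP (normc z0 + 12 * e) (wt a)) => [|h1]; first exact: ran_low.
have h2 : wt a < normc z0 - 12 * e.
  rewrite ltNge; apply/negP => h2; move: H; rewrite ltNge => /negP; apply.
  by rewrite ler_norml; apply/andP; split; lra.
(* For small weights the statement on basis vectors is transferred by symmetry: w a = (e_a | E A w)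
   = (E A e_a | w). *)
by rewrite -Aw -ip_basisl -(sm_sym hE mA (l2_basis R a) lw) (ran_basis_high h2)
  -(ip_conj lw (l2_0 R _)) ip0r conjc0.
Qed.

(** The squared norm of E A e_b is its own coordinate at b, to which [ran_support] applies. *)
Lemma basis_far b : 12 * e < `|wt b - normc z0| -> E A (basis R b) = fun=> 0.
Proof.
move=> H; have [l1 A1] := ran_E (l2_basis R b).
apply: sqn_eq0 => //; apply: (@complexI R).
rewrite -(sm_ip hE mA (l2_basis R b)) ip_basisl; apply/eqP; apply: contraTT H => wb.
by rewrite -leNgt; exact: (ran_support l1 A1 wb).
Qed.

(* Below, the radius is so small that the disc meets at most one of the circles |z| = q^k. *)
Variable b : J.
Hypothesis small : 24 * e < wt b * (1 - q).

Lemma wt_gap k : `|q ^ k - wt b| < wt b * (1 - q) -> k = mF b.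
Proof.
rewrite /wt /= => H; case: (ltgtP k (mF b)) => // kb; exfalso.
  have h1 : q ^ (mF b - 1) <= q ^ k by apply: qz_le => //; lia.
  move: H; rewrite ltr_norml => /andP[_]; apply/negP; rewrite -leNgt.
  apply: (@le_trans _ _ (q ^ (mF b - 1) - q ^ mF b)); last by rewrite lerB.
  have E1 : q ^ mF b = q * q ^ (mF b - 1).
    transitivity (q ^ (1 + (mF b - 1))); first by congr (q ^ _); ring.
    by rewrite (qzD hq 1 (mF b - 1)) expr1z.
  rewrite E1; have := qz_gt0 hq (mF b - 1); move: (q ^ (mF b - 1)) => x x0.
  have := mulr_ge0 (ltW x0) (sqr_ge0 (1 - q)); nra.
have h1 : q ^ k <= q ^ (mF b + 1) by apply: qz_le => //; lia.
move: H; rewrite ltr_norml => /andP[+ _]; apply/negP; rewrite -leNgt.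
apply: (@le_trans _ _ (q ^ (mF b + 1) - q ^ mF b)); first by rewrite lerB.
by rewrite (qzD hq (mF b) 1) expr1z mulrBr mulr1 opprB.
Qed.

(** If wt b is within 12 e of |z0|, any weight in the support differs from it by at most 24 e, less
    than the gap between circles; otherwise E A kills the basis vector. *)
Lemma level_support j a : E A (basis R (shF j b)) a != 0 -> mF a = mF b.
Proof.
move=> H; have [l1 A1] := ran_E (l2_basis R (shF j b)).
have h1 := ran_support l1 A1 H; apply: wt_gap.
case: (leP `|wt b - normc z0| (12 * e)) => h2.
  apply: le_lt_trans small.
  have -> : q ^ mF a - wt b = (wt a - normc z0) - (wt b - normc z0) by rewrite /wt; ring.
  apply: le_trans (ler_normB _ _) _; lra.
move: H; rewrite basis_far; first by rewrite eqxx.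
by rewrite wt_sh.
Qed.

(** E A commutes with X, the product of weight and shift. On the level of b the weight is the
    constant wt b and cancels, which leaves commutation with the shift. *)
Lemma E_shift1 j a : E A (basis R (shF (j + 1) b)) a = E A (basis R (shF j b)) (shF (- 1) a).
Proof.
set b' := shF j b; have [db Tb] := domX_basis q b'.
have -> : shF (j + 1) b = shF 1 b' by rewrite /b' -shFD addrC.
have := TX_commute mA db; rewrite Tb (linear_l2Z _ (sm_lin hE mA) (l2_basis R _)).
move=> /funeqP/(_ a) /=; rewrite /TX -/TX /= {1}/b' wt_sh => H.
have wb : (wt b)%:C != 0 :> C by rewrite realC_eq0 gt_eqF// wt_gt0.
apply: (mulfI wb); rewrite H.
have [->|n0] := eqVneq (E A (basis R b') (shF (- 1) a)) 0; first by rewrite !mulr0.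
by rewrite /wt -(level_support n0) mF_sh.
Qed.

Lemma E_shift j a : E A (basis R (shF j b)) a = E A (basis R b) (shF (- j) a).
Proof.
move: j a; apply: int_ind_pm => [a|n IH a|n IH a]; first by rewrite oppr0 !shF0.
  by rewrite E_shift1 IH -shFD; congr (E _ _ (shF _ _)); ring.
have := E_shift1 (n - 1) (shF 1 a); rewrite subrK IH shFK => <-.
by rewrite -shFD; congr (E _ _ (shF _ _)); ring.
Qed.

End SupportX.

(** * Measurability and boundedness of F_q on the closed set of circles *)

Section MeasurabilityQexp.
Variables (R : realType) (q : R).
Hypothesis hq : 0 < q < 1.
Local Notation C := R[i].
Local Notation normc := Normc.normc.

Let q0 : 0 < q. Proof. by case/andP: hq. Qed.
Let q1 : q < 1. Proof. by case/andP: hq. Qed.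

Definition toC (z : R * R) : C := z.1 +i* z.2.

Definition cmeasurable (S : set (R * R)) (f : R * R -> C) : Prop :=
  measurable_fun S (fun z => complex.Re (f z)) /\ measurable_fun S (fun z => complex.Im (f z)).

Lemma cmeasurable_cst S c : cmeasurable S (fun=> c).
Proof. by split; exact: measurable_cst. Qed.

Lemma cmeasurableD S f g : cmeasurable S f -> cmeasurable S g ->
  cmeasurable S (fun z => f z + g z).
Proof.
move=> [f1 f2] [g1 g2]; split.
  rewrite (_ : (fun z => _) = (fun z => complex.Re (f z)) \+ (fun z => complex.Re (g z))).
    exact: measurable_funD.
  by apply/funext => z /=; case: (f z) => ? ?; case: (g z).
rewrite (_ : (fun z => _) = (fun z => complex.Im (f z)) \+ (fun z => complex.Im (g z))).
  exact: measurable_funD.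
by apply/funext => z /=; case: (f z) => ? ?; case: (g z).
Qed.

Lemma cmeasurableM S f g : cmeasurable S f -> cmeasurable S g ->
  cmeasurable S (fun z => f z * g z).
Proof.
move=> [f1 f2] [g1 g2]; split.
  rewrite (_ : (fun z => _) = ((fun z => complex.Re (f z)) \* (fun z => complex.Re (g z))) \-
    ((fun z => complex.Im (f z)) \* (fun z => complex.Im (g z)))).
    by apply: measurable_funB; exact: measurable_funM.
  by apply/funext => z /=; case: (f z) => ? ?; case: (g z).
rewrite (_ : (fun z => _) = ((fun z => complex.Re (f z)) \* (fun z => complex.Im (g z))) \+
    ((fun z => complex.Im (f z)) \* (fun z => complex.Re (g z)))).
  by apply: measurable_funD; exact: measurable_funM.
by apply/funext => z /=; case: (f z) => ? ?; case: (g z).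
Qed.

Lemma cmeasurable_conj S f : cmeasurable S f -> cmeasurable S (fun z => conjc (f z)).
Proof.
move=> [f1 f2]; split.
  by rewrite (_ : (fun z => _) = (fun z => complex.Re (f z)))//; apply/funext => z; case: (f z).
rewrite (_ : (fun z => _) = \- (fun z => complex.Im (f z))); first exact: measurable_funN.
by apply/funext => z /=; case: (f z).
Qed.

Lemma cmeasurableX S f n : cmeasurable S f -> cmeasurable S (fun z => f z ^+ n).
Proof.
move=> mf; elim: n => [|n IH].
  by under eq_fun do rewrite expr0; exact: cmeasurable_cst.
by under eq_fun do rewrite exprS; exact: cmeasurableM.
Qed.

Lemma cmeasurable_sum S (I : Type) (s : seq I) (f : I -> R * R -> C) :
  (forall i, cmeasurable S (f i)) -> cmeasurable S (fun z => \sum_(i <- s) f i z).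
Proof.
move=> mf; elim: s => [|i s IH].
  by under eq_fun do rewrite big_nil; exact: cmeasurable_cst.
by under eq_fun do rewrite big_cons; exact: cmeasurableD.
Qed.

Lemma cmeasurable_toC S : measurable S -> cmeasurable S toC.
Proof.
move=> mS; split; [apply: (measurable_funS measurableT) (@subsetT _ _) measurable_fst|
  apply: (measurable_funS measurableT) (@subsetT _ _) measurable_snd].
Qed.

Lemma cmeasurable_cvg S (h : nat -> R * R -> C) f :
  (forall n, cmeasurable S (h n)) ->
  (forall z, S z -> exists M, forall n, normc (h n z - f z) <= M / n.+1%:R) ->
  cmeasurable S f.
Proof.
move=> mh hf.
have K (g : C -> R) : (forall z w, `|g z - g w| <= normc (z - w)) ->
    forall z, S z -> (fun n => g (h n z)) @ \oo --> g (f z).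
  move=> gL z Sz; have [M HM] := hf z Sz.
  apply/cvgrPdist_lt => e e0.
  have [N HN] : exists N : nat, `|M| / e < N%:R.
    by exists (Num.bound (`|M| / e)); apply: archi_boundP; rewrite divr_ge0// ltW.
  exists N => // n /= Nn; rewrite distrC.
  apply: le_lt_trans (gL _ _) _; apply: le_lt_trans (HM n) _.
  rewrite ltr_pdivrMr ?ltr0Sn//; apply: le_lt_trans (ler_norm _) _.
  rewrite -ltr_pdivrMl// mulrC; apply: lt_le_trans HN _.
  by rewrite ler_nat; exact: leqW.
split.
  apply: (measurable_fun_cvg (h := fun n z => complex.Re (h n z))); first by move=> n; have [] := mh n.
  by apply: (K (@complex.Re R)) => z w; rewrite -raddfB; exact: normr_Re.
apply: (measurable_fun_cvg (h := fun n z => complex.Im (h n z))); first by move=> n; have [] := mh n.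
by apply: (K (@complex.Im R)) => z w; rewrite -raddfB; exact: normr_Im.
Qed.

Definition circle (k : int) : set (R * R) := [set z | sq2 z = (q ^ k) ^+ 2].

Lemma measurable_circle k : measurable (circle k).
Proof.
rewrite -[X in measurable X]setTI; exact: (@measurable_sq2 R measurableT [set (q ^ k) ^+ 2] (measurable_set1 _)).
Qed.

Lemma normc_toC z : normc (toC z) ^+ 2 = sq2 z.
Proof. by rewrite normcE2. Qed.

Lemma circleP k z : circle k z <-> normc (toC z) = q ^ k.
Proof.
split=> H; last by rewrite /circle /mkset -normc_toC H.
have : normc (toC z) ^+ 2 == (q ^ k) ^+ 2 by rewrite normc_toC; apply/eqP.
by rewrite eqrXn2 ?normc_ge0 ?qz_ge0// => /eqP.
Qed.

Definition unitC (k : int) (z : R * R) : C := (q ^ (- k))%:C * toC z.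

Lemma unitC1 k z : circle k z -> normc (unitC k z) = 1.
Proof.
move=> /circleP H; rewrite normcM normc_real H ger0_norm ?qz_ge0// -qzD//.
by rewrite addNr expr0z.
Qed.

Lemma unitCK k z : (q ^ k)%:C * unitC k z = toC z.
Proof. by rewrite mulrA -realCM -qzD// subrr expr0z mul1r. Qed.

Lemma qexp_circle k z : circle k z -> qexp q (toC z) = phi q k (unitC k z).
Proof. by move=> cz; rewrite -{1}(unitCK k z) qexp_phi//; exact: unitC1. Qed.

(** On the circle this is the power j of [unitC k z]. Using the conjugate for negative j makes it
    polynomial in the real coordinates, hence measurable on the whole plane. *)
Definition monoC (k j : int) (z : R * R) : C :=
  match j with Posz n => unitC k z ^+ n | Negz n => conjc (unitC k z) ^+ n.+1 end.

Lemma monoCE k j z : circle k z -> monoC k j z = unitC k z ^ j.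
Proof.
move=> cz; have u1 := unitC1 cz; case: j => n; first by [].
change (conjc (unitC k z) ^+ n.+1 = unitC k z ^ Negz n).
by rewrite (conjc_unit u1) NegzE -exprz_inv exprN1 exprnP.
Qed.

Lemma cmeasurable_mono S k j : measurable S -> cmeasurable S (monoC k j).
Proof.
move=> mS; have mu : cmeasurable S (unitC k).
  by apply: cmeasurableM; [exact: cmeasurable_cst|exact: cmeasurable_toC].
by case: j => n; apply: cmeasurableX => //; exact: cmeasurable_conj.
Qed.

Definition ints (n : nat) : seq int :=
  [seq Posz i | i <- iota 0 n.+1] ++ [seq Negz i | i <- iota 0 n.+1].

Lemma ints_uniq n : uniq (ints n).
Proof.
rewrite cat_uniq; apply/and3P; split.
- by rewrite map_inj_uniq ?iota_uniq// => ? ? [].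
- by apply/hasPn => _ /mapP[i _ ->]; apply/mapP => -[].
- by rewrite map_inj_uniq ?iota_uniq// => ? ? [].
Qed.

Lemma ints_out n j : j \notin ints n -> (n < `|j|)%N.
Proof.
apply: contraR; rewrite -leqNgt mem_cat; case: j => i ji.
  by apply/orP; left; apply: map_f; rewrite mem_iota.
by apply/orP; right; apply: map_f; rewrite mem_iota /=; move: ji => /=; exact: ltnW.
Qed.

(** Outside [ints n] one has |j| >= n + 1, so the tail is at most the first moment divided by n +
    1. *)
Lemma phi_partial k (w : C) n : normc w = 1 ->
  normc (\sum_(j <- ints n) (fqc q j k)%:C * w ^ j - phi q k w) <= phi_lip q k / n.+1%:R.
Proof.
move=> w1; have sw := phi_summable hq k w1.
have [s1 <-] := csum_seq (fun j : int => (fqc q j k)%:C * w ^ j) (ints_uniq n).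
have sl := phi_lip_summable hq k.
rewrite phiE -(csumB s1 sw); apply: le_trans (normc_csum (csummableB s1 sw)) _.
rewrite mulrC /phi_lip -(rsumZ _ sl).
apply: ler_rsum; [exact: (csummableB s1 sw)|exact: (rsummableZ _ sl)|].
move=> j; case: ifPn => jn.
  by rewrite subrr normc0 mulr_ge0 ?invr_ge0// mulr_ge0.
rewrite sub0r normcN normcM normc_real (normc_expz j w1) mulr1 mulrA.
rewrite -[leLHS]mul1r; apply: ler_wpM2r => //.
by rewrite mulrC ler_pdivlMr ?ltr0Sn// mul1r ler_nat; exact: ints_out.
Qed.

Lemma cmeasurable_qexp_circle k : cmeasurable (circle k) (fun z => qexp q (toC z)).
Proof.
have mc := measurable_circle k.
apply: (@cmeasurable_cvg _ (fun n z => \sum_(j <- ints n) (fqc q j k)%:C * monoC k j z)).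
  move=> n; apply: cmeasurable_sum => j.
  by apply: cmeasurableM; [exact: cmeasurable_cst|exact: cmeasurable_mono].
move=> z cz; exists (phi_lip q k) => n; rewrite (qexp_circle cz).
rewrite (eq_bigr (fun j => (fqc q j k)%:C * unitC k z ^ j)).
  exact/phi_partial/unitC1.
by move=> j _; rewrite monoCE.
Qed.

Definition D2 : set (R * R) := [set z : R * R | Cbar_q q (z.1 +i* z.2)].

Lemma D2P z : D2 z <-> sq2 z = 0 \/ exists k, circle k z.
Proof.
rewrite /D2 /Cbar_q /= -[z.1 +i* z.2]/(toC z); split.
  case=> [H|[k]]; first by left; rewrite -normc_toC H normc0 expr0n.
  by move=> H; right; exists k; apply/circleP; apply: (@complexI R); rewrite -H.
case=> [H|[k /circleP H]]; last by right; exists k; rewrite -H.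
left; apply: Normc.eq0_normc; apply/eqP; rewrite -(@eqrXn2 _ 2) ?normc_ge0//.
by rewrite normc_toC H expr0n.
Qed.

(** The domain is a countable union of the origin, where the function is constant, and the circles,
    where it is a limit of trigonometric polynomials. *)
Lemma cmeasurable_qexp : cmeasurable D2 (fun z => qexp q (toC z)).
Proof.
pose zs : set (R * R) := [set z | sq2 z = 0].
have mzs : measurable zs.
  rewrite -[X in measurable X]setTI; exact: (@measurable_sq2 R measurableT [set 0] (measurable_set1 _)).
have czs : cmeasurable zs (fun z => qexp q (toC z)).
  have E : {in zs, (fun=> qexp q 0) =1 (fun z => qexp q (toC z))}.
    move=> z; rewrite inE => zz; congr qexp; apply/esym/Normc.eq0_normc/eqP.
    by rewrite -(@eqrXn2 _ 2) ?normc_ge0// normc_toC zz expr0n.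
  split.
    apply: (eq_measurable_fun (fun=> complex.Re (qexp q 0))) => [z /E -> //|].
    exact: measurable_cst.
  apply: (eq_measurable_fun (fun=> complex.Im (qexp q 0))) => [z /E -> //|].
  exact: measurable_cst.
pose S n : set (R * R) :=
  if n is k.+1 then (if @pickle_inv int k is Some j then circle j else zs) else zs.
have mS n : measurable (S n).
  case: n => [//|n] /=; case: pickle_inv => // j; exact: measurable_circle.
have cS n : cmeasurable (S n) (fun z => qexp q (toC z)).
  case: n => [//|n] /=; case: pickle_inv => // j; exact: cmeasurable_qexp_circle.
have DS : D2 = \bigcup_n S n.
  apply/seteqP; split=> z.
    move=> /D2P[zz|[k cz]]; first by exists 0%N.
    exists (pickle k).+1; first exact: Logic.I.
    by rewrite /S pickleK_inv.
  move=> [n _ Sz]; apply/D2P; case: n Sz => [|n] /=; first by left.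
  by case: pickle_inv => [k cz|]; [right; exists k|left].
by rewrite DS; split; apply/(measurable_fun_bigcup _ mS) => n; have [] := cS n.
Qed.

Lemma qexp_bounded z : D2 z -> normc (qexp q (toC z)) <= Num.max (wiener_bound q) (normc (qexp q 0)).
Proof.
move=> /D2P[zz|[k cz]].
  have -> : toC z = 0.
    apply: Normc.eq0_normc; apply/eqP.
    by rewrite -(@eqrXn2 _ 2) ?normc_ge0// normc_toC zz expr0n.
  by rewrite le_max lexx orbT.
rewrite (qexp_circle cz) le_max (normc_phi_le hq)//.
exact: unitC1.
Qed.

End MeasurabilityQexp.

Lemma small_box_gt0 (R : realType) (q c e n : R) :
  0 < q -> 0 < c -> 24 * e < c * (1 - q) -> `|c - n| <= 12 * e -> 0 < n.
Proof.
move=> q0 c0 smb far; have := ler_norm (c - n).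
have : c * (1 - q) <= c by rewrite ler_piMr ?(ltW c0)//; lra.
move: smb far; lra.
Qed.

Lemma small_box_lt (R : realType) (q c e : R) :
  0 < q -> 0 < c -> 13 * e < c * (1 - q) -> 13 * e < c.
Proof.
move=> q0 c0 smb; have : c * (1 - q) <= c by rewrite ler_piMr ?(ltW c0)//; lra.
move: smb; lra.
Qed.

(** * Identification of F with the convolution *)

Section IdentifyF.
Variables (R : realType) (q : R).
Hypothesis hq : 0 < q < 1.
Local Notation C := R[i].
Local Notation normc := Normc.normc.
Local Notation J := (L * L)%type.
Local Notation wt := (wt q).
Local Notation TX := (TX q).

Let q0 : 0 < q. Proof. by case/andP: hq. Qed.
Let q1 : q < 1. Proof. by case/andP: hq. Qed.

Lemma normc_ip_nrm (I : choiceType) (x y : vec R I) : l2 x -> l2 y ->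
  normc (ip x y) <= nrm x * nrm y.
Proof.
move=> lx ly; have [s sE] : exists s, s = ip x y by exists (ip x y).
rewrite -sE; have [->|s0] := eqVneq s 0; first by rewrite normc0 mulr_ge0 ?nrm_ge0.
have n0 : 0 < normc s.
  rewrite lt_def normc_ge0 andbT; apply: contra s0 => /eqP H.
  by apply/eqP; exact: Normc.eq0_normc.
pose c := (normc s)^-1%:C * conjc s.
have c1 : normc c = 1.
  by rewrite normcM normc_real normc_conj ger0_norm ?invr_ge0 ?normc_ge0// mulVf// gt_eqF.
have := Re_ip_le lx (l2Z c ly); rewrite (ipZr c lx ly) (nrmZ c ly) c1 mul1r -sE.
by rewrite /c -mulrA mul_conjc -realCM /= expr2 mulrA mulVf ?mul1r// gt_eqF.
Qed.

Definition shv (j : int) (w : vec R J) : vec R J := fun a => w (shF (- j) a).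

Lemma shv_l2 j w : l2 w -> l2 (shv j w).
Proof. exact: (l2_comp (bij_inj (shF_bij (- j)))). Qed.

Lemma nrm_shv j w : nrm (shv j w) = nrm w.
Proof. by rewrite /nrm /shv (sqn_comp w (shF_bij (- j))). Qed.

(** Telescoping: shifts and multiplication by the unimodular z preserve the norm, so each of the |j|
    steps costs one copy of the defect. *)
Lemma shv_power w (z : C) (j : int) : l2 w -> normc z = 1 ->
  nrm (fun a => shv j w a - z ^ j * w a) <=
  `|j|%N%:R * nrm (fun a => shv 1 w a - z * w a).
Proof.
move=> lw z1; set D := nrm (fun a => shv 1 w a - z * w a).
have zn0 := normc_unit_neq0 z1.
have P (n : nat) : nrm (fun a => shv n%:Z w a - z ^ n%:Z * w a) <= n%:R * D.
  elim: n => [|n IH].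
    rewrite mul0r (_ : (fun a => _) = fun=> 0); last first.
      by apply/funext => a; rewrite /shv oppr0 shF0 mul1r subrr.
    apply: nrm_le => //; rewrite expr0n /= le_eqVlt; apply/orP; left; apply/eqP.
    rewrite /sqn (eq_rsum (g := fun=> 0)) ?rsum0// => a.
    by rewrite normc0 expr0n.
  pose u a := shv n%:Z w a - z ^ n%:Z * w a.
  have lu : l2 u := l2B (shv_l2 _ lw) (l2Z _ lw).
  have lx : l2 (fun a => shv 1 w a - z * w a) := l2B (shv_l2 _ lw) (l2Z _ lw).
  rewrite (_ : (fun a => _) = fun a => shv 1 u a + z ^ n%:Z * (shv 1 w a - z * w a)).
    apply: le_trans (nrmD (shv_l2 1 lu) (l2Z _ lx)) _.
    rewrite nrm_shv (nrmZ _ lx) (normc_expz _ z1) mul1r -natr1 mulrDl mul1r.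
    by rewrite lerD2r.
  apply/funext => a; rewrite /u /shv -shFD (_ : - n%:Z + -1 = - n.+1%:Z); last by lia.
  by rewrite -[z ^ n.+1%:Z]/(z ^+ n.+1) exprSr -exprnP; ring.
case: j => n; first exact: P.
(* A negative power is, up to a unimodular factor, the defect of the positive power pulled back by
   the inverse shift. *)
have E : (fun a => shv (Negz n) w a - z ^ (Negz n) * w a) =
   (fun a => (fun b => - z ^ (Negz n) * (shv n.+1%:Z w b - z ^ n.+1%:Z * w b)) (shF n.+1%:Z a)).
  apply/funext => a; rewrite /shv NegzE (opprK n.+1%:Z) shFK.
  have E0 : z ^ (- n.+1%:Z) * z ^ n.+1%:Z = 1 by rewrite -expfzDr// addNr expr0z.
  rewrite mulrBr mulrA mulNr mulNr [in X in _ = _ - X]mulNr E0.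
  by ring.
have lu : l2 (fun b => shv n.+1%:Z w b - z ^ n.+1%:Z * w b) := l2B (shv_l2 _ lw) (l2Z _ lw).
pose v b := - z ^ (Negz n) * (shv n.+1%:Z w b - z ^ n.+1%:Z * w b).
have -> : nrm (fun a => shv (Negz n) w a - z ^ (Negz n) * w a) = nrm v.
  by rewrite E /nrm -(sqn_comp v (shF_bij n.+1%:Z)).
rewrite /v (nrmZ _ lu) normcN (normc_expz _ z1) mul1r; exact: P.
Qed.

Lemma fqc_wienerP : wiener (fqc q) (wiener_bound q).
Proof. exact: fqc_wiener. Qed.

Lemma fqc_orthogonal : orthogonal_coef (fqc q).
Proof.
move=> k n; rewrite -/(corr q k n); have [->|k0] := eqVneq k 0; first by rewrite corr0.
by rewrite corr_neq0.
Qed.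

Definition CF : op R J := conv shF mF (fqc q).

Lemma CF_l2 x : l2 x -> l2 (CF x).
Proof. by move=> lx; have [] := conv_l2 shF0 shFD mF_sh fqc_wienerP lx. Qed.

(** The difference v is paired with itself: (v | CF w) is a scalar series in the (v | shv j w), each
    within the bound of [shv_power] of z^j (v | w), and the first moment sums these bounds. *)
Lemma CF_near w (m : int) (z : C) : l2 w -> normc z = 1 ->
  (forall a, w a != 0 -> mF a = m) ->
  nrm (fun a => CF w a - phi q m z * w a) <= phi_lip q m * nrm (fun a => shv 1 w a - z * w a).
Proof.
move=> lw z1 lev; set D := nrm (fun a => shv 1 w a - z * w a).
have lC := CF_l2 lw; have lp := l2Z (phi q m z) lw.
set v := fun a => CF w a - _; have lv : l2 v := l2B lC lp.
have bs := bilinear_summable shF0 shFD mF_sh fqc_wienerP lw lv.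
(* Since w lives on one level, the coefficients do not depend on the point, and the two summations
   can be exchanged. *)
have E1 : ip v (CF w) = csum (fun j => (fqc q j m)%:C * ip v (shv j w)).
  rewrite (ip_conv shF0 shFD mF_sh fqc_wienerP lw lv).
  have bs' : csummable (fun p : J * int => conjc (v p.1) * ((fqc q p.2 m)%:C * w (shF (- p.2) p.1))).
    move: bs; congr csummable; apply/funext => -[a j] /=.
    have [->|n0] := eqVneq (w (shF (- j) a)) 0; first by rewrite !mulr0.
    by rewrite -(lev _ n0) mF_sh.
  transitivity (csum (fun p : J * int => conjc (v p.1) * ((fqc q p.2 m)%:C * w (shF (- p.2) p.1)))).
    apply: eq_csum => -[a j] /=.
    have [->|n0] := eqVneq (w (shF (- j) a)) 0; first by rewrite !mulr0.
    by rewrite -(lev _ n0) mF_sh.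
  have [_ _ ->] := csum_pair bs'.
  rewrite (csum_exchange bs'); apply: eq_csum => j.
  rewrite ipE -csumZ; last exact: (csummable_ip lv (shv_l2 j lw)).
  by apply: eq_csum => a /=; rewrite mulrCA.
have sp := phi_summable hq m z1.
have E2 : ip v (fun a => phi q m z * w a) = csum (fun j => (fqc q j m)%:C * (z ^ j * ip v w)).
  rewrite (ipZr _ lv lw) phiE mulrC -(csumZ _ sp).
  by apply: eq_csum => j; rewrite mulrC mulrA.
have su j : l2 (fun a => shv j w a - z ^ j * w a) := l2B (shv_l2 j lw) (l2Z _ lw).
have bnd j : normc ((fqc q j m)%:C * ip v (fun a => shv j w a - z ^ j * w a)) <=
    nrm v * D * (`|j|%N%:R * `|fqc q j m|).
  rewrite normcM normc_real [leRHS](_ : _ = `|fqc q j m| * (nrm v * (`|j|%N%:R * D))); last by ring.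
  rewrite ler_wpM2l//; apply: le_trans (normc_ip_nrm lv (su j)) _.
  by rewrite ler_wpM2l ?nrm_ge0// shv_power.
have sl := phi_lip_summable hq m.
have ss : csummable (fun j => (fqc q j m)%:C * ip v (fun a => shv j w a - z ^ j * w a)).
  exact: csummable_le bnd (rsummableZ _ sl).
have s2 : csummable (fun j => (fqc q j m)%:C * (z ^ j * ip v w)).
  have := csummableZ (ip v w) sp; congr csummable; apply/funext => j.
  by rewrite mulrC mulrA.
have E3 : (sqn v)%:C = csum (fun j => (fqc q j m)%:C * ip v (fun a => shv j w a - z ^ j * w a)).
  have s1 : csummable (fun j => (fqc q j m)%:C * ip v (shv j w)).
    have := csummableD ss s2; congr csummable; apply/funext => j.
    by rewrite (ipBr lv (shv_l2 j lw) (l2Z _ lw)) (ipZr _ lv lw) -mulrDr subrK.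
  rewrite -ipxx {2}/v (ipBr lv lC lp) E1 E2 -(csumB s1 s2); apply: eq_csum => j.
  by rewrite -mulrBr (ipBr lv (shv_l2 j lw) (l2Z _ lw)) (ipZr _ lv lw).
have H : sqn v <= nrm v * D * phi_lip q m.
  have -> : sqn v = normc (sqn v)%:C by rewrite normc_real ger0_norm ?sqn_ge0.
  rewrite E3; apply: le_trans (normc_csum ss) _.
  rewrite /phi_lip -(rsumZ _ sl); apply: ler_rsum => //; exact: (rsummableZ _ sl).
rewrite -nrm_sqr expr2 -mulrA in H.
have [->|n0] := eqVneq (nrm v) 0; first by rewrite mulr_ge0 ?phi_lip_ge0 ?nrm_ge0.
have npos : 0 < nrm v by rewrite lt_def n0 nrm_ge0.
by move: H; rewrite ler_pM2l// mulrC.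
Qed.

Variable E : set (R * R) -> op R J.
Hypothesis hsm : spectral_measure_of (opX q) E.
Let hE := smo_spectral hsm.
Variable F : op R J.
Hypothesis mD2 : measurable (@D2 R q).
Hypothesis ED2 : eq_op_l2 (E (~` @D2 R q)) (fun _ _ => 0).
Hypothesis bF : bounded_op F.
Hypothesis fF : forall x mu, l2 x -> scalar_measure E x mu ->
  ip x (F x) = cint mu (@D2 R q) (qexp q).

Lemma F_l2 x : l2 x -> l2 (F x).
Proof. by move=> lx; have [M _ HM] := bounded_l2 bF; have [] := HM x lx. Qed.

Lemma F_lin c (x y : vec R J) : l2 x -> l2 y ->
  F (fun i => c * x i + y i) = fun i => c * F x i + F y i.
Proof. by case: bF => lF _ lx ly; exact: lF. Qed.

Lemma formF w mu : l2 w -> scalar_measure E w mu ->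
  [/\ mu.-integrable (@D2 R q) (EFin \o (fun z : R * R => complex.Re (qexp q (z.1 +i* z.2)))),
      mu.-integrable (@D2 R q) (EFin \o (fun z : R * R => complex.Im (qexp q (z.1 +i* z.2))))
    & ip w (F w) = cint mu (@D2 R q) (qexp q)].
Proof.
move=> lw hmu; have [m1 m2] := cmeasurable_qexp hq.
have mufin : (mu (@D2 R q) < +oo)%E by rewrite (sm_scalar hE hmu lw mD2) ltry.
split; last exact: fF.
  apply: measurable_bounded_integrable => //.
  exists (Num.max (wiener_bound q) (normc (qexp q 0))); split; first exact: num_real.
  move=> x Hx z Dz /=; apply: le_trans (normr_Re _) _; apply: le_trans (ltW Hx).
  exact: (qexp_bounded hq).
apply: measurable_bounded_integrable => //.
exists (Num.max (wiener_bound q) (normc (qexp q 0))); split; first exact: num_real.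
move=> x Hx z Dz /=; apply: le_trans (normr_Im _) _; apply: le_trans (ltW Hx).
exact: (qexp_bounded hq).
Qed.

Lemma l2_lin c (x y : vec R J) : l2 x -> l2 y -> l2 (fun i => c * x i + y i).
Proof. by move=> lx ly; exact: (l2D (l2Z c lx) ly). Qed.

Lemma F_commute A x : measurable A -> l2 x -> E A (F x) = F (E A x).
Proof.
move=> mA lx; have [m1 m2] := cmeasurable_qexp hq.
apply: (@form_commute _ _ _ hE (@l2 R J) F (@D2 R q) (qexp q)) => //.
- exact: l2_lin.
- exact: F_lin.
- exact: F_l2.
- by move=> B y mB ly; exact: sm_l2.
- exact: l2_basis.
- exact: formF.
Qed.

Lemma F_near A w g0 e : measurable A -> l2 w -> E A w = w -> 0 < e ->
  (forall z : R * R, A z -> D2 q z -> normc (qexp q (z.1 +i* z.2) - g0) <= e) ->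
  nrm (fun a => F w a - g0 * w a) <= 12 * e * nrm w.
Proof.
move=> mA lw Aw e0 H; have [m1 m2] := cmeasurable_qexp hq.
apply: nrm_le; first by rewrite mulr_ge0 ?nrm_ge0// mulr_ge0// ltW.
rewrite exprMn nrm_sqr.
apply: (@form_near _ _ _ hE (@l2 R J) F (@D2 R q) (qexp q) _ _ _ _ _ _ _ _ _ _ _ A) => //.
- exact: l2_lin.
- exact: F_lin.
- exact: F_l2.
- by move=> B y mB ly; exact: sm_l2.
- exact: l2_basis.
- exact: formF.
- by have := l2B (F_l2 lw) (l2Z g0 lw).
Qed.

Section SmallBox.
Variables (A : set (R * R)) (z0 : C) (e : R) (b : J).
Hypothesis mA : measurable A.
Hypothesis e0 : 0 < e.
Hypothesis Az0 : forall z : R * R, A z -> normc ((z.1 +i* z.2) - z0) <= e.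
Hypothesis small : 24 * e < wt b * (1 - q).

(** On the level of b, [CF] is a series of shifts with fixed coefficients, and E A commutes with
    these shifts by [E_shift]. The series is moved across E A coordinate by coordinate, through the
    adjoint of [CF]. *)
Lemma CF_commute : E A (CF (basis R b)) = CF (E A (basis R b)).
Proof.
have lb := l2_basis R b; have lCb := CF_l2 lb; have lw := sm_l2 hE mA lb.
apply/funext => a; have la := l2_basis R a; have ly := sm_l2 hE mA la.
rewrite -[LHS]ip_basisl -(sm_sym hE mA la lCb) -(ip_conj lCb ly).
rewrite (conv_adjoint shF0 shFD mF_sh fqc_wienerP lb ly) ip_basisl.
have cs := conv_summable shF mF b (wiener_rev fqc_wienerP) ly.
rewrite /conv -(csum_conj cs) -[RHS](csum_bij _ oppz_bij); apply: eq_csum => j.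
have lj := l2_basis R (shF (- j) b).
have X : conjc (E A (basis R a) (shF (- j) b)) = E A (basis R b) (shF j a).
  rewrite -(ip_basisr _ (E A (basis R a))) (sm_sym hE mA la lj) ip_basisl.
  by rewrite (E_shift hq hsm mA e0 Az0 small) opprK.
rewrite conjcM conjc_real X /crev /= opprK.
have [->|n0] := eqVneq (E A (basis R b) (shF j a)) 0; first by rewrite !mulr0.
have n0' : E A (basis R (shF 0 b)) (shF j a) != 0 by rewrite shF0.
by rewrite -(level_support hq hsm mA e0 Az0 small n0') mF_sh.
Qed.

(** 156 = 12 * 13: [near_X] and [F_near] cost a factor 12, and recentring the disc at a point of
    modulus wt b enlarges its radius to 13 e. One [phi_lip] and the 1 come from F, the other
    [phi_lip] from [CF]. *)
Definition boxK : R := 156 / wt b * (2 * phi_lip q (mF b) + 1).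

Lemma box_estimate : nrm (fun a => F (E A (basis R b)) a - CF (E A (basis R b)) a) <=
  boxK * e * nrm (E A (basis R b)).
Proof.
have smb := small; have lb := l2_basis R b; have lw := sm_l2 hE mA lb; have Aw := sm_idem hE mA lb.
have c0 : 0 < wt b by exact: qz_gt0.
have lip0 := phi_lip_ge0 q (mF b).
have K0 : 0 <= boxK by rewrite mulr_ge0 ?divr_ge0 ?(ltW c0)//; lra.
have rhs0 : 0 <= boxK * e * nrm (E A (basis R b)).
  by rewrite mulr_ge0 ?nrm_ge0// mulr_ge0// ltW.
(* If the disc is far from the circle of b, E A kills the basis vector and both terms vanish. *)
case: (ltP (12 * e) `|wt b - normc z0|) => far.
  have w0 := basis_far hq hsm mA e0 Az0 far.
  have F0 : F (fun=> 0) = fun=> 0 by case: bF => lF _; exact: linear_l20.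
  have C0 : CF (fun=> 0) = fun=> 0 by exact: (linear_l20 (conv_linear shF mF fqc_wienerP)).
  rewrite w0 F0 C0 in rhs0 *; apply: nrm_le => //.
  rewrite (_ : sqn _ = 0) ?sqr_ge0// /sqn (eq_rsum (g := fun=> 0)) ?rsum0// => a.
  by rewrite subrr normc0 expr0n.
set w := E A (basis R b) in lw Aw rhs0 *; set c := wt b in c0 far smb *.
have r0 : 0 < normc z0.
  exact: small_box_gt0 q0 c0 smb far.
(* The direction of z0; the point z' = c ze of modulus c = wt b is then within 12 e of z0. *)
pose ze : C := (normc z0)^-1%:C * z0.
have ze1 : normc ze = 1.
  by rewrite normcM normc_real ger0_norm ?invr_ge0 ?normc_ge0// mulVf// gt_eqF.
pose z' : C := c%:C * ze.
have z'n : normc z' = c by rewrite normcM ze1 mulr1 normc_real gtr0_norm.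
have zz' : normc (z0 - z') <= 12 * e.
  have -> : z0 - z' = (normc z0 - c)%:C * ze.
    rewrite realCB mulrBl -/z'; congr (_ - _).
    by rewrite /ze mulrA -realCM mulfV ?gt_eqF// mul1r.
  by rewrite normcM ze1 mulr1 normc_real distrC.
have Az' (z : R * R) : A z -> normc ((z.1 +i* z.2) - z') <= 13 * e.
  move=> Az; rewrite (_ : _ - z' = ((z.1 +i* z.2) - z0) + (z0 - z')); last by ring.
  apply: le_trans (normcD _ _) _; have := Az0 Az; lra.
have e13 : 0 < 13 * e by rewrite mulr_gt0.
have lev a : w a != 0 -> mF a = mF b.
  move=> wa; have wa' : E A (basis R (shF 0 b)) a != 0 by rewrite shF0.
  exact: (level_support hq hsm mA e0 Az0 small wa').
have nX := near_X hsm mA e13 Az' lw Aw.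
have TXE : (fun a => TX w a - z' * w a) = (fun a => c%:C * (shv 1 w a - ze * w a)).
  apply/funext => a; rewrite /TX mulrBr mulrA -/z'; congr (_ - _).
  rewrite -/(shv 1 w a); have [->|n0] := eqVneq (shv 1 w a) 0; first by rewrite !mulr0.
  by rewrite /wt -(mF_sh (- 1) a) (lev _ n0).
have lS : l2 (fun a => shv 1 w a - ze * w a) := l2B (shv_l2 1 lw) (l2Z _ lw).
rewrite TXE (nrmZ _ lS) normc_real (gtr0_norm c0) in nX.
have nS : nrm (fun a => shv 1 w a - ze * w a) <= 156 / c * e * nrm w.
  rewrite (_ : 156 / c * e * nrm w = (12 * (13 * e) * nrm w) / c); last by field; rewrite gt_eqF.
  by rewrite ler_pdivlMr// mulrC.
have nC := CF_near lw ze1 lev.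
(* Variation of [phi] over the disc, rescaled to the unit circle; the 1 makes it positive even if
   [phi_lip] vanishes. *)
pose eF := (phi_lip q (mF b) + 1) * (13 * e / c).
have eF0 : 0 < eF by rewrite mulr_gt0 ?divr_gt0// ltr_wpDl.
have nF : nrm (fun a => F w a - phi q (mF b) ze * w a) <= 12 * eF * nrm w.
  apply: (F_near mA lw Aw eF0) => z Az Dz.
  have h := Az' z Az; have sm13 : 13 * e < c * (1 - q) by move: smb; lra.
  have hc : `|normc (toC z) - c| <= 13 * e.
    rewrite -z'n ler_norml; have := normcD (toC z - z') z'; rewrite subrK => h1.
    have := normcB (toC z) (toC z - z'); rewrite (_ : toC z - (toC z - z') = z'); last by ring.
    by move=> h2; apply/andP; split; move: h; rewrite -/(toC z); lra.
  (* The origin is excluded by 13 e < c, and among the circles only the one of b is close enough. *)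
  move: Dz => /(D2P hq)[zz|[k cz]].
    have n0 : normc (toC z) = 0.
      by apply/eqP; rewrite -(@eqrXn2 _ 2) ?normc_ge0// normc_toC zz expr0n.
    exfalso; rewrite n0 sub0r normrN (gtr0_norm c0) in hc.
    by move: hc; rewrite leNgt => /negP; apply; exact: small_box_lt q0 c0 sm13.
  have km : k = mF b.
    have nz := (circleP hq k z).1 cz; rewrite nz in hc.
    exact: (wt_gap hq e0 small (le_lt_trans hc sm13)).
  rewrite -/(toC z) (qexp_circle hq cz) km.
  have u1 := unitC1 hq cz.
  apply: le_trans (phi_lipschitz hq (mF b) _ ze1) _; first by rewrite -km.
  have -> : unitC q (mF b) z - ze = c^-1%:C * (toC z - z').
    by rewrite mulrBr /z' mulrA -realCM mulVf ?gt_eqF// mul1r /unitC qzN.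
  rewrite normcM normc_real gtr0_norm ?invr_gt0//.
  have le1 : c^-1 * normc (toC z - z') <= 13 * e / c by rewrite mulrC ler_pM2r ?invr_gt0.
  have le2 : phi_lip q (mF b) * (c^-1 * normc (toC z - z')) <= phi_lip q (mF b) * (13 * e / c).
    exact: ler_wpM2l.
  apply: le_trans le2 _; rewrite /eF; apply: ler_wpM2r; first by rewrite divr_ge0 ?ltW.
  by rewrite lerDl.
have lFw := F_l2 lw; have lCw := CF_l2 lw; have lpw := l2Z (phi q (mF b) ze) lw.
have -> : (fun a => F w a - CF w a) = (fun a => (F w a - phi q (mF b) ze * w a) +
   - (CF w a - phi q (mF b) ze * w a)) by apply/funext => a; ring.
apply: le_trans (nrmD (l2B lFw lpw) (l2N (l2B lCw lpw))) _; rewrite nrmN.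
have nC' : phi_lip q (mF b) * nrm (fun a => shv 1 w a - ze * w a) <=
   phi_lip q (mF b) * (156 / c * e * nrm w) by exact: ler_wpM2l.
rewrite (_ : boxK * e * nrm w = 12 * eF * nrm w + phi_lip q (mF b) * (156 / c * e * nrm w)).
  by apply: lerD => //; exact: le_trans nC nC'.
by rewrite /boxK /eF -/c; field; rewrite gt_eqF.
Qed.

End SmallBox.

(** F and [CF] both commute with E A on this vector, for A in a small box, so [sm_grid] sums the
    bounds of [box_estimate]. The resulting squared norm is of order dl^2 for every small mesh
    dl. *)
Lemma F_basis b : F (basis R b) = CF (basis R b).
Proof.
have lb := l2_basis R b; have lF := F_l2 lb; have lC := CF_l2 lb.
pose v : vec R J := fun a => F (basis R b) a - CF (basis R b) a.
have lv : l2 v := l2B lF lC.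
have c0 : 0 < wt b by exact: qz_gt0.
(* A box of side dl lies within 2 dl of its corner; for dl <= d0 the condition 24 (2 dl) < wt b (1 -
   q) holds with a factor 2 to spare. *)
pose d0 := wt b * (1 - q) / 96.
have d00 : 0 < d0 by rewrite divr_gt0// mulr_gt0// subr_gt0.
have key dl : 0 < dl -> dl <= d0 -> sqn v <= (boxK b * (2 * dl)) ^+ 2.
  move=> dl0 dld; rewrite (_ : _ ^+ 2 = (boxK b * (2 * dl)) ^+ 2 * sqn (basis R b)); last by rewrite sqn_basis mulr1.
  apply: (sm_grid hE dl0 (sqr_ge0 _) lv lb) => A a1 a2 mA HA.
  have e0 : 0 < 2 * dl by rewrite mulr_gt0.
  have Az0 (z : R * R) : A z -> normc ((z.1 +i* z.2) - (a1 +i* a2)) <= 2 * dl.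
    move=> /HA[/andP[h1 h2] /andP[h3 h4]]; apply: le_trans (normc_le _) _ => /=.
    rewrite !ger0_norm ?subr_ge0//; lra.
  have small : 24 * (2 * dl) < wt b * (1 - q).
    have : d0 * 96 = wt b * (1 - q) by rewrite divfK// pnatr_eq0.
    by move: dld d00; lra.
  have -> : E A v = fun a => F (E A (basis R b)) a - CF (E A (basis R b)) a.
    rewrite /v (linear_l2B (sm_lin hE mA) lF lC) (F_commute mA lb).
    by rewrite (CF_commute mA e0 Az0 small).
  rewrite -!nrm_sqr -exprMn lerXn2r ?nnegrE ?nrm_ge0//.
    apply: mulr_ge0; last exact: nrm_ge0.
    apply: mulr_ge0; last exact: ltW e0.
    by rewrite mulr_ge0 ?divr_ge0 ?(ltW c0)//; have := phi_lip_ge0 q (mF b); lra.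
  exact: (box_estimate mA e0 Az0 small).
have v0 : sqn v = 0.
  have h12 : 0 < (1 / 2 : R) < 1 by lra.
  apply: (geo_bounded_eq0 h12 (M := (boxK b * (2 * d0)) ^+ 2)) => n.
  have hn : 0 < (1 / 2 : R) ^+ n <= 1.
    apply/andP; split; first by apply: exprn_gt0; lra.
    by apply: exprn_ile1; lra.
  case/andP: hn => hn0 hn1.
  rewrite (ger0_norm (sqn_ge0 v)); apply: le_trans (key (d0 * (1 / 2) ^+ n) _ _) _.
  - by rewrite mulr_gt0.
  - by rewrite -[leRHS]mulr1 ler_pM2l.
  rewrite !mulrA [_ * _ ^+ n]mulrC exprMn mulrC; apply: ler_wpM2l; first exact: sqr_ge0.
  by rewrite expr2 -[leRHS]mulr1 ler_pM2l.
have /funeqP H := sqn_eq0 lv v0.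
by apply/funext => a; apply/eqP; rewrite -subr_eq0; apply/eqP; exact: H.
Qed.

Lemma F_conv : eq_op_l2 F CF.
Proof.
apply: bounded_op_ext => //; last exact: F_basis.
exact: (conv_bounded shF0 shFD mF_sh fqc_wienerP).
Qed.

End IdentifyF.

Lemma borel_calculus_conv (R : realType) (q : R) (F : op R (L * L)%type) : 0 < q < 1 ->
  borel_calculus (opX q) (@Cbar_q R q) (qexp q) F -> eq_op_l2 F (CF q).
Proof.
by move=> hq [E [hsm [mD2 ED2] bF fF]]; exact: (F_conv hq hsm mD2 ED2 bF fF).
Qed.

(** * Operators that permute the basis *)

Section PermutationOperators.
Variable R : realType.
Local Notation C := R[i].
Implicit Types I J : choiceType.

Lemma unitary_eq I (S T : op R I) : eq_op_l2 S T -> unitary S -> unitary T.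
Proof.
move=> ST [lS l2S ipS sS]; split.
- move=> c x y lx ly; have lxy := l2D (l2Z c lx) ly.
  by rewrite -(ST _ lx) -(ST _ ly) -(ST _ lxy) lS.
- by move=> x lx; rewrite -ST//; exact: l2S.
- by move=> x y lx ly; rewrite -!ST//; exact: ipS.
- by move=> y ly; have [x lx <-] := sS y ly; exists x => //; rewrite ST.
Qed.

Definition permutes I (T : op R I) (s : I -> I) : Prop :=
  bijective s /\ forall x i, T x i = x (s i).

Lemma permutes_l2 I (T : op R I) s x : permutes T s -> l2 x -> l2 (T x).
Proof.
move=> [bs Ts] lx; rewrite (_ : T x = fun i => x (s i)); last exact/funext.
exact: (l2_comp (bij_inj bs)).
Qed.

Lemma permutes_unitary I (T : op R I) s : permutes T s -> unitary T.
Proof.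
move=> Ps; have [bs Ts] := Ps; split.
- by move=> c x y _ _; apply/funext => i; rewrite !Ts.
- by move=> x; exact: (permutes_l2 Ps).
- move=> x y _ _; rewrite !ipE -[RHS](csum_bij _ bs).
  by apply: eq_csum => i /=; rewrite !Ts.
- move=> y ly; have [t st ts] := bs; exists (fun i => y (t i)).
    exact: (l2_comp (can_inj ts)).
  by apply/funext => i; rewrite Ts st.
Qed.

Lemma adj_permutes I (T : op R I) s t : cancel s t -> cancel t s ->
  (forall x i, T x i = x (s i)) -> forall x i, adj T x i = x (t i).
Proof.
move=> st ts Ts x i; rewrite /adj (_ : T (basis R i) = basis R (t i)) ?ip_basisl//.
apply/funext => j; rewrite Ts /basis; congr (_%:R).
by rewrite -[in RHS](inj_eq (can_inj st)) ts.
Qed.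

End PermutationOperators.

(** * Diagonal operators, their tensor products and commutants *)

Section DiagonalGraphs.
Variable R : realType.
Local Notation C := R[i].
Local Notation normc := Normc.normc.
Implicit Types I J : choiceType.

Lemma diag_basis I (w : I -> R) (c : C) i :
  diag_graph w (fun j => c * basis R i j, fun j => (w i)%:C * (c * basis R i j)).
Proof.
have lc := l2Z c (l2_basis R i); split => //=; first exact: (l2Z _ lc).
apply/funext => j /=; have [->|ji] := eqVneq j i; first by [].
by rewrite (basis_neq R ji) (mulr0 c) !mulr0.
Qed.

Lemma diag_strictly_positive I (w : I -> R) : (forall i, 0 < w i) ->
  strictly_positive (diag_graph w).
Proof.
move=> w0; split; first split.
- move=> x lx e e0; have [s us se] := l2_approx lx e0.
  exists (trunc s x, fun i => (w i)%:C * trunc s x i).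
    split => //=; first exact: l2_trunc.
    rewrite (_ : (fun i => _) = trunc s (fun i => (w i)%:C * x i)); first exact: l2_trunc.
    by apply/funext => i; rewrite /trunc; case: ifP => // _; rewrite mulr0.
  have lt := l2_trunc x us.
  by rewrite (norm2E (l2B lx lt)) lte_fin.
- apply/seteqP; split => -[x y] /=.
    move=> [/= lx ly H]; split => //=; apply/funext => i.
    (* Testing the adjoint relation on basis vectors reads off each coordinate of y. *)
    have := H _ (diag_basis w 1 i) => /=.
    have lb := l2_basis R i; have lb1 := l2Z 1 lb.
    rewrite (ipZl _ lb1 lx) !(ipZl 1 lb) // !ip_basisl conjc_real conjc1 !mul1r.
    by move=> <-.
  move=> [/= lx ly yE]; split => //= -[u v] [/= lu lv vE]; rewrite yE vE.
  by rewrite !ipE; apply: eq_csum => i /=; rewrite conjcM conjc_real mulrCA mulrA.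
- move=> [u v] [/= lu lv ->]; rewrite ipE.
  rewrite (eq_csum (g := fun i => (w i * normc (u i) ^+ 2)%:C)); last first.
    by move=> i; rewrite mulrCA mul_conjc -realCM.
  by rewrite csum_real ler0c rsum_ge0// => i; rewrite mulr_ge0 ?sqr_ge0 ?ltW.
- move=> x [/= lx _ /funeqP E]; apply/funext => i.
  move: (E i) => /esym/eqP; rewrite mulf_eq0 realC_eq0 gt_eqF//= => /eqP.
  exact.
Qed.

Lemma id_graphE I : id_graph R I = diag_graph (fun=> 1).
Proof.
apply/seteqP; split => -[x y] /=.
  by move=> [/= lx ->]; split => //=; apply/funext => i; rewrite mul1r.
by move=> [/= lx _ ->]; split => //=; apply/funext => i; rewrite mul1r.
Qed.

(** Sums of elementary tensors satisfy y = W x at each coordinate, which passes to limits.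
    Conversely, truncations of x and y to a common finite set are such sums. *)
Lemma tens_graph_diag I J (w : I -> R) (w' : J -> R) :
  tens_graph (diag_graph w) (diag_graph w') =
  diag_graph (fun ij : I * J => w ij.1 * w' ij.2).
Proof.
apply/seteqP; split => -[x y] [/= lx ly H]; split => //=.
  apply/funext => ij; set W := w ij.1 * w' ij.2.
  apply/eqP; rewrite -subr_eq0; apply/eqP; apply: Normc.eq0_normc.
  apply/eqP; rewrite -sqrf_eq0; apply/eqP; set d := _ ^+ 2.
  have d0 : 0 <= d by exact: sqr_ge0.
  have key e : 0 < e -> d <= (2 + 2 * W ^+ 2) * e.
    move=> /H[n [a [b [Aab /norm2_lt[l1 s1] /norm2_lt[l2' s2]]]]].
    have := normc_le_sqn ij l2'; have := normc_le_sqn ij l1.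
    set S1 := \sum_(s < n) _; set S2 := \sum_(s < n) _ => h1 h2.
    have S21 : S2 = W%:C * S1.
      rewrite /S2 /S1 mulr_sumr; apply: eq_bigr => s _; rewrite /tens.
      have [[_ _ ->] [_ _ ->]] := Aab s.
      by rewrite /W realCM mulrACA.
    have dE : y ij - W%:C * x ij = (y ij - S2) - W%:C * (x ij - S1).
      by rewrite S21; ring.
    have h3 : normc (y ij - W%:C * x ij) <= normc (y ij - S2) + `|W| * normc (x ij - S1).
      by rewrite dE; apply: le_trans (normcB _ _) _; rewrite normcM normc_real.
    have h4 := sqrD_le (normc (y ij - S2)) (`|W| * normc (x ij - S1)).
    have h5 : d <= (normc (y ij - S2) + `|W| * normc (x ij - S1)) ^+ 2.
      by rewrite lerXn2r ?nnegrE ?normc_ge0// (le_trans (normc_ge0 _) h3).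
    apply: le_trans h5 (le_trans h4 _); rewrite exprMn real_normK ?num_real//.
    have W2 := sqr_ge0 W.
    have : W ^+ 2 * normc (x ij - S1) ^+ 2 <= W ^+ 2 * e.
      by rewrite ler_wpM2l// (le_trans h1)// ltW.
    move: (le_trans h2 (ltW s2)); lra.
  apply/eqP; rewrite eq_le d0 andbT leNgt; apply/negP => dp.
  have K0 : 0 < 2 + 2 * W ^+ 2 by have := sqr_ge0 W; lra.
  move: K0 key dp; move: (2 + 2 * W ^+ 2) d {d0} => K d K0 key dp.
  have := key (d / (2 * K)) (divr_gt0 dp (mulr_gt0 (ltr0Sn R 1) K0)).
  have -> : K * (d / (2 * K)) = d / 2 by field; rewrite gt_eqF.
  by move: dp; lra.
move=> e e0; have [s us [s1 s2]] := l2_approx2 lx ly e0.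
pose nthi := tnth (in_tuple s).
exists (size s), (fun t => (fun i => x (nthi t) * basis R (nthi t).1 i,
    fun i => (w (nthi t).1)%:C * (x (nthi t) * basis R (nthi t).1 i))),
  (fun t => (fun j => 1 * basis R (nthi t).2 j,
    fun j => (w' (nthi t).2)%:C * (1 * basis R (nthi t).2 j))).
have bE (p ij : I * J) : basis R p.1 ij.1 * basis R p.2 ij.2 = basis R p ij.
  by rewrite /basis -natrM mulnb.
have lt1 := l2_trunc x us; have lt2 := l2_trunc y us.
split; first by move=> t; split; exact: diag_basis.
- rewrite (_ : (fun i => _) = fun i => x i - trunc s x i).
    by rewrite (norm2E (l2B lx lt1)) lte_fin.
  apply/funext => ij; rewrite truncE// [in RHS]big_tnth; congr (_ - _).
  by apply: eq_bigr => t _; rewrite /tens /= mul1r -mulrA bE.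
- rewrite (_ : (fun i => _) = fun i => y i - trunc s y i).
    by rewrite (norm2E (l2B ly lt2)) lte_fin.
  apply/funext => ij; rewrite truncE// [in RHS]big_tnth; congr (_ - _).
  apply: eq_bigr => t _; rewrite /tens /= mul1r -/(nthi t) H realCM -bE; ring.
Qed.

Lemma commutes_permutes I (T : op R I) s (w : I -> R) : permutes T s ->
  (forall i, w (s i) = w i) -> commutes T (diag_graph w).
Proof.
move=> Ps ws x y lx ly; have [[t st ts] Ts] := Ps.
have lTx := permutes_l2 Ps lx; have lTy := permutes_l2 Ps ly; split => -[/= _ _ H]; split => //=.
  by apply/funext => i; rewrite !Ts H ws.
apply/funext => i; have /funeqP/(_ (t i)) := H.
by rewrite !Ts ts -[w (t i)]ws ts.
Qed.

Lemma conv_diag I (sh : int -> I -> I) (m : I -> int) c A (w : I -> R) (x : vec R I) :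
  wiener c A -> (forall j a, w (sh j a) = w a) -> l2 x ->
  conv sh m c (fun a => (w a)%:C * x a) = fun a => (w a)%:C * conv sh m c x a.
Proof.
move=> wc wsh lx; apply/funext => a; rewrite /conv -(csumZ _ (conv_summable sh m a wc lx)).
by apply: eq_csum => j; rewrite wsh mulrCA.
Qed.

(** The weight is constant on orbits, so multiplication by it commutes with the convolution and with
    its inverse, the convolution by [crev c]; the inverse gives the converse implication. *)
Lemma commutes_conv I (sh : int -> I -> I) (m : I -> int) c A (w : I -> R) (T : op R I) :
  (forall a, sh 0 a = a) -> (forall i j a, sh (i + j) a = sh i (sh j a)) ->
  (forall j a, m (sh j a) = m a) -> wiener c A -> orthogonal_coef c ->
  (forall j a, w (sh j a) = w a) -> eq_op_l2 T (conv sh m c) ->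
  commutes T (diag_graph w).
Proof.
move=> sh0 shD msh wc oc wsh TE x y lx ly.
have [lcx _] := conv_l2 sh0 shD msh wc lx; have [lcy _] := conv_l2 sh0 shD msh wc ly.
rewrite !TE//; split => -[/= _ _ H]; split => //=.
  by rewrite H (conv_diag m wc wsh lx).
rewrite -(conv_revK sh0 shD msh wc oc ly) H (conv_diag m (wiener_rev wc) wsh lcx).
by rewrite (conv_revK sh0 shD msh wc oc lx).
Qed.

End DiagonalGraphs.

(** * The braided multiplicative unitary *)

Section Legs.
Variables (R : realType) (q : R).
Hypothesis hq : 0 < q < 1.
Variable F : op R (L * L)%type.
Hypothesis FE : eq_op_l2 F (CF q).
Local Notation C := R[i].
Implicit Types I K : choiceType.

Definition sh12 (K : choiceType) (j : int) (a : L * L * K) : L * L * K := (shF j a.1, a.2).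
Definition m12 (K : choiceType) (a : L * L * K) : int := mF a.1.
Definition sh23 (I : choiceType) (j : int) (a : I * L * L) : I * L * L :=
  (a.1.1, (shF j (a.1.2, a.2)).1, (shF j (a.1.2, a.2)).2).
Definition m23 (I : choiceType) (a : I * L * L) : int := mF (a.1.2, a.2).

Lemma sh12_0 K (a : L * L * K) : sh12 0 a = a.
Proof. by rewrite /sh12 shF0; case: a. Qed.

Lemma sh12_D K i j (a : L * L * K) : sh12 (i + j) a = sh12 i (sh12 j a).
Proof. by rewrite /sh12 shFD. Qed.

Lemma m12_sh K j (a : L * L * K) : m12 (sh12 j a) = m12 a.
Proof. exact: mF_sh. Qed.

Lemma sh23_0 I (a : I * L * L) : sh23 0 a = a.
Proof. by rewrite /sh23 shF0; case: a => -[]. Qed.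

Lemma sh23_D I i j (a : I * L * L) : sh23 (i + j) a = sh23 i (sh23 j a).
Proof.
case: a => -[i0 b] c; rewrite /sh23 shFD; set p := shF j (b, c).
by rewrite -/p -[in RHS](surjective_pairing p).
Qed.

Lemma m23_sh I j (a : I * L * L) : m23 (sh23 j a) = m23 a.
Proof.
case: a => -[i0 b] c; rewrite /m23 /sh23; set p := shF j (b, c).
by rewrite -[mF (b, c)](mF_sh j) -/p [in RHS](surjective_pairing p).
Qed.

Definition F12 (K : choiceType) : op R (L * L * K)%type := conv (@sh12 K) (@m12 K) (fqc q).
Definition F23 (I : choiceType) : op R (I * L * L)%type := conv (@sh23 I) (@m23 I) (fqc q).

Let wF := fqc_wienerP hq.

Lemma leg12_F K (x : vec R (L * L * K)%type) : l2 x -> leg12 F x = F12 x.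
Proof.
move=> lx; apply/funext => -[[a b] c]; rewrite /leg12 FE.
  by apply: eq_csum => j /=; rewrite /m12 /sh12 -surjective_pairing.
by apply: (l2_comp _ lx) => -[b1 b2] [c1 c2] [-> ->].
Qed.

Lemma leg23_F I (x : vec R (I * L * L)%type) : l2 x -> leg23 F x = F23 x.
Proof.
move=> lx; apply/funext => -[[a b] c]; rewrite /leg23 FE.
  by apply: eq_csum => j.
by apply: (l2_comp _ lx) => -[b1 b2] [c1 c2] [-> ->].
Qed.

Lemma l2_F12 K (x : vec R (L * L * K)%type) : l2 x -> l2 (F12 x).
Proof.
by move=> lx; have [] := conv_l2 (@sh12_0 K) (@sh12_D K) (@m12_sh K) wF lx.
Qed.

Lemma l2_F23 I (x : vec R (I * L * L)%type) : l2 x -> l2 (F23 x).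
Proof.
by move=> lx; have [] := conv_l2 (@sh23_0 I) (@sh23_D I) (@m23_sh I) wF lx.
Qed.

(** The maps [s] act on coordinates, T x a = x (s a); the permutation of the basis itself is the
    inverse [t]. Composing operators thus composes the [s] in reverse order. *)
Definition sW (a : H * H) : H * H := (a.1, a.2 - a.1).
Definition sU (a : L * H) : L * H := (a.1, a.2 - a.1.2).
Definition sV (a : H * L) : H * L := (a.1, (a.2.1 - a.1, a.2.2)).
Definition sZ (a : L * L) : L * L := (a.1, (a.2.1 + a.1.2, a.2.2)).
Definition opZ : op R (L * L)%type := fun x a => x (sZ a).

Definition tW (a : H * H) : H * H := (a.1, a.2 + a.1).
Definition tU (a : L * H) : L * H := (a.1, a.2 + a.1.2).
Definition tV (a : H * L) : H * L := (a.1, (a.2.1 + a.1, a.2.2)).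
Definition tZ (a : L * L) : L * L := (a.1, (a.2.1 - a.1.2, a.2.2)).

Lemma sWK : cancel sW tW. Proof. by case=> a b; rewrite /sW /tW /= subrK. Qed.
Lemma tWK : cancel tW sW. Proof. by case=> a b; rewrite /sW /tW /= addrK. Qed.
Lemma sUK : cancel sU tU. Proof. by case=> a b; rewrite /sU /tU /= subrK. Qed.
Lemma tUK : cancel tU sU. Proof. by case=> a b; rewrite /sU /tU /= addrK. Qed.
Lemma sVK : cancel sV tV. Proof. by case=> a [b c]; rewrite /sV /tV /= subrK. Qed.
Lemma tVK : cancel tV sV. Proof. by case=> a [b c]; rewrite /sV /tV /= addrK. Qed.
Lemma sZK : cancel sZ tZ. Proof. by case=> a [b c]; rewrite /sZ /tZ /= addrK. Qed.
Lemma tZK : cancel tZ sZ. Proof. by case=> a [b c]; rewrite /sZ /tZ /= subrK. Qed.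

Lemma opWE x a : @opW R x a = x (sW a). Proof. by case: a. Qed.
Lemma opUE x a : @opU R x a = x (sU a). Proof. by case: a => -[]. Qed.
Lemma opVE x a : @opV R x a = x (sV a). Proof. by case: a => ? []. Qed.

Lemma permutes_W : permutes (@opW R) sW.
Proof. by split; [exists tW; [exact: sWK|exact: tWK]|exact: opWE]. Qed.
Lemma permutes_U : permutes (@opU R) sU.
Proof. by split; [exists tU; [exact: sUK|exact: tUK]|exact: opUE]. Qed.
Lemma permutes_V : permutes (@opV R) sV.
Proof. by split; [exists tV; [exact: sVK|exact: tVK]|exact: opVE]. Qed.
Lemma permutes_Z : permutes opZ sZ.
Proof. by split; [exists tZ; [exact: sZK|exact: tZK]|]. Qed.

Lemma W_pentagon x : (leg23 (@opW R) \o leg12 (@opW R) : op R (H * H * H)%type) x =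
  (leg12 (@opW R) \o leg13 (@opW R) \o leg23 (@opW R)) x.
Proof.
apply/funext => -[[k l] m] /=; rewrite /leg12 /leg13 /leg23 !opWE /sW /=.
by congr (x (_, _, _)); ring.
Qed.

Lemma WU_relation x : (leg23 (@opW R) \o leg12 (@opU R) : op R (L * H * H)%type) x =
  (leg12 (@opU R) \o leg13 (@opU R) \o leg23 (@opW R)) x.
Proof.
apply/funext => -[[k l] m] /=; rewrite /leg12 /leg13 /leg23 !opWE !opUE opWE /sW /sU /=.
by congr (x (_, _, _)); ring.
Qed.

Lemma VW_relation x : (leg23 (@opV R) \o leg12 (@opW R) : op R (H * H * L)%type) x =
  (leg12 (@opW R) \o leg13 (@opV R) \o leg23 (@opV R)) x.
Proof.
apply/funext => -[[k l] m] /=; rewrite /leg12 /leg13 /leg23 !opVE !opWE !opVE /sW /sV /=.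
by congr (x (_, _, (_, _))); ring.
Qed.

Lemma YD_relation x : (leg23 (@opU R) \o leg13 (@opW R) \o leg12 (@opV R) : op R (H * L * H)%type) x =
  (leg12 (@opV R) \o leg13 (@opW R) \o leg23 (@opU R)) x.
Proof.
apply/funext => -[[k l] m] /=.
rewrite /leg12 /leg13 /leg23 !opUE !opWE !opVE !opWE !opUE /sW /sV /sU /=.
by congr (x (_, _, _)); ring.
Qed.

Lemma opZ_braiding : braiding_of (@opU R) (@opV R) opZ.
Proof.
split; first exact: permutes_unitary permutes_Z.
move=> x _; apply/funext => -[[a m] [n p]] /=.
rewrite /leg12 /leg13 /leg23 opVE (adj_permutes sUK tUK opUE) (adj_permutes sVK tVK opVE).
rewrite !opUE /opZ /sZ /sV /tU /tV /sU /=.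
by congr (x (_, _, (_, _))); ring.
Qed.

(** U_13 U_23 translates m by the sum of the second indices of the two L factors, which the shift
    [shF] leaves unchanged. *)
Lemma UF_relation : eq_op_l2
  (leg13 (@opU R) \o leg23 (@opU R) \o leg12 F : op R (L * L * H)%type)
  (leg12 F \o leg13 (@opU R) \o leg23 (@opU R)).
Proof.
have E (y : vec R (L * L * H)%type) : leg13 (@opU R) (leg23 (@opU R) y) =
    fun a => y (a.1, a.2 - a.1.1.2 - a.1.2.2).
  apply/funext => -[[a b] m]; rewrite /leg13 /leg23 !opUE /sU /=.
  by congr (y (_, _, _)); ring.
move=> x lx /=; rewrite !E (leg12_F lx) leg12_F; last first.
  apply: (l2_comp _ lx) => -[a m] [b n] /= [-> h]; congr pair.
  by move: h => /addIr/addIr.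
apply/funext => -[[[k l] [n p]] m]; apply: eq_csum => j /=.
rewrite /m12 /sh12 /shF /=; congr (_ * x (_, _)); ring.
Qed.

(** V_13 V_12 translates the first indices of both L factors by the same amount, and the level [mF]
    depends only on their difference. *)
Lemma VF_relation : eq_op_l2
  (leg13 (@opV R) \o leg12 (@opV R) \o leg23 F : op R (H * L * L)%type)
  (leg23 F \o leg13 (@opV R) \o leg12 (@opV R)).
Proof.
have E (y : vec R (H * L * L)%type) : leg13 (@opV R) (leg12 (@opV R) y) =
    fun a => y (a.1.1, (a.1.2.1 - a.1.1, a.1.2.2), (a.2.1 - a.1.1, a.2.2)).
  by apply/funext => -[[m a] b]; rewrite /leg13 /leg12 !opVE.
move=> x lx /=; rewrite !E (leg23_F lx) leg23_F; last first.
  apply: (l2_comp _ lx) => -[[m [k l]] [n p]] [[m' [k' l']] [n' p']] /= [-> h1 -> h2 ->].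
  by rewrite (addIr _ h1) (addIr _ h2).
apply/funext => -[[m [k l]] [n p]]; apply: eq_csum => j /=.
rewrite /m23 /sh23 /shF /mF /=; congr ((fqc q j _)%:C * _); ring.
Qed.

End Legs.

Lemma rsummable_dep (R : realType) (I J : choiceType) (c : I -> R) (d : I -> J -> R) A :
  rsummable c -> (forall i, rsummable (d i)) -> (forall i, rsum (fun j => `|d i j|) <= A) ->
  rsummable (fun p : I * J => c p.1 * d p.1 p.2) /\
  rsum (fun p : I * J => `|c p.1 * d p.1 p.2|) <= A * rsum (fun i => `|c i|).
Proof.
move=> sc sd dA; have sac := rsummable_abs sc.
have E i : rsum (fun j => `|c i * d i j|) = `|c i| * rsum (fun j => `|d i j|).
  by rewrite -(rsumZ _ (rsummable_abs (sd i))); apply: eq_rsum => j; rewrite normrM.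
have le i : rsum (fun j => `|c i * d i j|) <= A * `|c i|.
  by rewrite E mulrC ler_wpM2r.
have sE : rsummable (fun i => rsum (fun j => `|c i * d i j|)).
  apply: (rsummable_le _ (rsummableZ A sac)) => i; rewrite ger0_norm//.
  by apply: rsum_ge0 => j.
have S : rsummable (fun p : I * J => c p.1 * d p.1 p.2).
  by apply: rsummable_pair => [i|]; [exact: (rsummableZ (c i) (sd i))|exact: sE].
split; first exact: S.
have [_ _ ->] := rsum_pair (rsummable_abs S).
rewrite -(rsumZ _ sac); exact: (ler_rsum sE (rsummableZ A sac) le).
Qed.

(** * The braided pentagon equation *)

Section Pentagon.
Variables (R : realType) (q : R).
Hypothesis hq : 0 < q < 1.
Variable F : op R (L * L)%type.
Hypothesis FE : eq_op_l2 F (CF q).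
Local Notation C := R[i].
Local Notation normc := Normc.normc.
Local Notation L3 := (L * L * L)%type.
Local Notation opB := (@opZ R \o @flip R L).

Let wF := fqc_wienerP hq.

Definition sB (a : L * L) : L * L := ((a.2.1 + a.1.2, a.2.2), a.1).
Definition tB (a : L * L) : L * L := (a.2, (a.1.1 - a.2.2, a.1.2)).

Lemma sBK : cancel sB tB. Proof. by case=> -[a b] [c d]; rewrite /sB /tB /= addrK. Qed.
Lemma tBK : cancel tB sB. Proof. by case=> -[a b] [c d]; rewrite /sB /tB /= subrK. Qed.

Lemma opBE x a : opB x a = x (sB a). Proof. by []. Qed.

(* B_23 F_12 B_23^* is the convolution F13 below: its weight is q^-1 times the
   product of the weights of X_12 and X_23. *)
Definition sh13 (j : int) (a : L3) : L3 :=
  (a.1.1.1, a.1.1.2 + j, a.1.2, (a.2.1, a.2.2 - j)).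
Definition m13 (a : L3) : int := m12 a + m23 a - 1.
Definition F13 : op R L3 := conv sh13 m13 (fqc q).

Lemma sh13_0 a : sh13 0 a = a.
Proof. by case: a => -[[k l] b] [n p]; rewrite /sh13 /= addr0 subr0. Qed.

Lemma sh13_D i j a : sh13 (i + j) a = sh13 i (sh13 j a).
Proof.
by case: a => -[[k l] b] [n p]; rewrite /sh13 /=; congr (_, _, _, (_, _)); ring.
Qed.

Lemma m13_sh j a : m13 (sh13 j a) = m13 a.
Proof.
case: a => -[[k l] [n' p']] [n p]; rewrite /m13 /m12 /m23 /mF /sh13 /=; ring.
Qed.

Lemma braided_leg13 x : l2 x -> leg23 opB (leg12 F (leg23 (adj opB) x)) = F13 x.
Proof.
move=> lx; have E : leg23 (adj opB) x = fun a => x (a.1.1, a.2, (a.1.2.1 - a.2.2, a.1.2.2)).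
  apply/funext => -[[a b] c]; rewrite /leg23 (adj_permutes sBK tBK) //.
rewrite E (leg12_F FE); last first.
  apply: (l2_comp _ lx) => -[[a [b1 b2]] [c1 c2]] [[a' [b1' b2']] [c1' c2']] /= [-> -> -> h ->].
  by rewrite (addIr _ h).
apply/funext => -[[[k1 l1] [k2 l2]] [k3 l3]]; rewrite /leg23 opBE; apply: eq_csum => j /=.
rewrite /m13 /m12 /m23 /mF /sh12 /sh13 /shF /=.
by congr ((fqc q j _)%:C * x (_, _, (_, _))); ring.
Qed.

Section Point.
Variables (x : vec R L3) (al : L3).
Hypothesis lx : l2 x.
Let a := m12 al.
Let b := m23 al.
Let P (s t : int) : C := x (sh12 (- s) (sh23 (- t) al)).
(** Summand of the right side: the indices w, (r, u) are the shifts made by [F12], [F13] and [F23],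
    and each level accounts for the shifts made before. *)
Let f (p : int * (int * int)) : C :=
  (fqc q p.1 a * (fqc q p.2.1 (a + b - 1 - p.1) * fqc q p.2.2 (b - p.1 - p.2.1)))%:C *
  P (p.1 + p.2.1) (p.2.1 + p.2.2).
(** Summand of the left side after the product formula: the indices (t, s) are the total shifts
    along [sh23] and [sh12], and r is the index of [pent_sum]. *)
Let h (p : (int * int) * int) : C :=
  (pent_term q p.1.2 p.1.1 (a + p.1.1) (b - p.1.2) p.2)%:C * P p.1.2 p.1.1.

(** The levels of the inner sums depend on the outer indices, but the Wiener bound is uniform in the
    level, so the bounds multiply. *)
Lemma pentagon_summable : csummable f.
Proof.
pose A := wiener_bound q.
have S1 w := @rsummable_dep R _ _ (fun r => fqc q r (a + b - 1 - w))
  (fun r u => fqc q u (b - w - r)) A (wF _).1 (fun r => (wF _).1) (fun r => (wF _).2).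
have A0 : 0 <= A by exact: wiener_bound_ge0.
have S2 w : rsum (fun p : int * int => `|fqc q p.1 (a + b - 1 - w) * fqc q p.2 (b - w - p.1)|)
    <= A * A.
  by apply: le_trans (S1 w).2 _; rewrite ler_wpM2l//; exact: (wF _).2.
have [S3 _] := @rsummable_dep R _ _ (fun w => fqc q w a)
  (fun w (p : int * int) => fqc q p.1 (a + b - 1 - w) * fqc q p.2 (b - w - p.1))
  _ (wF a).1 (fun w => (S1 w).1) S2.
apply: (csummable_le _ (rsummableZ (1 + sqn x) (rsummable_abs S3))) => p.
by rewrite normcM normc_real [leLHS]mulrC; apply: ler_wpM2r; [exact: normr_ge0|exact: (normc_le_l2 lx)].
Qed.

(** The middle operator shifts along both pairs, hence s = w + r and t = r + u. *)
Lemma pentagon_reindex : bijective (fun p : int * (int * int) =>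
  ((p.2.1 + p.2.2, p.1 + p.2.1), p.2.1)).
Proof.
exists (fun p => (p.1.2 - p.2, (p.2, p.1.1 - p.2))).
  by move=> [w [r u]] /=; congr (_, (_, _)); ring.
by move=> [[t s] r] /=; congr ((_, _), _); ring.
Qed.

Lemma pentagon_f_h p : f p = h (p.2.1 + p.2.2, p.1 + p.2.1, p.2.1).
Proof.
case: p => w [r u]; rewrite /f /h /pent_term; cbn [fst snd].
rewrite [w + r - r]addrK [a + (r + u) - (r + u)]addrK.
rewrite (_ : a + (r + u) + (b - (w + r)) - 1 - (r + u) + r = a + b - 1 - w); last by ring.
rewrite (_ : r + u - r = u); last by ring.
rewrite (_ : b - (w + r) = b - w - r); last by ring.
by rewrite [X in X%:C * _ = _]mulrA.
Qed.

Lemma pentagon_h_summable : csummable h.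
Proof.
apply: (csummable_bij pentagon_reindex); have := pentagon_summable.
by congr csummable; apply/funext => p; rewrite pentagon_f_h.
Qed.

Lemma pentagon_csum : csum f = csum h.
Proof.
rewrite -[RHS](csum_bij _ pentagon_reindex); apply: eq_csum => p; exact: pentagon_f_h.
Qed.

Lemma pentagon_lhs : F23 q (F12 q x) al = csum h.
Proof.
have [_ s2 ->] := csum_pair pentagon_h_summable.
have [_ _ ->] := csum_pair s2.
apply: eq_csum => t; rewrite -(csumZ _ (conv_summable _ _ _ wF lx)).
apply: eq_csum => s /=; rewrite mulrA -realCM -/(P s t).
(* The shift along the second pair lowers the second index of the middle factor by t, which raises
   the level of the first pair by t. *)
have -> : m12 (sh23 (- t) al) = a + t.
  by rewrite /a; case: (al) => -[[k1 l1] [k2 l2]] [k3 l3]; rewrite /m12 /sh23 /mF /shF /=; ring.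
rewrite -/b (_ : fqc q t b * fqc q s (a + t) = pent_sum q s t (a + t) (b - s)); last first.
  by rewrite -(product_formula hq) mulrC subrK.
rewrite /pent_sum -csum_real mulrC -csumZ.
  by apply: eq_csum => r; rewrite mulrC.
by apply: (csummable_le _ (rsummable_abs (pent_summable hq s t (a + t) (b - s)))) => r; rewrite normc_real.
Qed.

Lemma pentagon_rhs : F12 q (F13 (F23 q x)) al = csum f.
Proof.
have lF := l2_F23 hq lx; have [s1 _ ->] := csum_pair pentagon_summable.
apply: eq_csum => w; have [_ _ ->] := csum_pair (s1 w).
rewrite -(csumZ _ (conv_summable _ _ _ wF lF)); apply: eq_csum => r.
rewrite -(csumZ _ (conv_summable _ _ _ wF lx)) -csumZ; last first.
  exact: (csummableZ _ (conv_summable _ _ _ wF lx)).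
apply: eq_csum => u /=; rewrite /f /= !realCM !mulrA /P /a /b.
case: (al) => -[[k1 l1] [k2 l2]] [k3 l3]; rewrite /m13 /m12 /m23 /sh12 /sh13 /sh23 /mF /shF /=.
congr ((fqc q _ _)%:C * (fqc q _ _)%:C * (fqc q _ _)%:C * x (_, _, (_, _), (_, _))); ring.
Qed.

End Point.

Lemma F_pentagon : eq_op_l2 (leg23 F \o leg12 F : op R L3)
  (leg12 F \o leg23 opB \o leg12 F \o leg23 (adj opB) \o leg23 F).
Proof.
move=> x lx /=; have lF := l2_F23 hq lx.
rewrite (leg23_F FE lx) (braided_leg13 lF) (leg12_F FE lx) (leg23_F FE (l2_F12 hq lx)).
rewrite (leg12_F FE); last first.
  by have [l _] := conv_l2 sh13_0 sh13_D m13_sh wF lF.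
by apply/funext => al; rewrite (pentagon_lhs al lx) (pentagon_rhs al lx) pentagon_csum.
Qed.

End Pentagon.

(** * Manageability and the operators Q_L and Y *)

Section Manageability.
Variables (R : realType) (q : R).
Hypothesis hq : 0 < q < 1.
Local Notation C := R[i].
Local Notation J := (L * L)%type.

Let q0 : 0 < q. Proof. by case/andP: hq. Qed.

Lemma l2_tens (I K : choiceType) (x : vec R I) (y : vec R K) : l2 x -> l2 y -> l2 (tens x y).
Proof.
move=> /l2P lx /l2P ly; apply/l2P.
have [S _] := rsummable_dep lx (fun=> ly) (fun=> lexx _).
by move: S; congr rsummable; apply/funext => p; rewrite /tens normcM exprMn.
Qed.

Lemma unitary_comp (I : choiceType) (S T : op R I) : unitary S -> unitary T -> unitary (S \o T).
Proof.
move=> [lS l2S ipS sS] [lT l2T ipT sT]; split => /=.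
- move=> c x y lx ly.
  by rewrite -[X in _ = X](lS c _ _ (l2T _ lx) (l2T _ ly)) -(lT c x y lx ly).
- by move=> x lx; apply: l2S; exact: l2T.
- by move=> x y lx ly; rewrite (ipS _ _ (l2T _ lx) (l2T _ ly)) (ipT _ _ lx ly).
- move=> y ly; have [z lz <-] := sS y ly; have [x lx <-] := sT z lz; by exists x.
Qed.

(** W is diagonal in its first leg, so W itself is the second unitary: exchanging x and y with their
    conjugates only permutes the factors of each term. *)
Lemma W_manageable : manageable_by (@opW R) (id_graph R H).
Proof.
rewrite id_graphE; split; first by apply: diag_strictly_positive => i; exact: ltr01.
  by rewrite tens_graph_diag; apply: commutes_permutes (permutes_W R) _.
exists (@opW R); first exact: permutes_unitary (permutes_W R).
move=> x y u Qu v v' lx ly [/= _ _ ->] [/= _ _ ->]; rewrite !ipE; apply: eq_csum => -[k m].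
by rewrite !opWE /tens /cvec /sW; cbn [fst snd]; rewrite !conjcM conjcK conjc1 !mul1r; ring.
Qed.

(** The shift of the second index by j turns these weights into the power of q that occurs in
    [fqc_sym]. *)
Definition wL (a : L) : R := q ^ (- a.2).

(** Y arises from Z^* F by transposing the first leg: the shift there is reversed, so both second
    indices now move in the same direction, and [mY] is the level m - j of [fqc_sym] in the new
    coordinates. [coefY] is the right side of [fqc_sym] without its power of q. *)
Definition shY (j : int) (a : J) : J := ((a.1.1, a.1.2 - j), (a.2.1, a.2.2 - j)).
Definition mY (a : J) : int := 2 * (a.1.1 - a.2.1) + a.1.2 - a.2.2 + 1.
Definition coefY (j m : int) : R := (-1) ^ j * fqc q (- j) m.
Definition opY : op R J := conv shY mY coefY \o (fun x a => x (tZ a)).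

Lemma shY0 a : shY 0 a = a.
Proof. by case: a => -[k l] [n p]; rewrite /shY /= !subr0. Qed.

Lemma shYD i j a : shY (i + j) a = shY i (shY j a).
Proof.
by case: a => -[k l] [n p]; rewrite /shY /=; congr ((_, _), (_, _)); ring.
Qed.

Lemma mY_sh j a : mY (shY j a) = mY a.
Proof. by case: a => -[k l] [n p]; rewrite /mY /shY /=; ring. Qed.

Lemma coefY_norm j m : `|coefY j m| = `|fqc q (- j) m|.
Proof.
rewrite normrM (_ : `|(-1) ^ j| = 1) ?mul1r//.
by case: j => n; rewrite /exprz ?normfV normrX normrN1 expr1n ?invr1.
Qed.

Lemma coefY_wiener : wiener coefY (wiener_bound q).
Proof.
move=> n; have [s1 s2] := wiener_rev (fqc_wienerP hq) n; split.
  by apply: (rsummable_le _ (rsummable_abs s1)) => j; rewrite coefY_norm.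
by rewrite (eq_rsum (g := fun j => `|crev (fqc q) j n|))// => j; rewrite coefY_norm.
Qed.

Lemma coefY_orthogonal : orthogonal_coef coefY.
Proof.
move=> k n; have [s1 _] := wiener_rev (fqc_wienerP hq) n.
pose g i : R := crev (fqc q) i n * crev (fqc q) (i + k) n.
have sg2 (i : int) : (-1) ^ i * (-1) ^ i = 1 :> R by rewrite -expfzMl mulrNN mulr1 exp1rz.
have E i : coefY i n * coefY (i + k) n = (-1) ^ k * g i.
  rewrite /coefY expfzDr ?oppr_eq0 ?oner_eq0// /g /crev.
  have H (u v A B : R) : u * u = 1 -> u * A * (u * v * B) = v * (A * B).
    by move=> uu; rewrite (_ : _ * _ = u * u * (v * (A * B))); [rewrite uu mul1r|ring].
  exact: H.
have sg : rsummable g.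
  apply: (rsummable_le _ (rsummableZ (fqc_bound q) (rsummable_abs s1))) => i.
  rewrite /g normrM mulrC; apply: ler_wpM2r; first exact: normr_ge0.
  exact: fqc_le_bound.
have gE : rsum g = (- k == 0)%:R.
  rewrite -(fqc_orthogonal hq (- k) n) -(rsum_bij g oppz_bij); apply: eq_rsum => i.
  by rewrite /g /crev; cbn beta delta [comp]; rewrite opprK [- (- i + k)]opprD opprK.
rewrite (eq_rsum E) (rsumZ _ sg) gE.
by rewrite oppr_eq0; have [->|_] := eqVneq k 0; rewrite ?expr0z ?mul1r ?mulr0.
Qed.

Lemma Y_unitary : unitary opY.
Proof.
have uc := conv_unitary shY0 shYD mY_sh coefY_wiener coefY_orthogonal.
have up : unitary (fun (x : vec R J) a => x (tZ a)).
  by apply: (permutes_unitary (s := tZ)); split=> //; exists sZ; [exact: tZK|exact: sZK].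
exact: (unitary_comp uc up).
Qed.

Variable F : op R J.
Hypothesis FE : eq_op_l2 F (CF q).

Let wF := fqc_wienerP hq.

Lemma wL_gt0 a : 0 < wL a. Proof. exact: qz_gt0. Qed.

Lemma U_commutes : commutes (@opU R) (tens_graph (diag_graph wL) (id_graph R H)).
Proof.
by rewrite id_graphE tens_graph_diag; apply: commutes_permutes (permutes_U R) _.
Qed.

Lemma V_commutes : commutes (@opV R) (tens_graph (id_graph R H) (diag_graph wL)).
Proof.
by rewrite id_graphE tens_graph_diag; apply: commutes_permutes (permutes_V R) _.
Qed.

Lemma F_commutes : commutes F (tens_graph (diag_graph wL) (diag_graph wL)).
Proof.
rewrite tens_graph_diag.
apply: (commutes_conv shF0 shFD mF_sh wF (fqc_orthogonal hq) _ FE) => j -[[k l] [n p]].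
by rewrite /wL /shF /= -!(qzD hq); congr (q ^ _); ring.
Qed.

Lemma F_manageable : manageability_identity (adj (@opZ R) \o F) opY (diag_graph wL).
Proof.
move=> x y u Qu v v' lx ly [/= lu lQu QuE] [/= lv' lv vE].
have lyv := l2_tens ly lv; have [lCyv _] := conv_l2 shF0 shFD mF_sh wF lyv.
have lxu : l2 (fun b => tens x u (sZ b)) := l2_comp (can_inj sZK) (l2_tens lx lu).
have lxv : l2 (fun b => tens (cvec x) v' (tZ b)).
  exact: (l2_comp (can_inj tZK) (l2_tens (l2_conj lx) lv')).
have lyu := l2_tens (l2_conj ly) lQu.
have sZ_bij : bijective sZ by exists tZ; [exact: sZK|exact: tZK].
have -> : ip (tens x u) ((adj (@opZ R) \o F) (tens y v)) =
    ip (fun b => tens x u (sZ b)) (CF q (tens y v)).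
  rewrite !ipE -[LHS](csum_bij _ sZ_bij); apply: eq_csum => b.
  by rewrite /= (adj_permutes sZK tZK)// sZK FE.
rewrite (ip_conv shF0 shFD mF_sh wF lyv lxu) (ip_conv shY0 shYD mY_sh coefY_wiener lxv lyu).
(* The base point on the right carries the index (k, l - j) of y in its first leg and the index (n +
   l, p) of u in its second. *)
have e_bij : bijective (fun p : J * int =>
    ((p.1.1.1, p.1.1.2 - p.2, (p.1.2.1 + p.1.1.2, p.1.2.2)), p.2) : J * int).
  exists (fun p : J * int => ((p.1.1.1, p.1.1.2 + p.2, (p.1.2.1 - (p.1.1.2 + p.2), p.1.2.2)), p.2)).
    by move=> [[[k l] [n p]] j] /=; rewrite subrK addrK.
  by move=> [[[k l] [n p]] j] /=; rewrite subrK addrK.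
rewrite -[RHS](csum_bij _ e_bij); apply: eq_csum => -[[[k l] [n p]] j].
rewrite /tens /cvec /sZ /tZ /shY /mY /shF /mF QuE vE; cbn [fst snd].
rewrite /wL /coefY; cbn [fst snd].
cbv beta delta [comp]; cbn [fst snd].
rewrite !(opprK j) (subrK j l) (addrK l n) !conjcM conjcK conjc_real.
(* The power q^(- (p + j)) comes from Q_L^(-1) v at the shifted index and q^(- p) from Q_L u; their
   ratio is the q^j of the symmetry. *)
have key : fqc q j (2 * (k - n) - (l + p) + 1) * q ^ (- (p + j)) =
    q ^ (- p) * ((-1) ^ j * fqc q (- j) (2 * (k - (n + l)) + (l - j) - p + 1)).
  rewrite (fqc_sym hq) -[- q]mulN1r expfzMl [- (p + j)]opprD (qzD hq).
  rewrite (_ : 2 * (k - n) - (l + p) + 1 - j = 2 * (k - (n + l)) + (l - j) - p + 1); last by ring.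
  have qj : q ^ j != 0 := expfz_neq0 j (lt0r_neq0 q0).
  rewrite (qzN q j); move: ((-1) ^ j) (q ^ (- p)) (fqc _ _ _) (q ^ j) qj => s b f t t0.
  by field.
have H (X U Y V A B D E : C) : A * B = D * E ->
    X * U * (A * (Y * (B * V))) = Y * (D * U) * (E * (X * V)).
  move=> AB; rewrite (_ : X * U * _ = X * U * Y * V * (A * B)); last by ring.
  by rewrite AB; ring.
by apply: H; rewrite -!realCM key.
Qed.

End Manageability.

Theorem theorem4p7 (R : realType) (q : R) (hq : 0 < q < 1)
    (F : op R (L * L)%type)
    (hF : borel_calculus (opX q) (@Cbar_q R q) (qexp q) F) :
  manageable_top_braided_mu (@opW R) (id_graph R H) (@opU R) (@opV R) F.
Proof.
have FE := borel_calculus_conv hq hF.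
have uC := conv_unitary shF0 shFD mF_sh (fqc_wienerP hq) (fqc_orthogonal hq).
have uF : unitary F by apply: (unitary_eq _ uC) => x lx; rewrite FE.
split.
- by split; [exact: permutes_unitary (permutes_W R)|move=> x _; exact: W_pentagon].
- exact: W_manageable.
exists (@opZ R); split.
  split.
  - exact: permutes_unitary (permutes_U R).
  - exact: permutes_unitary (permutes_V R).
  - exact: uF.
  - exact: opZ_braiding.
  - by move=> x _; exact: WU_relation.
  - by move=> x _; exact: VW_relation.
  - by move=> x _; exact: YD_relation.
  - exact: UF_relation FE.
  - exact: VF_relation FE.
  - exact: F_pentagon hq _ FE.
exists (diag_graph (wL q)), (opY q); split.
- by split; [apply: diag_strictly_positive; exact: wL_gt0|exact: Y_unitary].
- exact: U_commutes.
- exact: V_commutes.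
- exact: F_commutes hq _ FE.
- exact: F_manageable hq _ FE.
Qed.
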